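(* Let $\Omega\subset\mathbb{R}^N$ be a bounded domain and $j\in\{1,\dots,N\}$; let $u_0\in C(\overline\Omega)$ with $u_0|_{\partial\Omega}=g$. Let $\Omega_R$ be a strictly convex bounded domain with $\overline{\Omega}\subset\Omega_R$, and let $\mu_R>0$ and $\psi_R\in C(\overline{\Omega_R})$ be such that $\psi_R>0$ in $\Omega_R$, $\psi_R=0$ on $\partial\Omega_R$ and $-\lambda_N(D^2\psi_R)=\mu_R\psi_R$ in $\Omega_R$ in the viscosity sense; set $\varphi_R=-\psi_R$ (so $\varphi_R<0$ in $\Omega_R$, $\varphi_R=0$ on $\partial\Omega_R$, $-\lambda_1(D^2\varphi_R)=\mu_R\varphi_R$). Let $u$ be the viscosity solution of $u_t-\lambda_j(D^2u)=0$ in $\Omega\times(0,\infty)$, $u=g$ on $\partial\Omega\times(0,\infty)$, $u(\cdot,0)=u_0$, and $z$ the viscosity solution of $\lambda_j(D^2z)=0$ in $\Omega$, $z=g$ on $\partial\Omega$. Then there exist constants $C_1,C_2>0$ depending on $u_0$ such that for all $x\in\Omega$, $t>0$, \[ z(x)+C_1e^{-\mu_R t}\varphi_R(x)\le u(x,t)\le z(x)+C_2e^{-\mu_R t}\psi_R(x). \]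
   Context: $\lambda_j(A)$ is the $j$-th smallest eigenvalue of a symmetric matrix $A$, $\lambda_j(A)=\inf_{\dim S=j}\sup_{v\in S,|v|=1}\langle Av,v\rangle$. Solutions are viscosity solutions continuous up to the boundary. (Such positive eigenpairs $(\mu_R,\psi_R)$ exist for strictly convex domains.) *)

(* Defs.v *)
(* classical reals. Points of R^N are represented as
   functions nat -> R vanishing at indices >= N (predicate InRn N). *)
From Stdlib Require Import Reals Lra ClassicalEpsilon.
Open Scope R_scope.

Definition pt := nat -> R.
Definition mat := nat -> nat -> R.

Fixpoint sumN (n : nat) (f : nat -> R) : R :=
  match n with O => 0 | S m => sumN m f + f m end.

Definition InRn (N : nat) (x : pt) : Prop := forall i, (N <= i)%nat -> x i = 0.
Definition vsub (x y : pt) : pt := fun i => x i - y i.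
Definition dot (N : nat) (x y : pt) : R := sumN N (fun i => x i * y i).
Definition nrm2 (N : nat) (x : pt) : R := dot N x x.
Definition dist (N : nat) (x y : pt) : R := sqrt (nrm2 N (vsub x y)).

(* symmetric N x N matrices (entries with indices >= N are irrelevant) *)
Definition symmetric (N : nat) (X : mat) : Prop :=
  forall i k, (i < N)%nat -> (k < N)%nat -> X i k = X k i.
Definition quad (N : nat) (X : mat) (v : pt) : R :=
  sumN N (fun i => sumN N (fun k => X i k * v i * v k)).

Definition Rsup (E : R -> Prop) : R := epsilon (inhabits 0) (fun m => is_lub E m).
Definition Rinf (E : R -> Prop) : R := - Rsup (fun r => E (- r)).

Definition lin_comb (j : nat) (c : nat -> R) (vs : nat -> pt) : pt :=
  fun i => sumN j (fun l => c l * vs l i).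
Definition lin_indep (N j : nat) (vs : nat -> pt) : Prop :=
  forall c : nat -> R, (forall i, (i < N)%nat -> lin_comb j c vs i = 0) ->
    forall l, (l < j)%nat -> c l = 0.

Definition rayleigh_sup (N j : nat) (X : mat) (vs : nat -> pt) : R :=
  Rsup (fun q => exists c : nat -> R,
          nrm2 N (lin_comb j c vs) = 1 /\ q = quad N X (lin_comb j c vs)).

(* lambda_j(X) = inf_{dim S = j} sup_{v in S, |v|=1} <Xv,v>;
   subspaces of dimension j = spans of j linearly independent vectors of R^N *)
Definition lambda (N j : nat) (X : mat) : R :=
  Rinf (fun s => exists vs : nat -> pt,
          (forall l, (l < j)%nat -> InRn N (vs l)) /\ lin_indep N j vs /\
          s = rayleigh_sup N j X vs).

Definition open_in (N : nat) (U : pt -> Prop) : Prop :=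
  (forall x, U x -> InRn N x) /\
  forall x, U x -> exists r, r > 0 /\ forall y, InRn N y -> dist N x y < r -> U y.
Definition connected (N : nat) (U : pt -> Prop) : Prop :=
  forall A B : pt -> Prop, open_in N A -> open_in N B ->
    (forall x, U x <-> (A x \/ B x)) -> (forall x, ~ (A x /\ B x)) ->
    (forall x, ~ A x) \/ (forall x, ~ B x).
Definition bounded_set (N : nat) (U : pt -> Prop) : Prop :=
  exists M, forall x, U x -> nrm2 N x <= M.
Definition is_domain (N : nat) (U : pt -> Prop) : Prop :=
  open_in N U /\ connected N U /\ (exists x, U x).
Definition cl (N : nat) (U : pt -> Prop) (x : pt) : Prop :=
  InRn N x /\ forall r, r > 0 -> exists y, U y /\ dist N x y < r.
Definition boundary (N : nat) (U : pt -> Prop) (x : pt) : Prop :=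
  cl N U x /\ ~ U x.
Definition strictly_convex (N : nat) (U : pt -> Prop) : Prop :=
  forall x y, cl N U x -> cl N U y -> x <> y ->
    forall s, 0 < s < 1 -> U (fun i => (1 - s) * x i + s * y i).

Definition continuous_on (N : nat) (S : pt -> Prop) (f : pt -> R) : Prop :=
  forall x, S x -> forall eps, eps > 0 -> exists d, d > 0 /\
    forall y, S y -> dist N x y < d -> Rabs (f y - f x) < eps.
Definition continuous_on_cyl (N : nat) (S : pt -> Prop) (u : pt -> R -> R) : Prop :=
  forall x t, S x -> 0 <= t -> forall eps, eps > 0 -> exists d, d > 0 /\
    forall y s, S y -> 0 <= s -> dist N x y < d -> Rabs (s - t) < d ->
      Rabs (u y s - u x t) < eps.

Definition superjet (N : nat) (U : pt -> Prop) (f : pt -> R) (x p : pt) (X : mat) : Prop :=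
  InRn N p /\ symmetric N X /\
  forall eps, eps > 0 -> exists d, d > 0 /\ forall y, U y -> dist N x y < d ->
    f y <= f x + dot N p (vsub y x) + / 2 * quad N X (vsub y x)
           + eps * nrm2 N (vsub y x).
Definition subjet (N : nat) (U : pt -> Prop) (f : pt -> R) (x p : pt) (X : mat) : Prop :=
  InRn N p /\ symmetric N X /\
  forall eps, eps > 0 -> exists d, d > 0 /\ forall y, U y -> dist N x y < d ->
    f y >= f x + dot N p (vsub y x) + / 2 * quad N X (vsub y x)
           - eps * nrm2 N (vsub y x).

(* viscosity solution of F(x, f, D^2 f) = 0 in U, F nonincreasing in X *)
Definition visc_solution (N : nat) (U : pt -> Prop) (F : pt -> R -> mat -> R)
  (f : pt -> R) : Prop :=
  (forall x p X, U x -> superjet N U f x p X -> F x (f x) X <= 0) /\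
  (forall x p X, U x -> subjet N U f x p X -> F x (f x) X >= 0).

Definition par_superjet (N : nat) (U : pt -> Prop) (u : pt -> R -> R) (x : pt) (t a : R)
  (p : pt) (X : mat) : Prop :=
  InRn N p /\ symmetric N X /\
  forall eps, eps > 0 -> exists d, d > 0 /\ forall y s, U y -> 0 < s ->
    dist N x y < d -> Rabs (s - t) < d ->
    u y s <= u x t + a * (s - t) + dot N p (vsub y x) + / 2 * quad N X (vsub y x)
           + eps * (Rabs (s - t) + nrm2 N (vsub y x)).
Definition par_subjet (N : nat) (U : pt -> Prop) (u : pt -> R -> R) (x : pt) (t a : R)
  (p : pt) (X : mat) : Prop :=
  InRn N p /\ symmetric N X /\
  forall eps, eps > 0 -> exists d, d > 0 /\ forall y s, U y -> 0 < s ->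
    dist N x y < d -> Rabs (s - t) < d ->
    u y s >= u x t + a * (s - t) + dot N p (vsub y x) + / 2 * quad N X (vsub y x)
           - eps * (Rabs (s - t) + nrm2 N (vsub y x)).

Definition visc_solution_par (N j : nat) (U : pt -> Prop) (u : pt -> R -> R) : Prop :=
  (forall x t a p X, U x -> 0 < t -> par_superjet N U u x t a p X ->
     a - lambda N j X <= 0) /\
  (forall x t a p X, U x -> 0 < t -> par_subjet N U u x t a p X ->
     a - lambda N j X >= 0).

(* Main.v *)
(** The eigenfunction [psiR] is concave, and at each point it lies below a
    paraboloid whose opening is almost [muR * psiR]; hence adding
    [C exp(-muR t) psiR] to the stationary solution [z], or subtracting it, gives
    a supersolution, or a subsolution, of the evolution problem, without any theorem
    on sums of viscosity solutions.  The estimates then follow from the comparison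
    principle for [u_t = lambda_j(D^2 u)].

    The comparison principle needs the theorem on sums for semiconvex functions,
    proved here without Alexandrov's theorem and without measure theory.  Call a
    function good at scale [r] if it is within [eps r^2] of a quadratic polynomial on
    a ball of radius [r].  If a paraboloid touches a semiconvex function from above
    and the function is not good at that scale, then a Hopf barrier produces a nearby
    touching paraboloid, at a comparable scale, whose trace is smaller by a fixed
    amount; as the trace is bounded below, the function is good after finitely many
    steps.  Applied to the Legendre-type transform [F p = max (f - p.x)] of
    [f = U + V], this gives a ball in which every point is almost a contact
    point of [f] with an affine function; applied again to [U] inside that ball, it
    gives a quadratic polynomial that is, up to [eps r^2], simultaneously a second
    order expansion of [U] and, up to an affine function, of [-V]. *)

From Stdlib Require Import Reals Lra Lia Psatz Classical ClassicalEpsilon FunctionalExtensionality.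
Require Import Defs.
Open Scope R_scope.

(** * Vectors, quadratic forms and compactness *)

(** The classical proof of the theorem on sums intersects two sets: contact points of [f = U + V]
    with affine functions, of positive measure, and points where [U] is twice differentiable, of
    full measure. Without measure theory a common point has to be produced by hand. This is why the
    approximation is first applied to [F]: as [f] is semiconvex, [F] is strongly convex at its good
    scale, so its gradient nearly covers a ball, and a good ball for [U] found inside it consists of
    near-contact points automatically.

    Expansions are never exact, only within [eps * r ^ 2] on a ball of radius [r]. This suffices
    because the penalty [lam / (T1 - t)] leaves a fixed gap [eta] in the equation, and because
    [lambda_j] grows by at most [c] when the quadratic form grows by [c * nrm2].

    The constant in the estimates is a bound for [|u0 - z|] divided by the minimum of [psiR] over
    the closure of [Omega], positive because that closure lies in [OmegaR]; one value serves for
    [C1] and [C2]. *)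

Definition vadd (x y : pt) : pt := fun i => x i + y i.
Definition vsc (c : R) (x : pt) : pt := fun i => c * x i.
Definition mv (n : nat) (A : mat) (v : pt) : pt := fun i => sumN n (fun k => A i k * v k).
Definition nm (n : nat) (x : pt) : R := sqrt (nrm2 n x).
Definition tr (n : nat) (A : mat) : R := sumN n (fun i => A i i).
Definition madd (A B : mat) : mat := fun i k => A i k + B i k.
Definition msc (c : R) (A : mat) : mat := fun i k => c * A i k.
Definition idm (c : R) : mat := fun i k => if Nat.eqb i k then c else 0.
Definition outer (v : pt) : mat := fun i k => v i * v k.
Definition trunc (n : nat) (x : pt) : pt := fun i => if Nat.ltb i n then x i else 0.

Lemma Rabs_le_bounds x a : Rabs x <= a -> - a <= x <= a.
Proof. unfold Rabs; destruct (Rcase_abs x); lra. Qed.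

Lemma sumN_ext n f g : (forall i, (i < n)%nat -> f i = g i) -> sumN n f = sumN n g.
Proof.
induction n; simpl; intros H; auto.
rewrite IHn by (intros; apply H; lia). rewrite H by lia. reflexivity.
Qed.

Lemma sumN_le n f g : (forall i, (i < n)%nat -> f i <= g i) -> sumN n f <= sumN n g.
Proof.
induction n; simpl; intros H; [lra|].
assert (f n <= g n) by (apply H; lia).
assert (sumN n f <= sumN n g) by (apply IHn; intros; apply H; lia). lra.
Qed.

Lemma sumN_zero n : sumN n (fun _ => 0) = 0.
Proof. induction n; simpl; lra. Qed.

Lemma sumN_plus n f g : sumN n (fun i => f i + g i) = sumN n f + sumN n g.
Proof. induction n; simpl; lra. Qed.

Lemma sumN_mult n c f : sumN n (fun i => c * f i) = c * sumN n f.
Proof. induction n; simpl; lra. Qed.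

Lemma sumN_exchange n m (f : nat -> nat -> R) :
  sumN n (fun i => sumN m (fun k => f i k)) = sumN m (fun k => sumN n (fun i => f i k)).
Proof.
induction n; simpl; [now rewrite sumN_zero|].
rewrite sumN_plus, IHn; reflexivity.
Qed.

Lemma sumN_pick n i a : (i < n)%nat -> sumN n (fun k => if Nat.eqb i k then a k else 0) = a i.
Proof.
induction n; intros H; [lia|]; simpl.
destruct (Nat.eqb_spec i n) as [->|Hne].
- rewrite (sumN_ext n _ (fun _ => 0)), sumN_zero; [ring|].
  intros k Hk; destruct (Nat.eqb_spec n k); [lia|reflexivity].
- rewrite IHn by lia; ring.
Qed.

Lemma dot_ext n x y x' y' : (forall i, (i < n)%nat -> x i = x' i) ->
  (forall i, (i < n)%nat -> y i = y' i) -> dot n x y = dot n x' y'.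
Proof. intros H1 H2; apply sumN_ext; intros; rewrite H1, H2; auto. Qed.
Lemma nrm2_ext n x y : (forall i, (i < n)%nat -> x i = y i) -> nrm2 n x = nrm2 n y.
Proof. intros; apply dot_ext; auto. Qed.

Lemma dot_sym n x y : dot n x y = dot n y x.
Proof. apply sumN_ext; intros; ring. Qed.
Lemma dot_addl n x y z : dot n (vadd x y) z = dot n x z + dot n y z.
Proof. unfold dot, vadd; induction n; simpl; lra. Qed.
Lemma dot_addr n x y z : dot n z (vadd x y) = dot n z x + dot n z y.
Proof. unfold dot, vadd; induction n; simpl; lra. Qed.
Lemma dot_subl n x y z : dot n (vsub x y) z = dot n x z - dot n y z.
Proof. unfold dot, vsub; induction n; simpl; lra. Qed.
Lemma dot_subr n x y z : dot n z (vsub x y) = dot n z x - dot n z y.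
Proof. unfold dot, vsub; induction n; simpl; lra. Qed.
Lemma dot_scl n c x z : dot n (vsc c x) z = c * dot n x z.
Proof. unfold dot, vsc; induction n; simpl; lra. Qed.
Lemma dot_scr n c x z : dot n z (vsc c x) = c * dot n z x.
Proof. unfold dot, vsc; induction n; simpl; lra. Qed.

Lemma nrm2_add n x y : nrm2 n (vadd x y) = nrm2 n x + 2 * dot n x y + nrm2 n y.
Proof. unfold nrm2; rewrite dot_addl, !dot_addr, (dot_sym n y x); ring. Qed.
Lemma nrm2_sub n x y : nrm2 n (vsub x y) = nrm2 n x - 2 * dot n x y + nrm2 n y.
Proof. unfold nrm2; rewrite dot_subl, !dot_subr, (dot_sym n y x); ring. Qed.
Lemma nrm2_sc n c x : nrm2 n (vsc c x) = c * c * nrm2 n x.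
Proof. unfold nrm2; rewrite dot_scl, dot_scr; ring. Qed.
Lemma nrm2_ge0 n x : 0 <= nrm2 n x.
Proof. unfold nrm2, dot; induction n; simpl; nra. Qed.
Lemma nrm2_zero n : nrm2 n (fun _ => 0) = 0.
Proof. unfold nrm2, dot; induction n; simpl; lra. Qed.

Lemma coord_le n x i : (i < n)%nat -> x i * x i <= nrm2 n x.
Proof.
induction n; intros H; [lia|]. unfold nrm2, dot in *; simpl.
pose proof (nrm2_ge0 n x) as H0; unfold nrm2, dot in H0.
destruct (Nat.eq_dec i n) as [->|]; [lra|].
assert (x i * x i <= sumN n (fun i => x i * x i)) by (apply IHn; lia). nra.
Qed.

Lemma nrm2_eq0 n x : nrm2 n x = 0 -> forall i, (i < n)%nat -> x i = 0.
Proof. intros H i Hi; pose proof (coord_le n x i Hi); nra. Qed.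

Lemma cauchy_schwarz2 n x y : dot n x y * dot n x y <= nrm2 n x * nrm2 n y.
Proof.
destruct (Req_dec (nrm2 n y) 0) as [E|E].
- assert (dot n x y = 0) as ->; [|rewrite E; lra].
  unfold dot; rewrite (sumN_ext n _ (fun _ => 0)), sumN_zero; auto.
  intros i Hi; rewrite (nrm2_eq0 n y E i Hi); ring.
- pose proof (nrm2_ge0 n y).
  pose proof (nrm2_ge0 n (vsub (vsc (nrm2 n y) x) (vsc (dot n x y) y))) as H1.
  rewrite nrm2_sub, !nrm2_sc, dot_scl, dot_scr in H1.
  assert (0 <= nrm2 n y * (nrm2 n x * nrm2 n y - dot n x y * dot n x y)) by lra.
  assert (0 < nrm2 n y) by lra. nra.
Qed.

Lemma nm_ge0 n x : 0 <= nm n x.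
Proof. apply sqrt_pos. Qed.
Lemma nm_sq n x : nm n x * nm n x = nrm2 n x.
Proof. apply sqrt_sqrt, nrm2_ge0. Qed.
Lemma nm_le n x a : 0 <= a -> nrm2 n x <= a * a -> nm n x <= a.
Proof. intros; pose proof (nm_ge0 n x); pose proof (nm_sq n x); nra. Qed.
Lemma nm_lt n x a : 0 <= a -> nrm2 n x < a * a -> nm n x < a.
Proof. intros; pose proof (nm_ge0 n x); pose proof (nm_sq n x); nra. Qed.
Lemma nrm2_le n x a : nm n x <= a -> nrm2 n x <= a * a.
Proof. intros; pose proof (nm_ge0 n x); pose proof (nm_sq n x); nra. Qed.
Lemma dot_abs n x y : Rabs (dot n x y) <= nm n x * nm n y.
Proof.
pose proof (cauchy_schwarz2 n x y) as H.
rewrite <- !nm_sq in H. pose proof (nm_ge0 n x); pose proof (nm_ge0 n y).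
rewrite <- (Rabs_right (nm n x * nm n y)) by nra.
apply Rsqr_le_abs_0; unfold Rsqr; lra.
Qed.
Lemma dot_le n x y : dot n x y <= nm n x * nm n y.
Proof. pose proof (dot_abs n x y); pose proof (Rle_abs (dot n x y)); lra. Qed.
Lemma dot_ge n x y : - (nm n x * nm n y) <= dot n x y.
Proof. pose proof (dot_abs n x y) as H; apply Rabs_le_bounds in H; lra. Qed.
Lemma nm_add n x y : nm n (vadd x y) <= nm n x + nm n y.
Proof.
pose proof (nm_ge0 n x); pose proof (nm_ge0 n y).
apply nm_le; [lra|]. rewrite nrm2_add, <- !nm_sq. pose proof (dot_le n x y); nra.
Qed.
Lemma nm_sub n x y : nm n (vsub x y) <= nm n x + nm n y.
Proof.
pose proof (nm_ge0 n x); pose proof (nm_ge0 n y).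
apply nm_le; [lra|]. rewrite nrm2_sub, <- !nm_sq. pose proof (dot_ge n x y); nra.
Qed.
Lemma nm_sc n c x : nm n (vsc c x) = Rabs c * nm n x.
Proof.
unfold nm; rewrite nrm2_sc, sqrt_mult.
- f_equal; apply sqrt_Rsqr_abs.
- apply Rle_0_sqr.
- apply nrm2_ge0.
Qed.
Lemma nm_ext n x y : (forall i, (i < n)%nat -> x i = y i) -> nm n x = nm n y.
Proof. intros; unfold nm; f_equal; now apply nrm2_ext. Qed.
Lemma nm_sub_sym n x y : nm n (vsub x y) = nm n (vsub y x).
Proof. unfold nm; f_equal; rewrite !nrm2_sub, (dot_sym n x y); ring. Qed.
Lemma dist_nm n x y : dist n x y = nm n (vsub y x).
Proof.
unfold dist, nm; f_equal; unfold nrm2, dot; apply sumN_ext; intros; unfold vsub; ring.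
Qed.

Lemma vadd_sub x y : vadd x (vsub y x) = y.
Proof. apply functional_extensionality; intros i; unfold vadd, vsub; ring. Qed.
Lemma vsub_add x y : vsub (vadd x y) x = y.
Proof. apply functional_extensionality; intros i; unfold vadd, vsub; ring. Qed.
Lemma vadd_assoc x y z : vadd (vadd x y) z = vadd x (vadd y z).
Proof. apply functional_extensionality; intros i; unfold vadd; ring. Qed.

Lemma quad_mv n A v : quad n A v = dot n (mv n A v) v.
Proof.
unfold quad, dot, mv; apply sumN_ext; intros i _.
rewrite Rmult_comm, <- sumN_mult; apply sumN_ext; intros; ring.
Qed.
Lemma mv_sym n A u v : symmetric n A -> dot n (mv n A u) v = dot n (mv n A v) u.
Proof.
intros HA. unfold dot, mv.
transitivity (sumN n (fun i => sumN n (fun k => A i k * u k * v i))).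
- apply sumN_ext; intros i _; rewrite Rmult_comm, <- sumN_mult; apply sumN_ext; intros; ring.
- rewrite sumN_exchange. apply sumN_ext; intros i Hi.
  rewrite Rmult_comm, <- sumN_mult; apply sumN_ext; intros k Hk. rewrite (HA k i); auto; ring.
Qed.
Lemma mv_add n A u v : mv n A (vadd u v) = vadd (mv n A u) (mv n A v).
Proof.
apply functional_extensionality; intros i; unfold mv, vadd.
rewrite <- sumN_plus; apply sumN_ext; intros; ring.
Qed.
Lemma mv_sc n A c u : mv n A (vsc c u) = vsc c (mv n A u).
Proof.
apply functional_extensionality; intros i; unfold mv, vsc.
rewrite <- sumN_mult; apply sumN_ext; intros; ring.
Qed.
Lemma quad_add n A u v : symmetric n A ->
  quad n A (vadd u v) = quad n A u + 2 * dot n (mv n A u) v + quad n A v.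
Proof.
intros HA; rewrite !quad_mv, mv_add, dot_addl, !dot_addr, (mv_sym n A v u HA); ring.
Qed.
Lemma quad_sc n A c u : quad n A (vsc c u) = c * c * quad n A u.
Proof. rewrite !quad_mv, mv_sc, dot_scl, dot_scr; ring. Qed.
Lemma quad_madd n A B v : quad n (madd A B) v = quad n A v + quad n B v.
Proof.
unfold quad, madd; rewrite <- sumN_plus; apply sumN_ext; intros.
rewrite <- sumN_plus; apply sumN_ext; intros; ring.
Qed.
Lemma quad_msc n c A v : quad n (msc c A) v = c * quad n A v.
Proof.
unfold quad, msc; rewrite <- sumN_mult; apply sumN_ext; intros.
rewrite <- sumN_mult; apply sumN_ext; intros; ring.
Qed.
Lemma quad_idm n c v : quad n (idm c) v = c * nrm2 n v.
Proof.
unfold quad, idm, nrm2, dot; rewrite <- sumN_mult; apply sumN_ext; intros i Hi.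
rewrite (sumN_ext n _ (fun k => if Nat.eqb i k then c * v i * v k else 0)).
- rewrite sumN_pick by auto; ring.
- intros k Hk; destruct (Nat.eqb i k); ring.
Qed.
Lemma quad_outer n w v : quad n (outer w) v = dot n w v * dot n w v.
Proof.
unfold quad, outer, dot; rewrite <- sumN_mult; apply sumN_ext; intros i Hi.
rewrite (Rmult_comm (sumN n _)), <- sumN_mult; apply sumN_ext; intros; ring.
Qed.
Lemma tr_madd n A B : tr n (madd A B) = tr n A + tr n B.
Proof. unfold tr, madd; apply sumN_plus. Qed.
Lemma tr_msc n c A : tr n (msc c A) = c * tr n A.
Proof. unfold tr, msc; apply sumN_mult. Qed.
Lemma tr_idm n c : tr n (idm c) = INR n * c.
Proof.
unfold tr, idm. induction n; [simpl; ring|]. rewrite S_INR; simpl.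
rewrite Nat.eqb_refl, IHn; ring.
Qed.
Lemma tr_outer n v : tr n (outer v) = nrm2 n v.
Proof. reflexivity. Qed.
Lemma sym_madd n A B : symmetric n A -> symmetric n B -> symmetric n (madd A B).
Proof. intros HA HB i k Hi Hk; unfold madd; rewrite HA, HB; auto. Qed.
Lemma sym_msc n c A : symmetric n A -> symmetric n (msc c A).
Proof. intros HA i k Hi Hk; unfold msc; rewrite HA; auto. Qed.
Lemma sym_idm n c : symmetric n (idm c).
Proof. intros i k _ _; unfold idm; rewrite Nat.eqb_sym; reflexivity. Qed.
Lemma sym_outer n v : symmetric n (outer v).
Proof. intros i k _ _; unfold outer; ring. Qed.

Definition basis (i : nat) : pt := fun k => if Nat.eqb i k then 1 else 0.
Lemma dot_basis n i x : (i < n)%nat -> dot n x (basis i) = x i.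
Proof.
intros Hi; unfold dot, basis.
rewrite (sumN_ext n _ (fun k => if Nat.eqb i k then x k else 0)), sumN_pick; auto.
intros k _; destruct (Nat.eqb i k); ring.
Qed.
Lemma nrm2_basis n i : (i < n)%nat -> nrm2 n (basis i) = 1.
Proof.
intros Hi; unfold nrm2; rewrite dot_basis by auto; unfold basis; now rewrite Nat.eqb_refl.
Qed.
Lemma quad_basis n A i : (i < n)%nat -> quad n A (basis i) = A i i.
Proof.
intros Hi; rewrite quad_mv, dot_basis by auto. change (dot n (A i) (basis i) = A i i).
now apply dot_basis.
Qed.

Lemma InRn_trunc n x : InRn n (trunc n x).
Proof. intros i Hi; unfold trunc; destruct (Nat.ltb_spec i n); [lia|reflexivity]. Qed.
Lemma trunc_eq n x i : (i < n)%nat -> trunc n x i = x i.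
Proof. intros Hi; unfold trunc; destruct (Nat.ltb_spec i n); [reflexivity|lia]. Qed.

(** * Choice and sequential compactness *)

Lemma functional_choice (A B : Type) (P : A -> B -> Prop) :
  (forall x, exists y, P x y) -> exists f, forall x, P x (f x).
Proof.
intros H; exists (fun x => proj1_sig (constructive_indefinite_description _ (H x))).
intros x; apply proj2_sig.
Qed.

(** Only [k <= sg k] is asked of the extraction, not strict monotonicity: tails still go into tails,
    and composition preserves the property. *)
Lemma bw_R (u : nat -> R) M : (forall k, Rabs (u k) <= M) ->
  exists l sg, (forall k, (k <= sg k)%nat) /\
    forall eps, eps > 0 -> exists K, forall k, (K <= k)%nat -> Rabs (u (sg k) - l) < eps.
Proof.
intros HM.
destruct (Bolzano_Weierstrass u (fun c => -M <= c <= M)) as [l Hl].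
{ apply compact_P3. }
{ intros k; apply Rabs_le_bounds, HM. }
assert (Hs : forall k : nat, exists p, (k <= p)%nat /\ Rabs (u p - l) < / (INR k + 1)).
{ intros k. assert (Hp : 0 < / (INR k + 1)) by (apply Rinv_0_lt_compat; pose proof (pos_INR k); lra).
  destruct (Hl (disc l (mkposreal _ Hp)) k) as [p [H1 H2]].
  - exists (mkposreal _ Hp); intros y Hy; exact Hy.
  - exists p; split; auto. }
destruct (functional_choice _ _ _ Hs) as [sg Hsg].
exists l, sg; split; [apply Hsg|].
intros eps He. destruct (archimed_cor1 eps He) as [K [HK1 HK2]].
exists K; intros k Hk. destruct (Hsg k) as [_ H]. apply Rlt_trans with (1 := H).
apply Rle_lt_trans with (2 := HK1). apply Rinv_le_contravar.
- apply lt_0_INR; lia.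
- apply le_INR in Hk; lra.
Qed.

Lemma bw n (X : nat -> pt) M : (forall k, nrm2 n (X k) <= M) ->
  exists x sg, InRn n x /\ (forall k, (k <= sg k)%nat) /\
    forall eps, eps > 0 -> exists K, forall k, (K <= k)%nat -> nrm2 n (vsub (X (sg k)) x) < eps.
Proof.
induction n; intros HM.
- exists (fun _ => 0), (fun k => k); repeat split; auto.
  intros eps He; exists 0%nat; intros; unfold nrm2, dot; simpl; lra.
- destruct IHn as [x [sg [Hx [Hsg Hc]]]].
  { intros k; specialize (HM k); unfold nrm2, dot in *; simpl in HM; nra. }
  destruct (bw_R (fun k => X (sg k) n) (M + 1)) as [l [tau [Ht Hl]]].
  { intros k; pose proof (HM (sg k)).
    pose proof (coord_le (S n) (X (sg k)) n (Nat.lt_succ_diag_r n)).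
    apply Rabs_le; split; nra. }
  exists (fun i => if Nat.eqb i n then l else x i), (fun k => sg (tau k)).
  split; [|split].
  + intros i Hi; destruct (Nat.eqb_spec i n); [lia|apply Hx; lia].
  + intros k; apply Nat.le_trans with (tau k); auto.
  + intros eps He.
    destruct (Hc (eps / 2)) as [K1 H1]; [lra|].
    assert (He2 : Rmin 1 (eps / 2) > 0) by (apply Rmin_pos; lra).
    destruct (Hl _ He2) as [K2 H2].
    exists (max K1 K2); intros k Hk.
    assert (K1 <= tau k)%nat by (apply Nat.le_trans with k; auto; lia).
    specialize (H1 (tau k) H). specialize (H2 k ltac:(lia)).
    change (nrm2 n (vsub (X (sg (tau k))) (fun i => if Nat.eqb i n then l else x i))
     + (X (sg (tau k)) n - (if Nat.eqb n n then l else x n)) * (X (sg (tau k)) n - (if Nat.eqb n n then l else x n)) < eps).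
    rewrite Nat.eqb_refl.
    rewrite (nrm2_ext n _ (vsub (X (sg (tau k))) x)).
    2:{ intros i Hi; unfold vsub; destruct (Nat.eqb_spec i n); [lia|reflexivity]. }
    set (d := X (sg (tau k)) n - l) in *.
    assert (d * d < eps / 2); [|lra].
    rewrite <- (Rabs_right (d * d)) by nra. rewrite Rabs_mult.
    pose proof (Rmin_l 1 (eps/2)); pose proof (Rmin_r 1 (eps/2)); pose proof (Rabs_pos d).
    assert (Rabs d < eps / 2) by (unfold d in *; lra).
    assert (Rabs d < 1) by (unfold d in *; lra). nra.
Qed.

(** Adherence is tested only at points of R^n, since [dist n] ignores the coordinates from [n] on
    and distinct functions can be at distance zero. *)
Definition seq_closed (n : nat) (S : pt -> Prop) : Prop :=
  forall x, InRn n x -> (forall r, r > 0 -> exists y, S y /\ dist n x y < r) -> S x.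

Lemma cluster n S M (X : nat -> pt) :
  (forall x, S x -> nrm2 n x <= M) -> seq_closed n S -> (forall k, S (X k)) ->
  exists x, S x /\ forall d, d > 0 -> forall K, exists k, (K <= k)%nat /\ dist n x (X k) < d.
Proof.
intros HM HS HX.
destruct (bw n X M) as [x [sg [Hx [Hsg Hc]]]]; [auto|].
assert (H : forall d, d > 0 -> forall K, exists k, (K <= k)%nat /\ dist n x (X k) < d).
{ intros d Hd K. destruct (Hc (d * d)) as [K' HK']; [nra|].
  exists (sg (max K K')); split.
  - apply Nat.le_trans with (max K K'); auto; lia.
  - rewrite dist_nm; apply nm_lt; [lra|]; apply HK'; lia. }
exists x; split; auto. apply HS; auto.
intros r Hr; destruct (H r Hr 0%nat) as [k [_ Hk]]; eauto.
Qed.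

Lemma evt n S M (phi : pt -> R) :
  (exists x, S x) -> (forall x, S x -> nrm2 n x <= M) -> seq_closed n S ->
  continuous_on n S phi -> exists x, S x /\ forall y, S y -> phi y <= phi x.
Proof.
intros [x0 Hx0] HM HS Hc.
assert (Hb : exists B, forall y, S y -> phi y <= B).
{ apply NNPP; intros Hn.
  assert (forall k : nat, exists y, S y /\ phi y > INR k).
  { intros k; apply NNPP; intros Hk; apply Hn; exists (INR k); intros y Hy.
    apply Rnot_lt_le; intros Hl; apply Hk; exists y; auto. }
  destruct (functional_choice _ _ _ H) as [X HX].
  destruct (cluster n S M X HM HS) as [x [Hx Hcl]]; [apply HX|].
  destruct (Hc x Hx 1) as [d [Hd Hd']]; [lra|].
  destruct (INR_unbounded (phi x + 1)) as [K HK].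
  destruct (Hcl d Hd K) as [k [Hk1 Hk2]].
  specialize (Hd' (X k) (proj1 (HX k)) Hk2). pose proof (proj2 (HX k)).
  apply le_INR in Hk1. apply Rabs_def2 in Hd'. lra. }
destruct Hb as [B HB].
destruct (completeness (fun v => exists y, S y /\ v = phi y)) as [s [Hs1 Hs2]].
{ exists B; intros v [y [Hy ->]]; auto. }
{ exists (phi x0), x0; auto. }
assert (H : forall k : nat, exists y, S y /\ phi y > s - / (INR k + 1)).
{ intros k; apply NNPP; intros Hk.
  assert (0 < / (INR k + 1)) by (apply Rinv_0_lt_compat; pose proof (pos_INR k); lra).
  assert (s <= s - / (INR k + 1)); [|lra].
  apply Hs2; intros v [y [Hy ->]]; apply Rnot_lt_le; intros Hl; apply Hk; exists y; auto. }
destruct (functional_choice _ _ _ H) as [X HX].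
destruct (cluster n S M X HM HS) as [x [Hx Hcl]]; [apply HX|].
exists x; split; auto. intros y Hy.
assert (phi y <= s) by (apply Hs1; exists y; auto).
apply Rle_trans with s; auto. apply Rnot_lt_le; intros Hlt.
destruct (Hc x Hx ((s - phi x) / 2)) as [d [Hd Hd']]; [lra|].
destruct (archimed_cor1 ((s - phi x) / 2)) as [K [HK1 HK2]]; [lra|].
destruct (Hcl d Hd K) as [k [Hk1 Hk2]].
specialize (Hd' (X k) (proj1 (HX k)) Hk2). pose proof (proj2 (HX k)).
assert (/ (INR k + 1) <= / INR K).
{ apply Rinv_le_contravar; [apply lt_0_INR; lia|apply le_INR in Hk1; lra]. }
apply Rabs_def2 in Hd'. lra.
Qed.

(** * The eigenvalue functions *)

Lemma quad_ext n A v w : (forall i, (i < n)%nat -> v i = w i) -> quad n A v = quad n A w.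
Proof.
intros H; unfold quad; apply sumN_ext; intros; apply sumN_ext; intros.
rewrite !H; auto.
Qed.

(** The reindexing that isolates the pivot in the elimination of [lin_dep]. *)
Lemma sumN_skip n l0 (f : nat -> R) : (l0 <= n)%nat ->
  sumN (S n) f = f l0 + sumN n (fun l => f (if Nat.ltb l l0 then l else S l)).
Proof.
induction n; intros H.
- assert (l0 = 0%nat) as -> by lia. simpl; ring.
- destruct (Nat.eq_dec l0 (S n)) as [->|Hne].
  + change (sumN (S n) f + f (S n) = f (S n) + sumN (S n) (fun l => f (if Nat.ltb l (S n) then l else S l))).
    rewrite (sumN_ext (S n) (fun l => f (if Nat.ltb l (S n) then l else S l)) f); [ring|].
    intros i Hi; destruct (Nat.ltb_spec i (S n)); [reflexivity|lia].
  + change (sumN (S n) f + f (S n) = f l0 + (sumN n (fun l => f (if Nat.ltb l l0 then l else S l)) + f (if Nat.ltb n l0 then n else S n))).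
    rewrite IHn by lia. destruct (Nat.ltb_spec n l0); [lia|ring].
Qed.

(** Gaussian elimination on the last coordinate. A vector with nonzero last coordinate is the pivot;
    if there is none, that coordinate imposes nothing and one vector can be given coefficient
    zero. *)
Lemma lin_dep m (w : nat -> pt) : exists c : nat -> R,
  (exists l, (l < S m)%nat /\ c l <> 0) /\
  forall i, (i < m)%nat -> sumN (S m) (fun l => c l * w l i) = 0.
Proof.
revert w; induction m; intros w.
- exists (fun _ => 1); split; [exists 0%nat; split; [lia|lra]|intros; lia].
- destruct (classic (exists l0, (l0 < S (S m))%nat /\ w l0 m <> 0)) as [[l0 [Hl0 Hw]]|Hn].
  + set (sk := fun l => if Nat.ltb l l0 then l else S l).
    destruct (IHm (fun l i => w (sk l) i - w (sk l) m / w l0 m * w l0 i)) as [c [[l [Hl Hcl]] Hc]].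
    assert (Hsk : forall l, sk l <> l0).
    { intros k; unfold sk; destruct (Nat.ltb_spec k l0); lia. }
    set (un := fun l => if Nat.ltb l l0 then l else pred l).
    assert (Hun : forall l, un (sk l) = l).
    { intros k; unfold un, sk; destruct (Nat.ltb_spec k l0).
      - destruct (Nat.ltb_spec k l0); lia.
      - destruct (Nat.ltb_spec (S k) l0); lia. }
    (* The pivot's coefficient collects the multiples of [w l0] subtracted from the other
       vectors. *)
    set (a := - sumN (S m) (fun l => c l * (w (sk l) m / w l0 m))).
    exists (fun l => if Nat.eqb l l0 then a else c (un l)).
    split.
    { exists (sk l); split.
      - unfold sk; destruct (Nat.ltb_spec l l0); lia.
      - destruct (Nat.eqb_spec (sk l) l0) as [E|]; [destruct (Hsk _ E)|]. now rewrite Hun. }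
    intros i Hi. rewrite (sumN_skip (S m) l0) by lia. rewrite Nat.eqb_refl.
    rewrite (sumN_ext _ _ (fun l => c l * w (sk l) i)).
    2:{ intros k Hk; fold (sk k). destruct (Nat.eqb_spec (sk k) l0) as [E|]; [destruct (Hsk _ E)|].
        now rewrite Hun. }
    destruct (Nat.eq_dec i m) as [->|Hne].
    * unfold a. rewrite (sumN_ext _ (fun l => c l * (w (sk l) m / w l0 m)) (fun l => / w l0 m * (c l * w (sk l) m))).
      2:{ intros; unfold Rdiv; ring. }
      rewrite sumN_mult; field; auto.
    * specialize (Hc i ltac:(lia)).
      rewrite (sumN_ext _ _ (fun l => c l * w (sk l) i + (- w l0 i) * (c l * (w (sk l) m / w l0 m)))) in Hc.
      2:{ intros; ring. }
      rewrite sumN_plus, sumN_mult in Hc. unfold a; lra.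
  + destruct (IHm w) as [c [[l [Hl Hcl]] Hc]].
    exists (fun l => if Nat.eqb l (S m) then 0 else c l); split.
    { exists l; split; [lia|]. destruct (Nat.eqb_spec l (S m)); [lia|auto]. }
    intros i Hi.
    change (sumN (S m) (fun l => (if Nat.eqb l (S m) then 0 else c l) * w l i) +
      (if Nat.eqb (S m) (S m) then 0 else c (S m)) * w (S m) i = 0).
    rewrite Nat.eqb_refl, (sumN_ext _ _ (fun l => c l * w l i)).
    2:{ intros k Hk; destruct (Nat.eqb_spec k (S m)); [lia|auto]. }
    destruct (Nat.eq_dec i m) as [->|Hne].
    * rewrite (sumN_ext _ _ (fun _ => 0)), sumN_zero; [ring|].
      intros k Hk; destruct (Req_dec (w k m) 0) as [E|E]; [rewrite E; ring|].
      destruct Hn; exists k; split; [lia|auto].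
    * rewrite Hc by lia; ring.
Qed.

(** With [e] appended there are N+1 vectors in dimension N; independence of [vs] forces the
    coefficient of [e] in a dependence relation to be nonzero. *)
Lemma lin_indep_spans N vs e : lin_indep N N vs ->
  exists c, forall i, (i < N)%nat -> lin_comb N c vs i = e i.
Proof.
intros Hi. destruct (lin_dep N (fun l => if Nat.ltb l N then vs l else e)) as [c [[l [Hl Hcl]] Hc]].
assert (Hc' : forall i, (i < N)%nat -> lin_comb N c vs i + c N * e i = 0).
{ intros i Hi'. rewrite <- (Hc i Hi'). unfold lin_comb; simpl.
  rewrite Nat.ltb_irrefl. f_equal. apply sumN_ext; intros k Hk.
  destruct (Nat.ltb_spec k N); [reflexivity|lia]. }
destruct (Req_dec (c N) 0) as [E|E].
- destruct Hcl. destruct (Nat.eq_dec l N) as [->|]; auto. apply Hi; [|lia].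
  intros i Hi'; specialize (Hc' i Hi'); rewrite E in Hc'; lra.
- exists (fun l => (- / c N) * c l); intros i Hi'. specialize (Hc' i Hi').
  unfold lin_comb in *. rewrite (sumN_ext _ _ (fun l => (- / c N) * (c l * vs l i))) by (intros; ring).
  rewrite sumN_mult. replace (sumN N (fun l => c l * vs l i)) with (- c N * e i) by lra. field; auto.
Qed.

(** [Rsup] is a choice operator: it means something only once the set is known to be nonempty and
    bounded. *)
Lemma Rsup_lub E m B : E m -> (forall x, E x -> x <= B) -> is_lub E (Rsup E).
Proof.
intros Hm HB; unfold Rsup; apply epsilon_spec.
destruct (completeness E) as [s Hs]; eauto. exists B; auto.
Qed.

Lemma quad_bound n A : exists B, 0 <= B /\ forall v, Rabs (quad n A v) <= B * nrm2 n v.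
Proof.
exists (sumN n (fun i => sumN n (fun k => Rabs (A i k)))).
assert (Hnn : forall m (f : nat -> R), (forall i, 0 <= f i) -> 0 <= sumN m f).
{ intros m f Hf; induction m; simpl; [lra|]; specialize (Hf m); lra. }
split.
{ apply Hnn; intros; apply Hnn; intros; apply Rabs_pos. }
assert (Habs : forall m f, Rabs (sumN m f) <= sumN m (fun i => Rabs (f i))).
{ intros m f; induction m; simpl; [rewrite Rabs_R0; lra|].
  apply Rle_trans with (1 := Rabs_triang _ _); lra. }
intros v; unfold quad. apply Rle_trans with (1 := Habs _ _).
rewrite Rmult_comm, <- sumN_mult. apply sumN_le; intros i Hi.
apply Rle_trans with (1 := Habs _ _).
rewrite <- sumN_mult; apply sumN_le; intros k Hk.
rewrite Rmult_assoc, Rabs_mult, (Rmult_comm (nrm2 n v)).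
apply Rmult_le_compat_l; [apply Rabs_pos|].
pose proof (coord_le n v i Hi); pose proof (coord_le n v k Hk).
apply Rabs_le; split; nra.
Qed.

Section lambda.
Variables (N j : nat).
Hypotheses (Hj1 : (1 <= j)%nat) (HjN : (j <= N)%nat).

Definition rayleigh_set (X : mat) (vs : nat -> pt) (q : R) : Prop :=
  exists c : nat -> R, nrm2 N (lin_comb j c vs) = 1 /\ q = quad N X (lin_comb j c vs).
Definition lambda_set (X : mat) (s : R) : Prop :=
  exists vs : nat -> pt, (forall l, (l < j)%nat -> InRn N (vs l)) /\ lin_indep N j vs /\
    s = rayleigh_sup N j X vs.

(** Normalise the first vector; [1 <= j] ensures that there is one. *)
Lemma unit_comb vs : lin_indep N j vs -> exists c, nrm2 N (lin_comb j c vs) = 1.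
Proof.
intros Hi. set (e := basis 0).
assert (H : nrm2 N (lin_comb j e vs) <> 0).
{ intros E. assert (e 0%nat = 0); [|unfold e, basis in *; simpl in *; lra].
  apply Hi; [|lia]. apply nrm2_eq0, E. }
pose proof (nrm2_ge0 N (lin_comb j e vs)).
exists (fun l => / nm N (lin_comb j e vs) * e l).
replace (lin_comb j (fun l => / nm N (lin_comb j e vs) * e l) vs)
  with (vsc (/ nm N (lin_comb j e vs)) (lin_comb j e vs)).
- pose proof (nm_sq N (lin_comb j e vs)) as Hq.
  rewrite nrm2_sc, <- Hq. field. intros E; rewrite E in Hq; lra.
- apply functional_extensionality; intros i; unfold vsc, lin_comb.
  rewrite <- sumN_mult; apply sumN_ext; intros; ring.
Qed.

Lemma rayleigh_lub X vs : lin_indep N j vs -> is_lub (rayleigh_set X vs) (rayleigh_sup N j X vs).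
Proof.
intros Hi. destruct (unit_comb vs Hi) as [c Hc]. destruct (quad_bound N X) as [B [_ HB]].
apply (Rsup_lub _ (quad N X (lin_comb j c vs)) B).
- exists c; auto.
- intros q [c' [Hc' ->]]. specialize (HB (lin_comb j c' vs)). apply Rabs_le_bounds in HB.
  rewrite Hc' in HB; lra.
Qed.

Lemma basis_indep : (forall l, (l < j)%nat -> InRn N (basis l)) /\ lin_indep N j basis.
Proof.
split.
- intros l Hl i Hi; unfold basis; destruct (Nat.eqb_spec l i); [lia|reflexivity].
- intros c Hc l Hl. rewrite <- (Hc l) by lia. unfold lin_comb.
  rewrite (sumN_ext _ _ (fun k => if Nat.eqb l k then c k else 0)), sumN_pick; auto.
  intros k Hk; unfold basis; rewrite (Nat.eqb_sym k l); destruct (Nat.eqb l k); ring.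
Qed.

Lemma lambda_glb X : (forall s, lambda_set X s -> lambda N j X <= s) /\
  (forall m, (forall s, lambda_set X s -> m <= s) -> m <= lambda N j X).
Proof.
destruct (quad_bound N X) as [B [_ HB]].
assert (HE : forall s, lambda_set X s -> - B <= s).
{ intros s [vs [_ [Hi ->]]]. destruct (unit_comb vs Hi) as [c Hc].
  apply Rle_trans with (quad N X (lin_comb j c vs)).
  - specialize (HB (lin_comb j c vs)); apply Rabs_le_bounds in HB; rewrite Hc in HB; lra.
  - apply (rayleigh_lub X vs Hi); exists c; auto. }
assert (H : is_lub (fun r => lambda_set X (- r)) (Rsup (fun r => lambda_set X (- r)))).
{ apply (Rsup_lub _ (- rayleigh_sup N j X basis) B).
  - exists basis; rewrite Ropp_involutive; destruct basis_indep; auto.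
  - intros x Hx; apply HE in Hx; lra. }
change (lambda N j X) with (- Rsup (fun r => lambda_set X (- r))).
destruct H as [H1 H2]; split.
- intros s Hs. assert (- s <= Rsup (fun r => lambda_set X (- r))); [|lra].
  apply H1; rewrite Ropp_involutive; auto.
- intros m Hm. assert (Rsup (fun r => lambda_set X (- r)) <= - m); [|lra].
  apply H2; intros r Hr; specialize (Hm _ Hr); lra.
Qed.

(** Monotonicity and shift in one statement, with [c] of either sign. Together with [lambda_max_ge]
    this is all that later arguments know about eigenvalues. *)
Lemma lambda_le X Y c : (forall v, quad N X v <= quad N Y v + c * nrm2 N v) ->
  lambda N j X <= lambda N j Y + c.
Proof.
intros H. assert (lambda N j X - c <= lambda N j Y); [|lra].
apply lambda_glb; intros s [vs [Hvs [Hi ->]]].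
assert (lambda N j X <= rayleigh_sup N j X vs) by (apply lambda_glb; exists vs; auto).
assert (rayleigh_sup N j X vs <= rayleigh_sup N j Y vs + c); [|lra].
apply (rayleigh_lub X vs Hi); intros q [c' [Hc' ->]].
specialize (H (lin_comb j c' vs)); rewrite Hc' in H.
assert (quad N Y (lin_comb j c' vs) <= rayleigh_sup N j Y vs); [|lra].
apply (rayleigh_lub Y vs Hi); exists c'; auto.
Qed.
End lambda.

(** For [j = N] every admissible family spans the whole space, so each Rayleigh supremum already
    dominates the value at [e]. *)
Lemma lambda_max_ge N X e : (1 <= N)%nat -> nrm2 N e = 1 -> quad N X e <= lambda N N X.
Proof.
intros HN He. apply lambda_glb; auto. intros s [vs [_ [Hi ->]]].
destruct (lin_indep_spans N vs e Hi) as [c Hc].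
apply (rayleigh_lub N N); auto. exists c; split.
- rewrite <- He; apply nrm2_ext, Hc.
- symmetry; apply quad_ext, Hc.
Qed.

(** * A barrier *)

Lemma cont_subset n (S S' : pt -> Prop) f : (forall x, S' x -> S x) ->
  continuous_on n S f -> continuous_on n S' f.
Proof.
intros H Hf x Hx eps He; destruct (Hf x (H x Hx) eps He) as [d [Hd Hd']].
exists d; split; auto.
Qed.

Lemma cont_ext n (S : pt -> Prop) f g : (forall x, S x -> f x = g x) ->
  continuous_on n S f -> continuous_on n S g.
Proof.
intros H Hf x Hx eps He; destruct (Hf x Hx eps He) as [d [Hd Hd']].
exists d; split; auto. intros y Hy Hxy; rewrite <- !H by auto; auto.
Qed.

Lemma cont_const n S c : continuous_on n S (fun _ => c).
Proof. intros x _ eps He; exists 1; split; [lra|]; intros; rewrite Rminus_diag, Rabs_R0; lra. Qed.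

Lemma cont_coord n S i : (i < n)%nat -> continuous_on n S (fun x => x i).
Proof.
intros Hi x _ eps He; exists eps; split; auto. intros y _ H.
apply Rle_lt_trans with (2 := H). rewrite dist_nm.
unfold nm; rewrite <- sqrt_Rsqr_abs; apply sqrt_le_1_alt.
apply (coord_le n (vsub y x) i Hi).
Qed.

Lemma cont_plus n S f g : continuous_on n S f -> continuous_on n S g ->
  continuous_on n S (fun x => f x + g x).
Proof.
intros Hf Hg x Hx eps He.
destruct (Hf x Hx (eps / 2)) as [d1 [H1 H1']]; [lra|].
destruct (Hg x Hx (eps / 2)) as [d2 [H2 H2']]; [lra|].
exists (Rmin d1 d2); split; [apply Rmin_pos; lra|]. intros y Hy Hxy.
pose proof (Rmin_l d1 d2); pose proof (Rmin_r d1 d2).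
specialize (H1' y Hy ltac:(lra)); specialize (H2' y Hy ltac:(lra)).
apply Rabs_def2 in H1'; apply Rabs_def2 in H2'. apply Rabs_def1; lra.
Qed.

Lemma cont_comp n S (f : R -> R) g : continuity f -> continuous_on n S g ->
  continuous_on n S (fun x => f (g x)).
Proof.
intros Hf Hg x Hx eps He.
destruct (Hf (g x) eps He) as [a [Ha Ha']].
destruct (Hg x Hx a Ha) as [d [Hd Hd']]. exists d; split; auto.
intros y Hy Hxy. specialize (Hd' y Hy Hxy).
destruct (Req_dec (g y) (g x)) as [->|Hne]; [rewrite Rminus_diag, Rabs_R0; lra|].
apply Ha'; split; [split; [exact I|auto]|exact Hd'].
Qed.

Lemma cont_scal n S c f : continuous_on n S f -> continuous_on n S (fun x => c * f x).
Proof. apply (cont_comp n S (fun v => c * v)); reg. Qed.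

Lemma cont_opp n S f : continuous_on n S f -> continuous_on n S (fun x => - f x).
Proof. apply (cont_comp n S (fun v => - v)); reg. Qed.

Lemma cont_minus n S f g : continuous_on n S f -> continuous_on n S g ->
  continuous_on n S (fun x => f x - g x).
Proof. intros; apply cont_plus; auto; apply cont_opp; auto. Qed.

(** Polarisation reduces products to squares, which [cont_comp] covers. *)
Lemma cont_mult n S f g : continuous_on n S f -> continuous_on n S g ->
  continuous_on n S (fun x => f x * g x).
Proof.
intros Hf Hg.
apply cont_ext with (fun x => / 4 * ((f x + g x) * (f x + g x)) + - (/ 4 * ((f x + - g x) * (f x + - g x)))).
{ intros; field. }
assert (Hsq : continuity (fun v => v * v)) by reg.
apply cont_plus; [|apply cont_opp]; apply cont_scal; apply (cont_comp n S (fun v => v * v)); auto;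
  apply cont_plus; auto; apply cont_opp; auto.
Qed.

Lemma cont_sumN n S m (f : nat -> pt -> R) :
  (forall i, (i < m)%nat -> continuous_on n S (f i)) -> continuous_on n S (fun x => sumN m (fun i => f i x)).
Proof.
induction m; intros H; simpl; [apply cont_const|].
apply cont_plus; [apply IHm; intros; apply H; lia|apply H; lia].
Qed.

Lemma cont_dot n S p : continuous_on n S (dot n p).
Proof.
apply (cont_sumN n S n (fun i x => p i * x i)); intros; apply cont_scal, cont_coord; auto.
Qed.

Lemma cont_quad n S A : continuous_on n S (quad n A).
Proof.
apply (cont_sumN n S n (fun i x => sumN n (fun k => A i k * x i * x k))); intros i Hi.
apply (cont_sumN n S n (fun k x => A i k * x i * x k)); intros k Hk.
apply cont_mult; [apply cont_scal|]; apply cont_coord; auto.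
Qed.

Lemma cont_affine n (S S' : pt -> Prop) f x0 c : (forall k, S' k -> S (vadd x0 (vsc c k))) ->
  continuous_on n S f -> continuous_on n S' (fun k => f (vadd x0 (vsc c k))).
Proof.
intros HS Hf x Hx eps He. destruct (Hf _ (HS x Hx) eps He) as [d [Hd Hd']].
exists (d / (Rabs c + 1)); pose proof (Rabs_pos c); split; [apply Rdiv_lt_0_compat; lra|].
intros y Hy Hxy; apply Hd'; auto. rewrite dist_nm in *.
replace (vsub (vadd x0 (vsc c y)) (vadd x0 (vsc c x))) with (vsc c (vsub y x)).
2:{ apply functional_extensionality; intros; unfold vadd, vsub, vsc; ring. }
rewrite nm_sc. pose proof (nm_ge0 n (vsub y x)).
assert ((Rabs c + 1) * nm n (vsub y x) < (Rabs c + 1) * (d / (Rabs c + 1))) by (apply Rmult_lt_compat_l; lra).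
replace ((Rabs c + 1) * (d / (Rabs c + 1))) with d in H1 by (field; lra). nra.
Qed.

Lemma cont_nrm2_sub n S c : continuous_on n S (fun x => nrm2 n (vsub x c)).
Proof.
unfold nrm2, dot. apply (cont_sumN n S n (fun i x => vsub x c i * vsub x c i)); intros i Hi; unfold vsub.
apply cont_mult; apply cont_minus; try apply cont_const; apply cont_coord; auto.
Qed.

(** With domain [fun _ => True] the arguments may carry arbitrary coordinates from [n] on; [dist n]
    does not see them, so neither does a continuous function. *)
Lemma continuous_dep n (f : pt -> R) x y : continuous_on n (fun _ => True) f ->
  (forall i, (i < n)%nat -> x i = y i) -> f x = f y.
Proof.
intros Hf H. apply Rminus_diag_uniq_sym.
destruct (Req_dec (f y - f x) 0) as [|Hne]; auto.
destruct (Hf x I (Rabs (f y - f x))) as [d [Hd Hd']]; [apply Rabs_pos_lt; auto|].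
assert (Rabs (f y - f x) < Rabs (f y - f x)); [|lra]. apply Hd'; auto.
rewrite dist_nm, (nm_ext n _ (fun _ => 0)).
- unfold nm; rewrite nrm2_zero, sqrt_0; lra.
- intros i Hi; unfold vsub; rewrite H; auto; ring.
Qed.

Definition ball (n : nat) (c : pt) (r : R) (x : pt) : Prop := InRn n x /\ nrm2 n (vsub x c) <= r * r.

Lemma ball_bounded n c r : exists M, forall x, ball n c r x -> nrm2 n x <= M.
Proof.
exists (2 * (r * r) + 2 * nrm2 n c); intros x [_ H].
pose proof (nrm2_ge0 n (vsub (vsub x c) c)) as H1.
pose proof (nrm2_sub n (vsub x c) c) as H2.
pose proof (nrm2_add n c (vsub x c)) as H3. rewrite vadd_sub in H3.
rewrite (dot_sym n c) in H3. lra.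
Qed.

Lemma ball_closed n c r : 0 <= r -> seq_closed n (ball n c r).
Proof.
intros Hr x Hx H; split; auto. apply Rnot_lt_le; intros Hlt.
assert (Hnm : r < nm n (vsub x c)).
{ apply Rnot_le_lt; intros Hle; apply nrm2_le in Hle; lra. }
destruct (H (nm n (vsub x c) - r)) as [y [[Hy1 Hy2] Hy3]]; [lra|].
apply nm_le in Hy2; auto. rewrite dist_nm in Hy3.
assert (nm n (vsub x c) <= nm n (vsub y c) + nm n (vsub y x)); [|lra].
replace (vsub x c) with (vsub (vsub y c) (vsub y x)); [apply nm_sub|].
apply functional_extensionality; intros; unfold vsub; ring.
Qed.

(** Compactness is available only within [InRn n]; truncation carries the maximum over to points
    with arbitrary further coordinates. *)
Lemma ball_max n (c : pt) r phi : 0 <= r -> continuous_on n (fun _ => True) phi ->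
  exists x, nrm2 n (vsub x c) <= r * r /\ forall y, nrm2 n (vsub y c) <= r * r -> phi y <= phi x.
Proof.
intros Hr Hphi. destruct (ball_bounded n c r) as [M HM].
assert (Ht : forall y, nrm2 n (vsub (trunc n y) c) = nrm2 n (vsub y c)).
{ intros y; apply nrm2_ext; intros i Hi; unfold vsub; now rewrite trunc_eq. }
destruct (evt n (ball n c r) M phi) as [x [[Hx1 Hx2] Hx3]].
- exists (trunc n c); split; [apply InRn_trunc|]. rewrite Ht, nrm2_sub. unfold nrm2; nra.
- exact HM.
- apply ball_closed; auto.
- apply cont_subset with (2 := Hphi); auto.
- exists x; split; auto. intros y Hy. rewrite (continuous_dep n phi y (trunc n y)); auto.
  + apply Hx3; split; [apply InRn_trunc|now rewrite Ht].
  + intros; now rewrite trunc_eq.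
Qed.

(** * The zero vector and the Hopf barrier *)

Definition zero : pt := fun _ => 0.
Lemma nrm2_0 n : nrm2 n zero = 0.
Proof. exact (nrm2_zero n). Qed.
Lemma dot_0r n p : dot n p zero = 0.
Proof. pose proof (cauchy_schwarz2 n p zero) as H; rewrite nrm2_0 in H; nra. Qed.
Lemma quad_0 n A : quad n A zero = 0.
Proof. rewrite quad_mv; apply dot_0r. Qed.
Lemma vsub_zero x : vsub x zero = x.
Proof. apply functional_extensionality; intros; unfold vsub, zero; ring. Qed.
Lemma vadd_zero x : vadd zero x = x.
Proof. apply functional_extensionality; intros; unfold vadd, zero; ring. Qed.
Lemma vadd_zero_r x : vadd x zero = x.
Proof. apply functional_extensionality; intros; unfold vadd, zero; ring. Qed.

(** Square [1 - t / 2 <= exp (- t / 2)]; the bound [t <= 2] keeps the smaller side nonnegative. *)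
Lemma exp_lower t : t <= 2 -> 1 - t + / 4 * (t * t) <= exp (- t).
Proof.
intros Ht. replace (- t) with (- t / 2 + - t / 2) by field. rewrite exp_plus.
pose proof (exp_ineq1_le (- t / 2)). assert (0 <= 1 + - t / 2) by lra. nra.
Qed.

(** [h] stands for the rescaled gap between a touching paraboloid and the function below it. As [h]
    vanishes at the centre, a bump centred at a nearby point where [h >= eps] must cross it. Where
    the bump exceeds [h] the most, a paraboloid touches [h] from below; this happens away from the
    centre of the bump, where the bump is strictly subharmonic, so the trace is positive. *)
Lemma barrier n G eps : 0 < G -> 0 < eps -> exists kap c, 0 < kap <= / 4 /\ 0 < c /\
  forall h, continuous_on n (fun _ => True) h -> h zero = 0 ->
  (forall y, nrm2 n y <= 1 -> 0 <= h y) ->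
  (forall y, exists w, forall k, h (vadd y k) <= h y + dot n w k + G / 2 * nrm2 n k) ->
  forall y0, nm n y0 <= / 4 -> eps <= h y0 ->
  exists x' w S, nm n x' <= 3 / 4 /\ symmetric n S /\ c <= tr n S /\
    forall k, nrm2 n k <= kap * kap -> h x' + dot n w k + / 2 * quad n S k <= h (vadd x' k).
Proof.
intros HG He.
(* The slope of [h] near [y0] is at most [3 * G], so [8 * G * rho <= eps] keeps [h] above [eps / 2]
   within [rho] of [y0]. *)
set (rho := Rmin (/ 4) (eps / (8 * G))).
assert (Hrho : 0 < rho) by (apply Rmin_pos; [lra|apply Rdiv_lt_0_compat; lra]).
assert (Hrho1 : rho <= / 4) by apply Rmin_l.
assert (Hrho2 : 8 * G * rho <= eps).
{ apply Rle_trans with (8 * G * (eps / (8 * G))).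
  - apply Rmult_le_compat_l; [lra|apply Rmin_r].
  - right; field; lra. }
pose proof (pos_INR n) as Hn.
(* Makes [al * nrm2 n v - 2 * INR n] at least 1 once [v] is longer than [rho]. *)
set (al := (2 * INR n + 1) / (rho * rho)).
assert (Hal : al * (rho * rho) = 2 * INR n + 1) by (unfold al; field; lra).
assert (Hal16 : 16 <= al).
{ apply Rmult_le_reg_r with (rho * rho); [nra|]. rewrite Hal. nra. }
clearbody al rho.
exists (/ al), (2 * (eps / 2) * al * exp (- (al / 4))).
assert (Hinv : / al * al = 1) by (field; lra).
assert (Hk0 : 0 < / al) by (apply Rinv_0_lt_compat; lra).
split; [split; auto; apply Rmult_le_reg_r with al; lra|].
split.
{ apply Rmult_lt_0_compat; [nra|apply exp_pos]. }
intros h Hc Hh0 Hpos Hup y0 Hy0 Hhy0.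
assert (Hup0 : forall y, nm n y <= 1 -> h y <= G / 2 * nrm2 n y).
{ intros y Hy. destruct (Hup zero) as [w Hw].
  (* [zero] is a minimum of [h], so the slope there vanishes: otherwise a short step against [w]
     would make [h] negative. *)
  assert (Hw0 : nrm2 n w = 0).
  { destruct (Req_dec (nrm2 n w) 0) as [|Hne]; auto. exfalso.
    pose proof (nrm2_ge0 n w) as Hw2.
    pose proof (nm_ge0 n w). pose proof (nm_sq n w).
    set (t := / (nm n w + G)).
    assert (Ht : 0 < t) by (apply Rinv_0_lt_compat; lra).
    assert (Ht1 : t * (nm n w + G) = 1) by (unfold t; field; lra).
    specialize (Hw (vsc (- t) w)). rewrite vadd_zero, Hh0, dot_scr, nrm2_sc in Hw.
    change (dot n w w) with (nrm2 n w) in Hw.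
    assert (0 <= h (vsc (- t) w)).
    { apply Hpos; rewrite nrm2_sc. rewrite <- H0. assert (0 <= t * nm n w <= 1) by (split; nra).
      replace (- t * - t * (nm n w * nm n w)) with ((t * nm n w) * (t * nm n w)) by ring. nra. }
    assert (t * G <= 1) by nra. assert (0 < t * nrm2 n w) by (apply Rmult_lt_0_compat; lra).
    assert (0 <= (t * nrm2 n w) * (1 - t * G)) by (apply Rmult_le_pos; lra). lra. }
  specialize (Hw y). rewrite vadd_zero, Hh0 in Hw.
  assert (dot n w y = 0); [|lra].
  pose proof (cauchy_schwarz2 n w y) as H; rewrite Hw0 in H. nra. }
assert (Hnear : forall y, nm n (vsub y y0) <= rho -> eps / 2 <= h y).
{ intros y Hy. pose proof (nm_ge0 n (vsub y y0)) as Hd0.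
  assert (Hy1 : nm n y <= / 2).
  { rewrite <- (vadd_sub y0 y). pose proof (nm_add n y0 (vsub y y0)); lra. }
  destruct (Hup y) as [w Hw].
  assert (Hwb : nm n w <= 3 * G).
  { pose proof (nm_ge0 n w) as Hw0. pose proof (nm_sq n w) as Hw2.
    destruct (Req_dec (nm n w) 0) as [E|E]; [lra|].
    (* A step of length [/ 4] against [w] must keep [h] nonnegative, which bounds [w]. *)
    set (k := vsc (- / (4 * nm n w)) w).
    assert (Hk : nm n k = / 4).
    { unfold k; rewrite nm_sc, Rabs_Ropp, Rabs_inv, Rabs_right by lra. field; lra. }
    assert (Hk2 : nrm2 n k = / 16) by (rewrite <- nm_sq, Hk; field).
    assert (Hwk : dot n w k = - (nm n w / 4)).
    { unfold k; rewrite dot_scr. change (dot n w w) with (nrm2 n w). rewrite <- Hw2. field; lra. }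
    specialize (Hw k). rewrite Hwk, Hk2 in Hw.
    assert (0 <= h (vadd y k)).
    { apply Hpos. pose proof (nm_add n y k). apply Rle_trans with (1 * 1); [apply nrm2_le|]; lra. }
    pose proof (Hup0 y ltac:(lra)).
    assert (nrm2 n y <= / 2 * / 2) by (apply nrm2_le; auto). nra. }
  specialize (Hw (vsub y0 y)). rewrite vadd_sub in Hw.
  pose proof (nm_sub_sym n y0 y) as Hs.
  pose proof (dot_le n w (vsub y0 y)). rewrite Hs in H.
  assert (nrm2 n (vsub y0 y) <= rho * rho) by (apply nrm2_le; lra).
  assert (nm n w * nm n (vsub y y0) <= 3 * G * rho) by (apply Rmult_le_compat; auto using nm_ge0).
  assert (rho * rho <= rho * / 4) by nra. nra. }
(* Positive exactly within [/ 2] of [y0], hence at [zero], and everywhere below [eps / 2]. So the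
   maximum of [b - h] is positive, and is attained at a distance between [rho] and [/ 2] from
   [y0]. *)
set (b := fun y => eps / 2 * (exp (- (al * nrm2 n (vsub y y0))) - exp (- (al / 4)))).
destruct (ball_max n zero 1 (fun y => b y - h y)) as [x' [Hx1 Hx2]]; [lra| |].
{ apply cont_minus; auto. unfold b; apply cont_scal, cont_minus; [|apply cont_const].
  apply (cont_comp n _ exp); [apply derivable_continuous, derivable_exp|].
  apply cont_opp, cont_scal, cont_nrm2_sub. }
rewrite vsub_zero in Hx1.
assert (Hhx : 0 <= h x') by (apply Hpos; lra).
assert (Hexp : forall s t, s < t -> exp s < exp t) by apply exp_increasing.
assert (Hb0 : 0 < b zero).
{ unfold b. assert (nrm2 n (vsub zero y0) <= / 4 * / 4).
  { apply nrm2_le. rewrite nm_sub_sym, vsub_zero; auto. }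
  assert (exp (- (al / 4)) < exp (- (al * nrm2 n (vsub zero y0)))) by (apply Hexp; nra). nra. }
assert (Hbx : h x' < b x').
{ specialize (Hx2 zero). rewrite vsub_zero in Hx2. unfold zero in Hx2 at 1. rewrite nrm2_zero in Hx2.
  specialize (Hx2 ltac:(lra)). rewrite Hh0 in Hx2. lra. }
set (v := vsub x' y0) in *.
assert (Hv1 : nm n v < / 2).
{ apply Rnot_le_lt; intros Hle. pose proof (nm_sq n v) as Hq.
  assert (exp (- (al * nrm2 n v)) <= exp (- (al / 4))).
  { destruct (Req_dec (al * nrm2 n v) (al / 4)) as [->|]; [lra|]. left; apply Hexp. nra. }
  unfold b in Hbx; fold v in Hbx. nra. }
pose proof (nm_ge0 n v) as Hv0. pose proof (nm_sq n v) as Hvsq.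
assert (Hv2 : rho * rho < nrm2 n v).
{ apply Rnot_le_lt; intros Hle. apply nm_le in Hle; [|lra]. specialize (Hnear x' Hle).
  assert (exp (- (al * nrm2 n v)) <= exp 0).
  { destruct (Req_dec (al * nrm2 n v) 0) as [E|]; [rewrite E, Ropp_0; lra|]. left; apply Hexp.
    pose proof (nrm2_ge0 n v); nra. }
  rewrite exp_0 in H. pose proof (exp_pos (- (al / 4))). unfold b in Hbx; fold v in Hbx. nra. }
set (E := exp (- (al * nrm2 n v))) in *.
assert (HE : exp (- (al / 4)) <= E) by (left; apply Hexp; nra).
pose proof (exp_pos (- (al / 4))) as HE0.
assert (Hxn : nm n x' <= 3 / 4).
{ rewrite <- (vadd_sub y0 x'). pose proof (nm_add n y0 (vsub x' y0)). fold v in H |- *; lra. }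
(* The Hessian of [b] at [x'] with its rank-one part halved and its multiple of the identity
   doubled; the slack pays for the remainder of the exponential on the ball of radius [/ al]. *)
exists x', (vsc (eps / 2 * E * (- 2 * al)) v),
  (msc (eps / 2 * E) (madd (msc (2 * al * al) (outer v)) (idm (- 4 * al)))).
split; [auto|split; [|split]].
- apply sym_msc, sym_madd; [apply sym_msc, sym_outer|apply sym_idm].
- rewrite tr_msc, tr_madd, tr_msc, tr_idm, tr_outer.
  replace (2 * al * al * nrm2 n v + INR n * (-4 * al)) with (2 * al * (al * nrm2 n v - 2 * INR n)) by ring.
  assert (1 <= al * nrm2 n v - 2 * INR n) by nra.
  assert (0 <= eps * al * (E - exp (- (al / 4)))) by (repeat apply Rmult_le_pos; lra).
  apply Rle_trans with (eps / 2 * E * (2 * al * 1)); [lra|].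
  apply Rmult_le_compat_l; [apply Rmult_le_pos; lra|].
  apply Rmult_le_compat_l; lra.
- intros k Hk. rewrite dot_scl, quad_msc, quad_madd, quad_msc, quad_outer, quad_idm.
  assert (Hkn : nm n k <= / al) by (apply nm_le; lra).
  pose proof (nm_ge0 n k) as Hkn0. pose proof (nm_sq n k) as Hksq.
  assert (Hal4 : / al <= / 4) by (apply Rmult_le_reg_r with al; lra).
  assert (Hy1 : nrm2 n (vadd x' k) <= 1).
  { apply Rle_trans with (1 * 1); [|lra]. apply nrm2_le. pose proof (nm_add n x' k); lra. }
  specialize (Hx2 (vadd x' k)). rewrite vsub_zero in Hx2. specialize (Hx2 ltac:(lra)).
  unfold b in Hx2; fold v E in Hx2.
  replace (vsub (vadd x' k) y0) with (vadd v k) in Hx2.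
  2:{ apply functional_extensionality; intros; unfold v, vadd, vsub; ring. }
  set (d := dot n v k) in *. set (q := nrm2 n k) in *.
  pose proof (dot_abs n v k) as Hd; fold d in Hd; apply Rabs_le_bounds in Hd.
  set (tau := al * (2 * d + q)).
  replace (- (al * nrm2 n (vadd v k))) with (- (al * nrm2 n v) + - tau) in Hx2.
  2:{ rewrite nrm2_add; unfold tau, d, q; ring. }
  rewrite exp_plus in Hx2; fold E in Hx2.
  assert (Hd2 : - (/ 2 * / al) <= d <= / 2 * / al) by nra.
  assert (Hq : 0 <= q <= / al * / 4) by nra.
  assert (Htau : tau <= 2).
  { unfold tau. apply Rle_trans with (al * (2 * (/ 2 * / al) + / al * / 4)); [|nra].
    apply Rmult_le_compat_l; lra. }
  pose proof (exp_lower tau Htau) as Hl.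
  assert (Hl2 : - 2 * al * d + al * al * (d * d) - 2 * al * q <= exp (- tau) - 1).
  { assert (al * d >= - / 2) by nra.
    assert (0 <= al * q) by nra.
    assert (0 <= (al * d + / 2) * (al * q)) by nra.
    assert (0 <= al * al * (q * q)) by nra.
    unfold tau in *; lra. }
  assert (0 < eps / 2 * E) by nra.
  assert (eps / 2 * E * (- 2 * al * d + al * al * (d * d) - 2 * al * q) <= eps / 2 * E * (exp (- tau) - 1)).
  { apply Rmult_le_compat_l; lra. }
  lra.
Qed.

(** * Quadratic approximation of semiconvex functions *)

(** Convexity of [f + K / 2 * nrm2], stated as existence of a global subgradient at every point. *)
Definition semiconvex (n : nat) (K : R) (f : pt -> R) : Prop :=
  forall x, exists p, forall k, f x + dot n p k - K / 2 * nrm2 n k <= f (vadd x k).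
Definition touch (n : nat) (f : pt -> R) (x p : pt) (A : mat) (r : R) : Prop :=
  forall k, nrm2 n k <= r * r -> f (vadd x k) <= f x + dot n p k + / 2 * quad n A k.

(** Stands in for the spectral theorem: coordinates are added one at a time, and positivity of the
    form controls the cross terms. *)
Lemma psd_trace n B v : symmetric n B -> (forall w, 0 <= quad n B w) ->
  quad n B v <= tr n B * nrm2 n v.
Proof.
intros HB Hp.
assert (H : forall m, (m <= n)%nat ->
  quad n B (trunc m v) <= sumN m (fun i => B i i) * sumN m (fun i => v i * v i)).
{ induction m; intros Hm.
  - simpl. replace (trunc 0 v) with zero by (apply functional_extensionality; reflexivity).
    rewrite quad_mv. unfold zero at 2. unfold dot. rewrite (sumN_ext _ _ (fun _ => 0)), sumN_zero; [lra|].
    intros; ring.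
  - specialize (IHm ltac:(lia)). simpl.
    set (T := sumN m (fun i => B i i)) in *. set (S := sumN m (fun i => v i * v i)) in *.
    assert (HT : 0 <= B m m) by (rewrite <- (quad_basis n) by lia; apply Hp).
    assert (HT0 : 0 <= T).
    { unfold T; rewrite <- (sumN_zero m); apply sumN_le; intros i Hi.
      rewrite <- (quad_basis n) by lia; apply Hp. }
    assert (HS0 : 0 <= S) by apply (nrm2_ge0 m v).
    set (x := trunc m v) in *. set (y := vsc (v m) (basis m)).
    replace (trunc (Datatypes.S m) v) with (vadd x y).
    2:{ apply functional_extensionality; intros i; unfold x, y, vadd, trunc, vsc, basis.
        destruct (Nat.ltb_spec i m); destruct (Nat.ltb_spec i (Datatypes.S m)); destruct (Nat.eqb_spec m i);
          subst; try lia; ring. }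
    assert (Hy : quad n B y = v m * v m * B m m).
    { unfold y; rewrite quad_sc, quad_basis by lia; ring. }
    rewrite quad_add, Hy by auto. set (be := dot n (mv n B x) y).
    set (a := B m m) in *. set (c := v m) in *.
    assert (2 * be <= c * c * T + S * a); [|lra].
    (* Positivity at [c ^ 2 x - S y], divided by [c ^ 2 S], is the bound for [2 * be]; the cases
       [c = 0] and [S = 0] are treated apart. *)
    pose proof (Hp (vadd (vsc (c * c) x) (vsc (- S) y))) as H.
    rewrite quad_add, !quad_sc, mv_sc, dot_scl, dot_scr, Hy in H by auto. fold be in H.
    destruct (Req_dec (c * c) 0) as [Ec|Ec].
    { assert (be = 0) as ->; [|nra].
      unfold be, y. rewrite dot_scr. assert (c = 0) as -> by nra. ring. }
    destruct (Req_dec S 0) as [ES|ES].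
    { assert (be = 0) as ->; [|nra].
      unfold be. rewrite mv_sym by auto. unfold dot.
      rewrite (sumN_ext _ _ (fun _ => 0)), sumN_zero; auto. intros i Hi.
      assert (x i = 0) as ->; [|ring]. unfold x, trunc. destruct (Nat.ltb_spec i m); auto.
      apply (nrm2_eq0 m v ES); auto. }
    assert (Hpos : 0 < c * c * S) by nra.
    assert (Hq : c * c * (c * c) * quad n B x <= c * c * (c * c) * (T * S)) by (apply Rmult_le_compat_l; nra).
    apply Rmult_le_reg_l with (c * c * S); auto. nra. }
specialize (H n (Nat.le_refl n)).
unfold quad in *. erewrite sumN_ext; [apply H|]. intros i Hi; apply sumN_ext; intros k Hk.
rewrite !trunc_eq; auto.
Qed.

(** Adding the inequalities at [t v] and [- t v] cancels both slopes. *)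
Lemma touch_lower n L f x p A r : 0 < r -> semiconvex n L f -> touch n f x p A r ->
  forall v, - L * nrm2 n v <= quad n A v.
Proof.
intros Hr Hs Ht v. destruct (Hs x) as [q Hq].
pose proof (nm_ge0 n v) as H0. pose proof (nm_sq n v) as H1.
set (t := r / (nm n v + 1)).
assert (Ht0 : 0 < t) by (apply Rdiv_lt_0_compat; lra).
assert (Ht1 : t * (nm n v + 1) = r) by (unfold t; field; lra).
assert (Hle : t * t * nrm2 n v <= r * r).
{ rewrite <- H1. assert (0 <= t * nm n v <= r) by (split; nra).
  replace (t * t * (nm n v * nm n v)) with ((t * nm n v) * (t * nm n v)) by ring. nra. }
pose proof (Hq (vsc t v)) as A1. pose proof (Hq (vsc (- t) v)) as A2.
pose proof (Ht (vsc t v)) as B1. pose proof (Ht (vsc (- t) v)) as B2.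
rewrite nrm2_sc, !dot_scr in *. rewrite quad_sc in *.
replace (- t * - t) with (t * t) in * by ring.
specialize (B1 Hle); specialize (B2 Hle).
apply Rmult_le_reg_l with (t * t); [nra|]. lra.
Qed.

Lemma touch_trace n L f x p A r : 0 < r -> semiconvex n L f -> touch n f x p A r ->
  - L * INR n <= tr n A.
Proof.
intros Hr Hs Ht. pose proof (touch_lower n L f x p A r Hr Hs Ht) as H.
unfold tr. replace (- L * INR n) with (sumN n (fun _ => - L)).
- apply sumN_le; intros i Hi. specialize (H (basis i)).
  rewrite nrm2_basis, quad_basis in H by auto; lra.
- clear. induction n; [simpl; ring|]. rewrite S_INR. simpl. rewrite IHn; ring.
Qed.

Lemma quad_le_trace n L A v : symmetric n A -> (forall w, - L * nrm2 n w <= quad n A w) ->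
  quad n A v + L * nrm2 n v <= (tr n A + INR n * L) * nrm2 n v.
Proof.
intros HA HL. pose proof (psd_trace n (madd A (idm L)) v) as H.
rewrite quad_madd, quad_idm, tr_madd, tr_idm in H. apply H.
- apply sym_madd; auto using sym_idm.
- intros w; rewrite quad_madd, quad_idm; specialize (HL w); lra.
Qed.

(** The gap between the paraboloid and [f], rescaled to the unit ball, fits [barrier]: it is
    nonnegative by touching, zero at the centre, and has upper paraboloids of opening [G], since [A]
    is bounded through its trace and [f] is semiconvex. Subtracting the barrier's [S] from [A]
    lowers the trace. *)
Lemma touch_step n L T eps : 0 < L -> 0 < T -> 0 < eps -> exists kap c, 0 < kap <= / 4 /\ 0 < c /\
  forall f x p A r, continuous_on n (fun _ => True) f -> semiconvex n L f -> 0 < r ->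
  symmetric n A -> tr n A <= T -> touch n f x p A r ->
  (forall k, nrm2 n k <= (r / 4) * (r / 4) ->
     f x + dot n p k + / 2 * quad n A k - eps * (r * r) <= f (vadd x k)) \/
  exists d p' A', nm n d <= 3 / 4 * r /\ symmetric n A' /\ tr n A' <= tr n A - c /\
    touch n f (vadd x d) p' A' (kap * r).
Proof.
intros HL HT He. pose proof (pos_INR n) as Hn.
set (G := T + INR n * L).
assert (HG : 0 < G) by (unfold G; nra).
destruct (barrier n G eps HG He) as [kap [c [Hk [Hc Hbar]]]].
exists kap, c; split; [auto|split; auto].
intros f x p A r Hcont Hs Hr HA HtrA Ht.
apply NNPP; intros Hn'. apply not_or_and in Hn'; destruct Hn' as [Hn1 Hn2].
apply Hn2. apply not_all_ex_not in Hn1; destruct Hn1 as [k0 Hk0].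
apply imply_to_and in Hk0; destruct Hk0 as [Hk0 Hk1]. apply Rnot_le_lt in Hk1.
pose proof (touch_lower n L f x p A r Hr Hs Ht) as Hlow.
assert (Hrr : 0 < r * r) by nra.
set (h := fun k => / (r * r) * (f x + r * dot n p k + / 2 * (r * r) * quad n A k - f (vadd x (vsc r k)))).
assert (Hh : forall k, r * r * h k = f x + r * dot n p k + / 2 * (r * r) * quad n A k - f (vadd x (vsc r k))).
{ intros k; unfold h; field; lra. }
destruct (Hbar h) with (y0 := vsc (/ r) k0) as [x' [w [S [Hx' [HS [HtS Hlo]]]]]].
- unfold h. apply cont_scal, cont_minus.
  + apply cont_plus; [apply cont_plus; [apply cont_const|apply cont_scal, cont_dot]|apply cont_scal, cont_quad].
  + apply cont_affine with (2 := Hcont); auto.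
- unfold h. rewrite quad_mv. unfold dot at 1. unfold dot. unfold zero.
  rewrite !(sumN_ext n (fun i => _ * 0) (fun _ => 0)) by (intros; ring). rewrite sumN_zero.
  replace (vadd x (vsc r (fun _ => 0))) with x; [field; lra|].
  apply functional_extensionality; intros; unfold vadd, vsc; ring.
- intros y Hy. apply Rmult_le_reg_l with (r * r); auto. rewrite Hh, Rmult_0_r.
  specialize (Ht (vsc r y)). rewrite nrm2_sc, dot_scr, quad_sc in Ht.
  assert (r * r * nrm2 n y <= r * r) by nra. specialize (Ht H); lra.
- intros y. destruct (Hs (vadd x (vsc r y))) as [q Hq].
  exists (vadd (vsc (/ r) (vsub p q)) (mv n A y)); intros k.
  apply Rmult_le_reg_l with (r * r); auto.
  specialize (Hq (vsc r k)). rewrite nrm2_sc, dot_scr in Hq.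
  replace (vadd (vadd x (vsc r y)) (vsc r k)) with (vadd x (vsc r (vadd y k))) in Hq.
  2:{ apply functional_extensionality; intros; unfold vadd, vsc; ring. }
  rewrite !Rmult_plus_distr_l, !Hh, dot_addl, dot_scl, dot_subl, dot_addr, quad_add by auto.
  pose proof (quad_le_trace n L A k HA Hlow) as HqA.
  pose proof (nrm2_ge0 n k).
  assert (quad n A k + L * nrm2 n k <= G * nrm2 n k).
  { apply Rle_trans with (1 := HqA). apply Rmult_le_compat_r; auto. unfold G; lra. }
  replace (r * r * (/ r * (dot n p k - dot n q k) + dot n (mv n A y) k))
    with (r * (dot n p k - dot n q k) + r * r * dot n (mv n A y) k) by (field; lra).
  assert (r * r * (quad n A k + L * nrm2 n k) <= r * r * (G * nrm2 n k)) by (apply Rmult_le_compat_l; lra).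
  lra.
- rewrite nm_sc, Rabs_right by (left; apply Rinv_0_lt_compat; auto).
  apply nm_le in Hk0; [|lra]. apply Rmult_le_reg_l with r; auto.
  rewrite <- Rmult_assoc, Rinv_r by lra. lra.
- apply Rmult_le_reg_l with (r * r); auto. rewrite Hh, dot_scr, quad_sc.
  replace (vsc r (vsc (/ r) k0)) with k0.
  2:{ apply functional_extensionality; intros; unfold vsc; field; lra. }
  replace (r * (/ r * dot n p k0)) with (dot n p k0) by (field; lra).
  replace (/ 2 * (r * r) * (/ r * / r * quad n A k0)) with (/ 2 * quad n A k0) by (field; lra). lra.
- exists (vsc r x'), (vadd (vsub p (vsc r w)) (mv n A (vsc r x'))), (madd A (msc (-1) S)).
  split; [rewrite nm_sc, Rabs_right by lra; nra|].
  split; [apply sym_madd; auto using sym_msc|].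
  split; [rewrite tr_madd, tr_msc; lra|].
  intros k Hk'. specialize (Hlo (vsc (/ r) k)).
  rewrite nrm2_sc, dot_scr, quad_sc in Hlo.
  assert (Hkk : / r * / r * nrm2 n k <= kap * kap).
  { apply Rmult_le_reg_l with (r * r); auto.
    replace (r * r * (/ r * / r * nrm2 n k)) with (nrm2 n k) by (field; lra). lra. }
  specialize (Hlo Hkk). apply (Rmult_le_compat_l (r * r)) in Hlo; [|lra].
  rewrite !Rmult_plus_distr_l, !Hh in Hlo.
  replace (vadd x (vsc r (vadd x' (vsc (/ r) k)))) with (vadd (vadd x (vsc r x')) k) in Hlo.
  2:{ apply functional_extensionality; intros; unfold vadd, vsc; field; lra. }
  rewrite dot_addr, dot_scr, quad_add, quad_sc, dot_scr in Hlo by auto.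
  rewrite dot_addl, dot_subl, dot_scl, quad_madd, quad_msc, mv_sc, dot_scl.
  replace (r * r * (/ r * dot n w k)) with (r * dot n w k) in Hlo by (field; lra).
  replace (r * r * (/ 2 * (/ r * / r * quad n S k))) with (/ 2 * quad n S k) in Hlo by (field; lra).
  replace (r * (dot n p x' + / r * dot n p k)) with (r * dot n p x' + dot n p k) in Hlo by (field; lra).
  replace (/ 2 * (r * r) * (quad n A x' + 2 * (/ r * dot n (mv n A x') k) + / r * / r * quad n A k))
    with (/ 2 * (r * r) * quad n A x' + r * dot n (mv n A x') k + / 2 * quad n A k) in Hlo by (field; lra).
  lra.
Qed.

Lemma quadratic_approx n L T eps : 0 < L -> 0 < T -> 0 < eps -> exists kap, 0 < kap /\
  forall f x p A r, continuous_on n (fun _ => True) f -> semiconvex n L f -> 0 < r ->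
  symmetric n A -> tr n A <= T -> touch n f x p A r ->
  exists d p' A' r', nm n d + r' <= r /\ kap * r <= r' /\ symmetric n A' /\ tr n A' <= T /\
    touch n f (vadd x d) p' A' r' /\
    forall k, nrm2 n k <= r' * r' ->
      f (vadd x d) + dot n p' k + / 2 * quad n A' k - eps * (r' * r') <= f (vadd (vadd x d) k).
Proof.
intros HL HT He.
(* [touch_step] measures the error with [r] but controls radius [r / 4], hence the factor 16. *)
destruct (touch_step n L T (eps / 16) HL HT ltac:(lra)) as [kap [c [Hk [Hc Hstep]]]].
(* [m] bounds the number of trace decrements still possible; at [m = 0] the trace would violate
   [touch_trace]. *)
assert (H : forall m, exists kap', 0 < kap' /\
  forall f x p A r, continuous_on n (fun _ => True) f -> semiconvex n L f -> 0 < r ->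
  symmetric n A -> tr n A <= T -> touch n f x p A r -> tr n A + INR n * L < INR m * c ->
  exists d p' A' r', nm n d + r' <= r /\ kap' * r <= r' /\ symmetric n A' /\ tr n A' <= T /\
    touch n f (vadd x d) p' A' r' /\
    forall k, nrm2 n k <= r' * r' ->
      f (vadd x d) + dot n p' k + / 2 * quad n A' k - eps * (r' * r') <= f (vadd (vadd x d) k)).
{ induction m as [|m [kap' [Hk' IH]]].
  - exists 1; split; [lra|]. intros f x p A r Hf Hs Hr HA HtA Ht Hlt.
    pose proof (touch_trace n L f x p A r Hr Hs Ht). simpl in Hlt; lra.
  - exists (Rmin (/ 4) (kap * kap')); split; [apply Rmin_pos; [lra|apply Rmult_lt_0_compat; lra]|].
    pose proof (Rmin_l (/ 4) (kap * kap')) as Hm1. pose proof (Rmin_r (/ 4) (kap * kap')) as Hm2.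
    intros f x p A r Hf Hs Hr HA HtA Ht Hlt. rewrite S_INR in Hlt.
    destruct (Hstep f x p A r Hf Hs Hr HA HtA Ht) as [Hgood|[d [p' [A' [Hd [HA' [HtA' Ht']]]]]]].
    + exists zero, p, A, (r / 4). rewrite vadd_zero_r.
      split.
      { unfold nm; unfold zero; rewrite nrm2_zero, sqrt_0; lra. }
      split; [nra|]. split; [auto|split; [auto|split]].
      * intros k Hk1; apply Ht. nra.
      * intros k Hk1. specialize (Hgood k Hk1). lra.
    + assert (Hkr : 0 < kap * r) by (apply Rmult_lt_0_compat; lra).
      destruct (IH f (vadd x d) p' A' (kap * r) Hf Hs Hkr HA' ltac:(lra) Ht' ltac:(lra))
        as [d2 [p2 [A2 [r2 [H1 [H2 [H3 [H4 [H5 H6]]]]]]]]].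
      exists (vadd d d2), p2, A2, r2. rewrite <- vadd_assoc.
      split; [pose proof (nm_add n d d2); nra|].
      split; [|auto]. apply Rle_trans with (2 := H2).
      apply Rle_trans with (kap * kap' * r); [nra|lra]. }
destruct (INR_unbounded ((T + INR n * L) / c)) as [m Hm].
destruct (H m) as [kap' [Hk' IH]]. exists kap'; split; auto.
intros f x p A r Hf Hs Hr HA HtA Ht. apply (IH f x p A r); auto.
apply (Rmult_lt_compat_r c) in Hm; auto.
replace ((T + INR n * L) / c * c) with (T + INR n * L) in Hm by (field; lra). lra.
Qed.

(** * Contact points of tilted semiconvex functions *)

(** A first order term cannot be dominated by a second order one: test at [- t g] with [t] small. *)
Lemma linear_zero n g a r : 0 < r -> 0 <= a ->
  (forall k, nrm2 n k <= r * r -> - a * nrm2 n k <= dot n g k) -> forall k, dot n g k = 0.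
Proof.
intros Hr Ha H. assert (Hg : nrm2 n g = 0).
{ destruct (Req_dec (nrm2 n g) 0) as [|Hne]; auto. exfalso.
  pose proof (nrm2_ge0 n g) as H0. pose proof (nm_ge0 n g) as H1. pose proof (nm_sq n g) as H2.
  set (t := Rmin (r / (nm n g + 1)) (/ (a + 1))).
  assert (Ht : 0 < t) by (apply Rmin_pos; [apply Rdiv_lt_0_compat|apply Rinv_0_lt_compat]; lra).
  assert (Ht1 : t * (nm n g + 1) <= r).
  { replace r with (r / (nm n g + 1) * (nm n g + 1)) at 1 by (field; lra).
    apply Rmult_le_compat_r; [lra|apply Rmin_l]. }
  assert (Ht2 : t * (a + 1) <= 1).
  { apply Rle_trans with (/ (a + 1) * (a + 1)); [|right; field; lra].
    apply Rmult_le_compat_r; [lra|apply Rmin_r]. }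
  clearbody t.
  specialize (H (vsc (- t) g)). rewrite nrm2_sc, dot_scr in H. change (dot n g g) with (nrm2 n g) in H.
  assert (H3 : - t * - t * nrm2 n g <= r * r).
  { rewrite <- H2. assert (0 <= t * nm n g <= r) by (split; nra).
    replace (- t * - t * (nm n g * nm n g)) with ((t * nm n g) * (t * nm n g)) by ring. nra. }
  specialize (H H3). assert (0 < t * nrm2 n g) by (apply Rmult_lt_0_compat; lra).
  assert (0 < 1 - t * a) by lra. assert (0 < (t * nrm2 n g) * (1 - t * a)) by (apply Rmult_lt_0_compat; lra). lra. }
intros k; pose proof (cauchy_schwarz2 n g k) as Hc; rewrite Hg in Hc. nra.
Qed.

(* A supergradient of a semiconvex function is also a subgradient. *)
Lemma semiconvex_grad n K f x p a r : 0 < r -> 0 <= a -> 0 <= K -> semiconvex n K f ->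
  (forall k, nrm2 n k <= r * r -> f (vadd x k) <= f x + dot n p k + a * nrm2 n k) ->
  forall k, f x + dot n p k - K / 2 * nrm2 n k <= f (vadd x k).
Proof.
intros Hr Ha HK Hs Hu k. destruct (Hs x) as [q Hq].
assert (H : dot n (vsub p q) k = 0).
{ apply (linear_zero n _ (a + K / 2) r); auto; [lra|]. intros k' Hk'.
  specialize (Hu k' Hk'); specialize (Hq k'). rewrite dot_subl; lra. }
rewrite dot_subl in H. specialize (Hq k); lra.
Qed.

(** Beyond radius [R1] quadratic decay beats the tilt and the values drop below the one at [zero];
    this gives existence by compactness and confines every maximiser. *)
Lemma tilted_max n f C c : 0 < c -> continuous_on n (fun _ => True) f ->
  (forall x, f x <= C - c * nrm2 n x) ->
  forall p, (exists x, forall y, f y - dot n p y <= f x - dot n p x) /\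
    (forall x, (forall y, f y - dot n p y <= f x - dot n p x) ->
      nm n x <= (Rabs (C - f zero) + nm n p) / c + 1).
Proof.
intros Hc Hf Hg p. set (R1 := (Rabs (C - f zero) + nm n p) / c + 1).
pose proof (Rabs_pos (C - f zero)) as HA. pose proof (nm_ge0 n p) as Hp.
assert (HR1 : c * R1 = Rabs (C - f zero) + nm n p + c) by (unfold R1; field; lra).
assert (HR : 1 <= R1) by (apply Rmult_le_reg_l with c; lra).
pose proof (dot_0r n p) as Hz.
assert (Hout : forall x, R1 < nm n x -> f x - dot n p x < f zero - dot n p zero).
{ intros x Hx. rewrite Hz. specialize (Hg x). pose proof (dot_ge n p x) as H1.
  rewrite <- nm_sq in Hg. pose proof (Rle_abs (C - f zero)) as H2.
  assert (c * (nm n x * nm n x) > (Rabs (C - f zero) + nm n p + c) * nm n x).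
  { rewrite <- HR1. assert (0 < c * nm n x) by (apply Rmult_lt_0_compat; lra). nra. }
  assert (Rabs (C - f zero) * 1 <= Rabs (C - f zero) * nm n x) by (apply Rmult_le_compat_l; lra).
  assert (0 < c * nm n x) by (apply Rmult_lt_0_compat; lra). lra. }
split.
- destruct (ball_max n zero R1 (fun x => f x - dot n p x)) as [x [Hx1 Hx2]]; [lra| |].
  { apply cont_minus; auto using cont_dot. }
  exists x; intros y. destruct (Rle_lt_dec (nm n y) R1) as [Hy|Hy].
  + apply Hx2. rewrite vsub_zero. apply nrm2_le; auto.
  + apply Rle_trans with (f zero - dot n p zero); [left; auto|apply Hx2].
    rewrite vsub_zero. rewrite nrm2_0; nra.
- intros x Hx. apply Rnot_lt_le; intros Hlt. specialize (Hx zero); specialize (Hout x Hlt); lra.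
Qed.

(** Minus the gradient of [F] sends a slope to the maximiser of the tilted [f]. Were [F] twice
    differentiable at [p1] with invertible Hessian, these maximisers would fill a ball around [xi].
    The finite-scale expansion gives this up to an error small compared with [r0], and semiconvexity
    of [f] turns a displacement [D] from the maximiser into a loss of order [nrm2 n D]. *)
Lemma almost_contact_ball n f K C c dl smax th : 0 < K -> 0 < c -> 0 < dl <= 1 -> 0 < smax -> 0 < th ->
  continuous_on n (fun _ => True) f -> semiconvex n K f -> (forall x, f x <= C - c * nrm2 n x) ->
  exists xi p1 r0, 0 < r0 <= smax /\ nm n p1 <= dl /\
    (forall y, f y - dot n p1 y <= f xi - dot n p1 xi) /\
    forall k, nm n k <= r0 -> exists l, nm n l <= dl /\
      forall y, f y - dot n l y <= f (vadd xi k) - dot n l (vadd xi k) + th * (r0 * r0).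
Proof.
intros HK Hc Hdl Hsm Hth Hf Hs Hg.
pose proof (tilted_max n f C c Hc Hf Hg) as Hmax.
destruct (functional_choice _ _ _ (fun p => proj1 (Hmax p))) as [X HX].
pose proof (fun p => proj2 (Hmax p) (X p) (HX p)) as HXb. clear Hmax.
set (B := Rabs (C - f zero)) in *.
assert (HB : 0 <= B) by apply Rabs_pos. clearbody B.
set (F := fun p => f (X p) - dot n p (X p)).
assert (HFle : forall p y, f y - dot n p y <= F p) by (intros; apply HX).
assert (HFsub : forall p q, F p - dot n (X p) q <= F (vadd p q)).
{ intros p q. pose proof (HFle (vadd p q) (X p)) as H. rewrite dot_addl in H.
  unfold F at 1. rewrite (dot_sym n (X p) q). lra. }
assert (HFsup : forall p q, F (vadd p q) <= F p - dot n (X (vadd p q)) q).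
{ intros p q. pose proof (HFle p (X (vadd p q))) as H. unfold F at 1.
  rewrite dot_addl, (dot_sym n (X (vadd p q)) q). lra. }
pose proof (pos_INR n) as Hn.
assert (HFs : semiconvex n 1 F).
{ intros p; exists (vsc (-1) (X p)); intros q. rewrite dot_scl. pose proof (HFsub p q).
  pose proof (nrm2_ge0 n q); lra. }
assert (HFc : continuous_on n (fun _ => True) F).
{ intros p _ eps He. set (R1 := (B + nm n p + 1) / c + 1).
  assert (HR1 : 1 <= R1).
  { unfold R1. pose proof (nm_ge0 n p). assert (0 <= (B + nm n p + 1) / c); [|lra].
    apply Rmult_le_pos; [lra|left; apply Rinv_0_lt_compat; auto]. }
  exists (Rmin 1 (eps / (R1 + 1))); split.
  { apply Rmin_pos; [lra|apply Rdiv_lt_0_compat; lra]. }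
  intros p2 _ Hd. rewrite dist_nm in Hd. set (q := vsub p2 p) in *.
  replace p2 with (vadd p q) by (unfold q; apply vadd_sub).
  pose proof (Rmin_l 1 (eps / (R1 + 1))); pose proof (Rmin_r 1 (eps / (R1 + 1))).
  pose proof (nm_ge0 n q) as Hq0.
  assert (Hb1 : nm n (X p) <= R1).
  { apply Rle_trans with (1 := HXb p). unfold R1. apply Rplus_le_compat_r.
    apply Rmult_le_compat_r; [left; apply Rinv_0_lt_compat; auto|lra]. }
  assert (Hb2 : nm n (X (vadd p q)) <= R1).
  { apply Rle_trans with (1 := HXb (vadd p q)). unfold R1. apply Rplus_le_compat_r.
    apply Rmult_le_compat_r; [left; apply Rinv_0_lt_compat; auto|]. pose proof (nm_add n p q); lra. }
  assert (Hq1 : R1 * nm n q < eps).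
  { apply Rle_lt_trans with ((R1 + 1) * nm n q); [nra|].
    replace eps with ((R1 + 1) * (eps / (R1 + 1))) by (field; lra). apply Rmult_lt_compat_l; lra. }
  pose proof (HFsub p q); pose proof (HFsup p q).
  pose proof (dot_le n (X p) q); pose proof (dot_ge n (X (vadd p q)) q).
  apply Rabs_def1; nra. }
set (R1 := (B + 1) / c + 1).
assert (HR1 : 1 <= R1).
{ unfold R1. assert (0 <= (B + 1) / c); [|lra].
  apply Rmult_le_pos; [lra|left; apply Rinv_0_lt_compat; auto]. }
assert (HXb1 : forall p, nm n p <= 1 -> nm n (X p) <= R1).
{ intros p Hp. apply Rle_trans with (1 := HXb p). unfold R1. apply Rplus_le_compat_r.
  apply Rmult_le_compat_r; [left; apply Rinv_0_lt_compat; auto|lra]. }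
clearbody R1.
(* [R1] bounds the slopes of [F], so this opening forces the maximum of [F - M / 2 * nrm2] over
   radius [dl / 2] to lie within [dl / 4], away from the edge. *)
set (M := 8 * R1 / dl).
assert (HM : M * dl = 8 * R1) by (unfold M; field; lra).
assert (HM0 : 0 < M) by (apply Rdiv_lt_0_compat; lra). clearbody M.
set (T := INR n * M + 1). assert (HT : 0 < T) by (unfold T; nra).
set (a := T + INR n). assert (Ha : 0 < a) by (unfold a; lra).
(* Ratio between the final loss [K / 2 * nrm2 n D], where [D] has length at most
   [(a / 2 + 1) * (e * s)] and [s = 8 * (K + 1) * r0], and the allowed [th * (r0 * r0)], apart from
   [e * e]. Then [e] is chosen with [e * e * H0 <= 1]. *)
set (H0 := (K / 2) * ((a / 2 + 1) * (a / 2 + 1)) * (64 * ((K + 1) * (K + 1))) / th).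
assert (HH0 : 0 < H0).
{ unfold H0. apply Rdiv_lt_0_compat; auto. repeat apply Rmult_lt_0_compat; lra. }
set (e := / (H0 + 2)).
assert (He : 0 < e) by (apply Rinv_0_lt_compat; lra).
assert (He1 : e * (H0 + 2) = 1) by (unfold e; field; lra).
assert (He2 : e <= / 2) by nra.
assert (HeH : e * e * H0 <= 1) by nra.
destruct (quadratic_approx n 1 T (e * e)) as [kap [Hkap Hqa]]; [lra|auto|nra|].
destruct (ball_max n zero (dl / 2) (fun p => F p - M / 2 * nrm2 n (vsub p zero))) as [p0 [Hp0 Hp0max]]; [lra| |].
{ apply cont_minus; auto. apply cont_scal, cont_nrm2_sub. }
rewrite vsub_zero in Hp0. pose proof (nm_le n p0 (dl / 2) ltac:(lra) Hp0) as Hp0n.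
assert (Hp0b : nm n p0 <= dl / 4).
{ pose proof (Hp0max zero) as H. rewrite !vsub_zero, nrm2_0 in H.
  specialize (H ltac:(nra)). rewrite <- nm_sq in H.
  pose proof (HFsup zero p0) as H1. rewrite vadd_zero in H1.
  pose proof (dot_ge n (X p0) p0) as H2. pose proof (HXb1 p0 ltac:(lra)) as H3. pose proof (nm_ge0 n p0) as H4.
  assert (nm n (X p0) * nm n p0 <= R1 * nm n p0) by (apply Rmult_le_compat_r; auto).
  assert (H6 : M / 2 * (nm n p0 * nm n p0) <= R1 * nm n p0) by lra.
  destruct (Req_dec (nm n p0) 0) as [E|E]; [lra|].
  assert (H7 : M / 2 * nm n p0 <= R1) by (apply Rmult_le_reg_r with (nm n p0); lra).
  apply Rmult_le_reg_l with M; auto. lra. }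
set (rin := Rmin (dl / 4) smax).
assert (Hrin : 0 < rin) by (apply Rmin_pos; lra).
assert (Hrin1 : rin <= dl / 4) by apply Rmin_l.
assert (Hrin2 : rin <= smax) by apply Rmin_r. clearbody rin.
destruct (Hqa F p0 (vsc M p0) (idm M) rin) as [d [g [A [s [Hds [Hsk [HA [HtA [Htch Hlow]]]]]]]]]; auto.
{ apply sym_idm. }
{ rewrite tr_idm; unfold T; lra. }
{ intros q Hq. rewrite dot_scl, quad_idm. pose proof (nm_le n q rin ltac:(lra) Hq).
  specialize (Hp0max (vadd p0 q)). rewrite !vsub_zero in Hp0max.
  pose proof (nm_add n p0 q). specialize (Hp0max ltac:(apply nrm2_le; lra)).
  rewrite nrm2_add in Hp0max. lra. }
assert (Hs0 : 0 < s) by (apply Rlt_le_trans with (2 := Hsk); apply Rmult_lt_0_compat; auto).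
pose proof (nm_ge0 n d) as Hd0.
set (p1 := vadd p0 d) in *.
assert (Hp1 : nm n p1 <= dl / 4 + nm n d) by (unfold p1; pose proof (nm_add n p0 d); lra).
clearbody p1. set (xi := X p1).
assert (HAa : forall q, quad n A q <= a * nrm2 n q).
{ intros q. pose proof (quad_le_trace n 1 A q HA (touch_lower n 1 F p1 g A s Hs0 HFs Htch)) as H.
  pose proof (nrm2_ge0 n q). unfold a.
  assert ((tr n A + INR n * 1) * nrm2 n q <= (T + INR n) * nrm2 n q) by (apply Rmult_le_compat_r; lra). lra. }
(* The slope of the expansion must agree with the subgradient [- xi] of [F] at [p1]. *)
assert (Hgx : forall q, dot n g q = - dot n xi q).
{ intros q. assert (H : dot n (vadd g xi) q = 0); [|rewrite dot_addl in H; lra].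
  apply (linear_zero n _ (/ 2 * a) s); auto; [lra|]. intros k Hk. rewrite dot_addl.
  pose proof (Htch k Hk); pose proof (HFsub p1 k); pose proof (HAa k). fold xi in H0. unfold xi at 1. lra. }
assert (Hgrad : forall p k, f (X p) + dot n p k - K / 2 * nrm2 n k <= f (vadd (X p) k)).
{ intros p. apply (semiconvex_grad n K f (X p) p 0 1); auto; try lra. intros k _.
  pose proof (HX p (vadd (X p) k)) as H. rewrite dot_addr in H. lra. }
(* Semiconvexity of [f] makes [F] strongly convex, so that [A] is invertible. *)
assert (Hstrong : forall q, nrm2 n q <= s * s -> nrm2 n q <= K * quad n A q).
{ intros q Hq. pose proof (Htch q Hq) as H1. pose proof (HFle (vadd p1 q) (vadd xi (vsc (- / K) q))) as H2.
  pose proof (Hgrad p1 (vsc (- / K) q)) as H3. fold xi in H3.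
  rewrite dot_addl, !dot_addr, !dot_scr in H2. rewrite dot_scr, nrm2_sc in H3.
  change (dot n q q) with (nrm2 n q) in H2. rewrite Hgx in H1. unfold F in H1 at 2; fold xi in H1.
  rewrite (dot_sym n xi q) in H1.
  replace (K / 2 * (- / K * - / K * nrm2 n q)) with (/ 2 * (/ K * nrm2 n q)) in H3 by (field; lra).
  assert (H4 : / K * nrm2 n q <= quad n A q) by lra.
  apply (Rmult_le_compat_l K) in H4; [|lra].
  replace (K * (/ K * nrm2 n q)) with (nrm2 n q) in H4 by (field; lra). lra. }
(* The solution of [A q0 = - k] has length at most [2 * K * nm n k]; this radius keeps it within
   [s / 4], well inside the ball of the expansion. *)
set (r0 := s / (8 * (K + 1))).
assert (Hr0 : 8 * (K + 1) * r0 = s) by (unfold r0; field; lra).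
assert (Hr00 : 0 < r0) by (apply Rdiv_lt_0_compat; lra).
assert (Hr0s : r0 <= s) by nra.
exists xi, p1, r0. split; [lra|]. split; [lra|]. split; [apply HX|].
intros k Hk.
(* [q0] solves [A q0 = - k]; the maximiser for the slope [p1 + q0] is then [xi + k] up to [O(e s)]. *)
destruct (ball_max n zero (s / 2) (fun q => - (/ 2 * quad n A q + dot n k q))) as [q0 [Hq0 Hq0max]]; [lra| |].
{ apply cont_opp, cont_plus; [apply cont_scal, cont_quad|apply cont_dot]. }
rewrite vsub_zero in Hq0.
assert (Hq0n : nm n q0 <= s / 4).
{ pose proof (Hq0max zero) as H. rewrite vsub_zero in H. rewrite nrm2_0 in H.
  specialize (H ltac:(nra)).
  rewrite quad_0, dot_0r in H. pose proof (Hstrong q0 ltac:(nra)) as H1. rewrite <- nm_sq in H1.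
  pose proof (dot_ge n k q0) as H2. pose proof (nm_ge0 n q0) as H3. pose proof (nm_ge0 n k) as H4.
  destruct (Req_dec (nm n q0) 0) as [E|E]; [lra|].
  assert (H5 : K * (/ 2 * quad n A q0) <= K * (nm n k * nm n q0)) by (apply Rmult_le_compat_l; lra).
  assert (H6 : nm n q0 <= 2 * K * nm n k) by (apply Rmult_le_reg_r with (nm n q0); lra).
  apply Rle_trans with (1 := H6). nra. }
assert (Hq0c : forall q, dot n (mv n A q0) q = - dot n k q).
{ intros q. assert (H : dot n (vadd (mv n A q0) k) q = 0); [|rewrite dot_addl in H; lra].
  apply (linear_zero n _ (/ 2 * a) (s / 4)); auto; try lra. intros q' Hq'.
  apply nm_le in Hq'; [|lra].
  specialize (Hq0max (vadd q0 q')). rewrite vsub_zero in Hq0max.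
  pose proof (nm_add n q0 q'). specialize (Hq0max ltac:(apply nrm2_le; lra)).
  rewrite quad_add, dot_addr in Hq0max by auto. rewrite dot_addl. pose proof (HAa q'). lra. }
set (p' := vadd p1 q0). set (x' := X p'). set (x := vadd xi k).
assert (Hp'n : nm n p' <= dl) by (unfold p'; pose proof (nm_add n p1 q0); lra).
exists p'; split; auto.
set (D := vsub x x').
(* At [p'] the expansion has slope [- x] and [F] has subgradient [- x']. Compared along [eta] of
   length [e * s], an error [e * e * (s * s)] in value becomes one of order [e * s] in slope. *)
assert (HD : nm n D <= (a / 2 + 1) * (e * s)).
{ assert (Hes : 0 < e * s) by (apply Rmult_lt_0_compat; lra).
  pose proof (nm_ge0 n D) as H1. destruct (Req_dec (nm n D) 0) as [E|E].
  { rewrite E. apply Rmult_le_pos; lra. }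
  set (eta := vsc (e * s / nm n D) D).
  assert (Hc0 : 0 < e * s / nm n D) by (apply Rdiv_lt_0_compat; lra).
  assert (Heta : nm n eta = e * s).
  { unfold eta; rewrite nm_sc, Rabs_right by lra. field; lra. }
  pose proof (HFsub p' eta) as H2. fold x' in H2.
  assert (Hqe : nrm2 n (vadd q0 eta) <= s * s).
  { apply nrm2_le. pose proof (nm_add n q0 eta). nra. }
  pose proof (Htch _ Hqe) as H3. rewrite <- vadd_assoc in H3. fold p' in H3.
  pose proof (Hlow q0 ltac:(nra)) as H4. fold p' in H4.
  rewrite quad_add, dot_addr, Hq0c, !Hgx in H3 by auto. rewrite Hgx in H4.
  pose proof (HAa eta) as H5. rewrite <- nm_sq, Heta in H5.
  assert (H6 : dot n D eta = nm n D * (e * s)).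
  { unfold eta. rewrite dot_scr. change (dot n D D) with (nrm2 n D). rewrite <- nm_sq. field; lra. }
  unfold D in H6 at 1. rewrite dot_subl in H6. unfold x in H6 at 1. rewrite dot_addl in H6.
  apply Rmult_le_reg_r with (e * s); auto. lra. }
intros y. pose proof (HFle p' y) as H1. pose proof (Hgrad p' D) as H2. fold x' in H2.
replace (vadd x' D) with x in H2 by (unfold D; rewrite vadd_sub; auto).
unfold F in H1; fold x' in H1. unfold D in H2 at 1. rewrite dot_subr in H2.
assert (H3 : K / 2 * nrm2 n D <= th * (r0 * r0)); [|lra].
apply nrm2_le in HD.
apply Rle_trans with (K / 2 * (((a / 2 + 1) * (e * s)) * ((a / 2 + 1) * (e * s)))).
{ apply Rmult_le_compat_l; lra. }
rewrite <- Hr0.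
replace (K / 2 * ((a / 2 + 1) * (e * (8 * (K + 1) * r0)) * ((a / 2 + 1) * (e * (8 * (K + 1) * r0)))))
  with (th * (r0 * r0) * (e * e * H0)) by (unfold H0; field; lra).
rewrite <- (Rmult_1_r (th * (r0 * r0))) at 2. apply Rmult_le_compat_l; auto.
apply Rmult_le_pos; nra.
Qed.

Lemma semiconvex_plus n K f g : semiconvex n K f -> semiconvex n K g ->
  semiconvex n (2 * K) (fun x => f x + g x).
Proof.
intros Hf Hg x. destruct (Hf x) as [p Hp]; destruct (Hg x) as [q Hq].
exists (vadd p q); intros k. rewrite dot_addl. specialize (Hp k); specialize (Hq k). lra.
Qed.

(** Polarisation with [k + r v] and [k - r v]. *)
Lemma polar_bound n A M r k v : symmetric n A -> 0 < r -> 0 <= M ->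
  (forall w, Rabs (quad n A w) <= M * nrm2 n w) ->
  nm n k <= r -> nm n v <= 1 -> Rabs (dot n (mv n A k) v) <= M * r.
Proof.
intros HA Hr HM0 HM Hk Hv.
pose proof (HM (vadd k (vsc r v))) as H1. pose proof (HM (vadd k (vsc (- r) v))) as H2.
apply nrm2_le in Hk. apply nrm2_le in Hv.
rewrite quad_add, nrm2_add, !dot_scr, quad_sc, nrm2_sc in H1 by auto.
rewrite quad_add, nrm2_add, !dot_scr, quad_sc, nrm2_sc in H2 by auto.
apply Rabs_le_bounds in H1. apply Rabs_le_bounds in H2.
pose proof (nrm2_ge0 n k). pose proof (nrm2_ge0 n v).
assert (M * nrm2 n k <= M * (r * r)) by (apply Rmult_le_compat_l; lra).
assert (M * (r * r * nrm2 n v) <= M * (r * r)) by (apply Rmult_le_compat_l; nra).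
apply Rabs_le; split; apply Rmult_le_reg_l with r; auto; lra.
Qed.

(** Near-contact at every point of the ball converts the lower bound of [U] by its expansion into an
    upper bound of [V] with Hessian [- A]; a small quadratic correction makes the latter touch at
    [x1 + k0]. The points [x1] and [x2] may differ, but both are almost maximal for [U + V], which
    is enough to locate them. *)
Theorem semiconvex_sums n U V K C c e0 : 0 < K -> 0 < c -> 0 < e0 ->
  continuous_on n (fun _ => True) U -> continuous_on n (fun _ => True) V ->
  semiconvex n K U -> semiconvex n K V -> (forall x, U x + V x <= C - c * nrm2 n x) ->
  exists x1 x2 p1 p2 A1 A2 r1 r2, 0 < r1 /\ 0 < r2 /\ symmetric n A1 /\ symmetric n A2 /\
    touch n U x1 p1 A1 r1 /\ touch n V x2 p2 A2 r2 /\
    (forall v, nm n v <= 1 -> dot n (vadd p1 p2) v <= e0) /\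
    (forall v, quad n A1 v + quad n A2 v <= e0 * nrm2 n v) /\
    (forall y, U y + V y <= U x1 + V x1 + e0) /\ (forall y, U y + V y <= U x2 + V x2 + e0).
Proof.
intros HK Hc He0 HU HV HsU HsV Hg.
set (f := fun x => U x + V x).
assert (Hf : continuous_on n (fun _ => True) f) by (apply cont_plus; auto).
pose proof (semiconvex_plus n K U V HsU HsV) as Hsf. fold f in Hsf.
pose proof (tilted_max n f C c Hc Hf Hg) as Hmax.
pose proof (Rabs_pos (C - f zero)) as HB. pose proof (pos_INR n) as Hn.
set (R1 := (Rabs (C - f zero) + 1) / c + 1).
assert (HR1 : forall p x, nm n p <= 1 -> (forall y, f y - dot n p y <= f x - dot n p x) -> nm n x <= R1).
{ intros p x Hp Hx. apply Rle_trans with (1 := proj2 (Hmax p) x Hx). unfold R1. apply Rplus_le_compat_r.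
  apply Rmult_le_compat_r; [left; apply Rinv_0_lt_compat; auto|lra]. }
assert (HR1p : 1 <= R1).
{ unfold R1. assert (0 <= (Rabs (C - f zero) + 1) / c); [|lra].
  apply Rmult_le_pos; [lra|left; apply Rinv_0_lt_compat; auto]. }
clearbody R1.
set (e1 := Rmin (e0 / 32) 1).
assert (He1 : 0 < e1) by (apply Rmin_pos; lra).
assert (He1a : e1 <= e0 / 32) by apply Rmin_l. assert (He1b : e1 <= 1) by apply Rmin_r. clearbody e1.
set (T := INR n * K + 1). assert (HT : 0 < T) by (unfold T; nra).
set (M := T + INR n * K + K). assert (HM : 0 < M) by (unfold M; nra).
destruct (quadratic_approx n K T e1 HK HT He1) as [kap [Hkap Hqa]].
(* [dl] limits the effect of the tilt on slopes, and on values over radius [R1 + 1]; [smax] limits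
   the term [A k0]. Each may use a quarter of [e0]. *)
set (dl := Rmin 1 (e0 / (4 * (2 * R1 + 1)))).
assert (Hdl : 0 < dl <= 1).
{ split; [apply Rmin_pos; [lra|apply Rdiv_lt_0_compat; lra]|apply Rmin_l]. }
assert (Hdl2 : dl * (2 * R1 + 1) <= e0 / 4).
{ apply Rle_trans with (e0 / (4 * (2 * R1 + 1)) * (2 * R1 + 1)); [|right; field; lra].
  apply Rmult_le_compat_r; [lra|apply Rmin_r]. }
clearbody dl.
set (smax := Rmin 1 (e0 / (4 * (M + 1)))).
assert (Hsm : 0 < smax <= 1).
{ split; [apply Rmin_pos; [lra|apply Rdiv_lt_0_compat; lra]|apply Rmin_l]. }
assert (Hsm2 : M * smax <= e0 / 4).
{ apply Rle_trans with ((M + 1) * (e0 / (4 * (M + 1)))); [|right; field; lra].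
  apply Rle_trans with ((M + 1) * smax); [nra|]. apply Rmult_le_compat_l; [lra|apply Rmin_r]. }
clearbody smax.
(* The tolerance is fixed before [r] is known; [kap * r0 <= r] turns it into [e1 * (r * r)]. *)
assert (Hth : 0 < e1 * (kap * kap)) by (repeat apply Rmult_lt_0_compat; auto).
destruct (almost_contact_ball n f (2 * K) C c dl smax (e1 * (kap * kap)))
  as [xi [p1 [r0 [Hr0 [Hp1 [Hxi Hball]]]]]]; auto; try lra.
assert (Hxin : nm n xi <= R1) by (apply (HR1 p1); auto; lra).
destruct (proj1 (Hmax zero)) as [xm Hxm].
assert (Hz0 : nm n zero = 0) by (unfold nm; rewrite nrm2_0; apply sqrt_0).
assert (Hxmn : nm n xm <= R1) by (apply (HR1 zero); auto; lra).
assert (Hnear : forall k E l y, nm n k <= r0 -> nm n l <= dl -> E <= e1 ->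
  (forall y, f y - dot n l y <= f (vadd xi k) - dot n l (vadd xi k) + E) -> f y <= f (vadd xi k) + e0).
{ intros k E l y Hk Hl HE H. apply Rle_trans with (f xm).
  { specialize (Hxm y). rewrite !(dot_sym n zero), !dot_0r in Hxm; lra. }
  specialize (H xm). pose proof (dot_le n l xm) as H1. pose proof (dot_ge n l (vadd xi k)) as H2.
  pose proof (nm_add n xi k) as H3.
  pose proof (nm_ge0 n l). pose proof (nm_ge0 n xm). pose proof (nm_ge0 n (vadd xi k)).
  assert (nm n l * nm n xm <= dl * R1) by (apply Rmult_le_compat; auto).
  assert (nm n l * nm n (vadd xi k) <= dl * (R1 + 1)) by (apply Rmult_le_compat; lra).
  lra. }
destruct (HsU xi) as [pU HpU]. destruct (HsV xi) as [pV HpV].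
(* The affine function above [f] minus the paraboloid below [V] touches [U] from above at [xi], with
   Hessian [K]. *)
destruct (Hqa U xi (vsub p1 pV) (idm K) r0) as [d [p' [A [r [Hdr [Hkr [HA [HtA [Htch Hlow]]]]]]]]]; auto; try lra.
{ apply sym_idm. }
{ rewrite tr_idm; unfold T; lra. }
{ intros k _. rewrite dot_subl, quad_idm. specialize (HpV k). specialize (Hxi (vadd xi k)).
  rewrite dot_addr in Hxi. unfold f in Hxi. lra. }
pose proof (nm_ge0 n d) as Hd0.
assert (Hr : 0 < r) by (apply Rlt_le_trans with (2 := Hkr); apply Rmult_lt_0_compat; lra).
assert (Herr : e1 * (kap * kap) * (r0 * r0) <= e1 * (r * r)).
{ rewrite Rmult_assoc. apply Rmult_le_compat_l; [lra|].
  replace (kap * kap * (r0 * r0)) with ((kap * r0) * (kap * r0)) by ring.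
  apply Rmult_le_compat; auto; apply Rmult_le_pos; lra. }
assert (Herr1 : e1 * (r * r) <= e1) by (assert (r * r <= 1) by nra; nra).
set (x1 := vadd xi d) in *.
assert (HAM : forall w, Rabs (quad n A w) <= M * nrm2 n w).
{ intros w. pose proof (touch_lower n K U x1 p' A r Hr HsU Htch) as H1.
  pose proof (quad_le_trace n K A w HA H1) as H2. specialize (H1 w). pose proof (nrm2_ge0 n w) as H3.
  assert ((tr n A + INR n * K) * nrm2 n w <= (T + INR n * K) * nrm2 n w) by (apply Rmult_le_compat_r; lra).
  assert (0 <= INR n * K * nrm2 n w) by (repeat apply Rmult_le_pos; lra).
  assert (0 <= T * nrm2 n w) by (apply Rmult_le_pos; lra).
  assert (0 <= K * nrm2 n w) by (apply Rmult_le_pos; lra).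
  unfold M. apply Rabs_le; split; lra. }
destruct (Hball d ltac:(lra)) as [l [Hl Hlmax]]. fold x1 in Hlmax.
(* Without its last term [G] exceeds its value at [zero] by at most [2 * e1 * (r * r)], so
   subtracting [4 * e1 * nrm2] forces the maximum strictly inside radius [r]. *)
set (G := fun k => V (vadd x1 k) - dot n (vsub l p') k + / 2 * quad n A k - 4 * e1 * nrm2 n k).
assert (HGup : forall k, nrm2 n k <= r * r -> G k <= V x1 + 2 * e1 * (r * r) - 4 * e1 * nrm2 n k).
{ intros k Hk. unfold G. specialize (Hlow k Hk). specialize (Hlmax (vadd x1 k)).
  rewrite dot_addr in Hlmax. unfold f in Hlmax. rewrite dot_subl. lra. }
destruct (ball_max n zero r G) as [k0 [Hk0 Hk0max]]; [lra| |].
{ unfold G. apply cont_minus; [apply cont_plus; [apply cont_minus|]|].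
  - apply cont_ext with (fun k => V (vadd x1 (vsc 1 k))).
    + intros; f_equal; apply functional_extensionality; intros; unfold vadd, vsc; ring.
    + apply cont_affine with (2 := HV); auto.
  - apply cont_dot.
  - apply cont_scal, cont_quad.
  - apply cont_scal. apply cont_ext with (fun x => nrm2 n (vsub x zero)).
    + intros; now rewrite vsub_zero.
    + apply cont_nrm2_sub. }
rewrite vsub_zero in Hk0.
assert (Hk0n : nm n k0 < r).
{ pose proof (Hk0max zero) as H. rewrite vsub_zero, nrm2_0 in H. specialize (H ltac:(nra)).
  pose proof (HGup k0 Hk0) as H1. unfold G at 1 in H.
  rewrite vadd_zero_r, dot_0r, quad_0, nrm2_0 in H.
  apply nm_lt; [lra|]. apply Rmult_lt_reg_l with (4 * e1); [lra|].
  assert (0 < e1 * (r * r)) by (apply Rmult_lt_0_compat; nra). lra. }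
exists x1, (vadd x1 k0), p', (vadd (vsub (vsub l p') (mv n A k0)) (vsc (8 * e1) k0)), A,
  (madd (msc (-1) A) (idm (8 * e1))), r, (r - nm n k0).
split; [auto|split; [lra|split; [auto|split]]].
{ apply sym_madd; [apply sym_msc; auto|apply sym_idm]. }
split; [auto|split; [|split; [|split; [|split]]]].
- intros k Hk. apply nm_le in Hk; [|lra].
  specialize (Hk0max (vadd k0 k)). rewrite vsub_zero in Hk0max.
  pose proof (nm_add n k0 k). specialize (Hk0max ltac:(apply nrm2_le; lra)).
  unfold G in Hk0max. rewrite quad_add, dot_addr, nrm2_add, !dot_subl, <- vadd_assoc in Hk0max by auto.
  rewrite quad_madd, quad_msc, quad_idm, dot_addl, !dot_subl, dot_scl. lra.
- intros v Hv. rewrite !dot_addl, !dot_subl, dot_scl.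
  pose proof (polar_bound n A M r k0 v HA Hr ltac:(lra) HAM ltac:(lra) Hv) as H1.
  apply Rabs_le_bounds in H1.
  pose proof (dot_le n l v) as H2. pose proof (dot_le n k0 v) as H3.
  pose proof (nm_ge0 n l). pose proof (nm_ge0 n k0). pose proof (nm_ge0 n v).
  assert (nm n l * nm n v <= dl * 1) by (apply Rmult_le_compat; lra).
  assert (nm n k0 * nm n v <= 1 * 1) by (apply Rmult_le_compat; lra).
  assert (M * r <= M * smax) by (apply Rmult_le_compat_l; lra).
  assert (8 * e1 * dot n k0 v <= 8 * e1 * 1) by (apply Rmult_le_compat_l; lra).
  assert (dl * 1 <= dl * (2 * R1 + 1)) by (apply Rmult_le_compat_l; lra). lra.
- intros v. rewrite quad_madd, quad_msc, quad_idm. pose proof (nrm2_ge0 n v).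
  assert (8 * e1 * nrm2 n v <= e0 * nrm2 n v) by (apply Rmult_le_compat_r; lra). lra.
- intros y. apply (Hnear d (e1 * (kap * kap) * (r0 * r0)) l y); auto; lra.
- intros y. destruct (Hball (vadd d k0)) as [l2 [Hl2 Hl2max]].
  { pose proof (nm_add n d k0); lra. }
  unfold x1. rewrite vadd_assoc.
  apply (Hnear (vadd d k0) (e1 * (kap * kap) * (r0 * r0)) l2 y); auto; try lra.
  pose proof (nm_add n d k0); lra.
Qed.

(** * Sup-convolutions and comparison *)

Lemma cont_inv n S f g0 : 0 < g0 -> (forall x, S x -> g0 <= f x) -> continuous_on n S f ->
  continuous_on n S (fun x => / f x).
Proof.
intros Hg0 Hg Hf x Hx eps He. destruct (Hf x Hx (eps * (g0 * g0))) as [d [Hd Hd']].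
{ apply Rmult_lt_0_compat; nra. }
exists d; split; auto. intros y Hy Hxy. specialize (Hd' y Hy Hxy).
pose proof (Hg x Hx) as H1; pose proof (Hg y Hy) as H2.
replace (/ f y - / f x) with (- (f y - f x) * / (f y * f x)) by (field; lra).
assert (Hp : g0 * g0 <= f y * f x) by nra. assert (Hp0 : 0 < g0 * g0) by nra.
rewrite Rabs_mult, Rabs_Ropp, (Rabs_right (/ _)) by (left; apply Rinv_0_lt_compat; lra).
apply Rmult_lt_reg_r with (f y * f x); [lra|].
rewrite Rmult_assoc, Rinv_l, Rmult_1_r by lra. nra.
Qed.

(** The maximiser [Z] is returned because jets of [G] at [x] are later moved to [g] at [Z x].
    Keeping [Z x] as competitor at [x + k] gives semiconvexity; boundedness of [D] gives the
    quadratic decay. *)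
Lemma sup_convolution n D M g ka : 0 < ka -> (exists x, D x) -> (forall x, D x -> nrm2 n x <= M) ->
  seq_closed n D -> continuous_on n D g ->
  exists (G : pt -> R) (Z : pt -> pt), (forall x, D (Z x)) /\
    (forall x, G x = g (Z x) - ka * nrm2 n (vsub x (Z x))) /\
    (forall x z, D z -> g z - ka * nrm2 n (vsub x z) <= G x) /\
    semiconvex n (2 * ka) G /\ continuous_on n (fun _ => True) G /\
    exists C, forall x, G x <= C - ka / 2 * nrm2 n x.
Proof.
intros Hka Hne HM HD Hg.
assert (H : forall x, exists z, D z /\ forall y, D y ->
  g y - ka * nrm2 n (vsub x y) <= g z - ka * nrm2 n (vsub x z)).
{ intros x. destruct (evt n D M (fun y => g y - ka * nrm2 n (vsub y x))) as [z [Hz1 Hz2]]; auto.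
  - apply cont_minus; auto. apply cont_scal, cont_nrm2_sub.
  - exists z; split; auto. intros y Hy. specialize (Hz2 y Hy).
    rewrite !nrm2_sub in *. rewrite (dot_sym n x y), (dot_sym n x z). lra. }
destruct (functional_choice _ _ _ H) as [Z HZ]. clear H.
exists (fun x => g (Z x) - ka * nrm2 n (vsub x (Z x))), Z.
assert (HZ1 : forall x, D (Z x)) by apply HZ.
assert (HZ2 : forall x z, D z -> g z - ka * nrm2 n (vsub x z) <= g (Z x) - ka * nrm2 n (vsub x (Z x))).
{ intros x z Hz; apply HZ; auto. }
assert (Hsub : forall x k, g (Z x) - ka * nrm2 n (vsub x (Z x)) + dot n (vsc (- 2 * ka) (vsub x (Z x))) k
  - ka * nrm2 n k <= g (Z (vadd x k)) - ka * nrm2 n (vsub (vadd x k) (Z (vadd x k)))).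
{ intros x k. apply Rle_trans with (2 := HZ2 (vadd x k) (Z x) (HZ1 x)).
  replace (vsub (vadd x k) (Z x)) with (vadd (vsub x (Z x)) k).
  2:{ apply functional_extensionality; intros; unfold vadd, vsub; ring. }
  rewrite nrm2_add, dot_scl. lra. }
split; [auto|split; [auto|split; [auto|split; [|split]]]].
- intros x. exists (vsc (- 2 * ka) (vsub x (Z x))). intros k. specialize (Hsub x k). lra.
- intros x _ eps He.
  assert (HM0 : 0 <= M) by (destruct Hne as [z Hz]; apply Rle_trans with (2 := HM z Hz); apply nrm2_ge0).
  set (B := nm n x + 1 + (M + 1)).
  assert (HZn : forall y, nm n (Z y) <= M + 1).
  { intros y; apply nm_le; [lra|]. pose proof (HM _ (HZ1 y)); nra. }
  pose proof (nm_ge0 n x) as Hx0. assert (HB : 1 <= B) by (unfold B; lra).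
  assert (Hb1 : nm n (vsub x (Z x)) <= B).
  { unfold B; pose proof (nm_sub n x (Z x)); pose proof (HZn x); lra. }
  assert (Hb2 : forall k, nm n k <= 1 -> nm n (vsub (vadd x k) (Z (vadd x k))) <= B).
  { intros k Hk; unfold B; pose proof (nm_sub n (vadd x k) (Z (vadd x k))); pose proof (nm_add n x k).
    pose proof (HZn (vadd x k)); lra. }
  clearbody B.
  exists (Rmin 1 (eps / (ka * (2 * B + 2)))); split.
  { apply Rmin_pos; [lra|apply Rdiv_lt_0_compat; auto; apply Rmult_lt_0_compat; lra]. }
  intros y _ Hxy. rewrite dist_nm in Hxy. set (k := vsub y x) in *.
  replace y with (vadd x k) by (unfold k; apply vadd_sub).
  pose proof (Rmin_l 1 (eps / (ka * (2 * B + 2)))) as Hm1. pose proof (Rmin_r 1 (eps / (ka * (2 * B + 2)))) as Hm2.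
  assert (Hk1 : nm n k <= 1) by lra.
  assert (Hk2 : nm n k * (ka * (2 * B + 2)) < eps).
  { replace eps with (eps / (ka * (2 * B + 2)) * (ka * (2 * B + 2))) by (field; lra).
    apply Rmult_lt_compat_r; [apply Rmult_lt_0_compat|]; lra. }
  pose proof (nm_ge0 n k) as Hk0. pose proof (nm_sq n k) as Hksq.
  pose proof (Hsub x k) as H1. rewrite dot_scl in H1.
  pose proof (Hsub (vadd x k) (vsc (-1) k)) as H2.
  replace (vadd (vadd x k) (vsc (-1) k)) with x in H2.
  2:{ apply functional_extensionality; intros; unfold vadd, vsc; ring. }
  rewrite dot_scl, dot_scr, nrm2_sc in H2.
  pose proof (dot_le n (vsub x (Z x)) k) as H3.
  pose proof (dot_ge n (vsub (vadd x k) (Z (vadd x k))) k) as H4. specialize (Hb2 k Hk1).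
  pose proof (nm_ge0 n (vsub x (Z x))). pose proof (nm_ge0 n (vsub (vadd x k) (Z (vadd x k)))).
  assert (nm n (vsub x (Z x)) * nm n k <= B * nm n k) by (apply Rmult_le_compat_r; auto).
  assert (nm n (vsub (vadd x k) (Z (vadd x k))) * nm n k <= B * nm n k) by (apply Rmult_le_compat_r; auto).
  assert (Hkk : nrm2 n k <= nm n k) by nra.
  assert (ka * nrm2 n k <= ka * nm n k) by (apply Rmult_le_compat_l; lra).
  assert (ka * dot n (vsub x (Z x)) k <= ka * (B * nm n k)) by (apply Rmult_le_compat_l; lra).
  assert (ka * - dot n (vsub (vadd x k) (Z (vadd x k))) k <= ka * (B * nm n k)) by (apply Rmult_le_compat_l; lra).
  assert (0 <= ka * nm n k) by (apply Rmult_le_pos; lra).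
  apply Rabs_def1; lra.
- destruct (evt n D M g Hne HM HD Hg) as [zm [_ Hzm]].
  exists (g zm + ka * M). intros x. specialize (Hzm _ (HZ1 x)). pose proof (HM _ (HZ1 x)) as HMz.
  set (z := Z x) in *.
  assert (H : nrm2 n x <= 2 * nrm2 n (vsub x z) + 2 * nrm2 n z).
  { pose proof (nrm2_ge0 n (vsub (vsub x z) z)) as H0. rewrite nrm2_sub in H0.
    pose proof (nrm2_add n z (vsub x z)) as H1. rewrite vadd_sub in H1. rewrite (dot_sym n z) in H1. lra. }
  apply (Rmult_le_compat_l (ka / 2)) in H; [|lra].
  assert (ka * nrm2 n z <= ka * M) by (apply Rmult_le_compat_l; lra). lra.
Qed.

(** * Space-time cylinders and parabolic jets *)

(* A point [(x, t)] of [R^N x R] is encoded in [R^(N+1)], with time as coordinate [N]. *)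
Definition glue (N : nat) (x : pt) (t : R) : pt := fun i => if Nat.eqb i N then t else x i.
Definition cylinder (N : nat) (S : pt -> Prop) (T : R) (z : pt) : Prop :=
  InRn (Datatypes.S N) z /\ S (trunc N z) /\ 0 <= z N <= T.

Lemma nrm2_S N z : nrm2 (S N) z = nrm2 N z + z N * z N.
Proof. reflexivity. Qed.
Lemma dot_S N y z : dot (S N) y z = dot N y z + y N * z N.
Proof. reflexivity. Qed.
Lemma quad_S N A z : symmetric (S N) A ->
  quad (S N) A z = quad N A z + 2 * (z N * dot N (fun i => A i N) z) + A N N * (z N * z N).
Proof.
intros HA. unfold quad; simpl. rewrite sumN_plus.
assert (E1 : sumN N (fun i => A i N * z i * z N) = z N * dot N (fun i => A i N) z).
{ unfold dot; rewrite <- sumN_mult; apply sumN_ext; intros; ring. }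
assert (E2 : sumN N (fun k => A N k * z N * z k) = z N * dot N (fun i => A i N) z).
{ unfold dot; rewrite <- sumN_mult; apply sumN_ext; intros. rewrite (HA N i) by lia; ring. }
rewrite E1, E2; ring.
Qed.

Lemma trunc_id N x : InRn N x -> trunc N x = x.
Proof.
intros H; apply functional_extensionality; intros i; unfold trunc.
destruct (Nat.ltb_spec i N); auto. symmetry; apply H; auto.
Qed.
Lemma trunc_glue N x t : InRn N x -> trunc N (glue N x t) = x.
Proof.
intros H; rewrite <- (trunc_id N x H) at 2. apply functional_extensionality; intros i; unfold trunc, glue.
destruct (Nat.ltb_spec i N); auto. destruct (Nat.eqb_spec i N); [lia|auto].
Qed.
Lemma glue_N N x t : glue N x t N = t.
Proof. unfold glue; now rewrite Nat.eqb_refl. Qed.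
Lemma glue_lt N x t i : (i < N)%nat -> glue N x t i = x i.
Proof. intros H; unfold glue; destruct (Nat.eqb_spec i N); [lia|auto]. Qed.
Lemma InRn_glue N x t : InRn N x -> InRn (S N) (glue N x t).
Proof. intros H i Hi; unfold glue; destruct (Nat.eqb_spec i N); [lia|apply H; lia]. Qed.
Lemma glue_trunc N z : InRn (S N) z -> glue N (trunc N z) (z N) = z.
Proof.
intros H; apply functional_extensionality; intros i; unfold glue, trunc.
destruct (Nat.eqb_spec i N) as [->|]; auto. destruct (Nat.ltb_spec i N); auto. symmetry; apply H; lia.
Qed.

Lemma dist_S N x y : dist N (trunc N x) (trunc N y) <= dist (S N) x y /\ Rabs (y N - x N) <= dist (S N) x y.
Proof.
split.
- rewrite !dist_nm. unfold nm. apply sqrt_le_1_alt. rewrite nrm2_S.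
  rewrite (nrm2_ext N _ (vsub y x)) by (intros; unfold vsub; rewrite !trunc_eq; auto). nra.
- rewrite dist_nm. unfold nm. rewrite <- sqrt_Rsqr_abs. apply sqrt_le_1_alt. rewrite nrm2_S.
  pose proof (nrm2_ge0 N (vsub y x)). unfold Rsqr. unfold vsub at 2 3. lra.
Qed.

Lemma cl_InRn N U x : cl N U x -> InRn N x.
Proof. intros [H _]; auto. Qed.
Lemma cl_incl N U x : (forall x, U x -> InRn N x) -> U x -> cl N U x.
Proof.
intros H Hx; split; auto. intros r Hr; exists x; split; auto.
rewrite dist_nm, (nm_ext N _ zero) by (intros; unfold vsub, zero; ring).
unfold nm; rewrite nrm2_0, sqrt_0; auto.
Qed.

Lemma dist_triangle n x y z : dist n x z <= dist n x y + dist n y z.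
Proof.
rewrite !dist_nm. replace (vsub z x) with (vadd (vsub y x) (vsub z y)); [apply nm_add|].
apply functional_extensionality; intros; unfold vadd, vsub; ring.
Qed.

Lemma cl_closed N U : seq_closed N (cl N U).
Proof.
intros x Hx H; split; auto. intros r Hr. destruct (H (r / 2)) as [y [[_ Hy] Hxy]]; [lra|].
destruct (Hy (r / 2)) as [z [Hz Hyz]]; [lra|]. exists z; split; auto.
pose proof (dist_triangle N x y z); lra.
Qed.

Lemma cl_bounded N U : bounded_set N U -> exists M, forall x, cl N U x -> nrm2 N x <= M.
Proof.
intros [M HM]. exists ((Rabs M + 2) * (Rabs M + 2)). intros x [_ Hx].
destruct (Hx 1) as [y [Hy Hxy]]; [lra|]. specialize (HM y Hy). rewrite dist_nm in Hxy.
pose proof (Rle_abs M). pose proof (Rabs_pos M). apply nrm2_le.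
assert (nm N y <= Rabs M + 1) by (apply nm_le; [lra|nra]).
replace x with (vsub y (vsub y x)) by (apply functional_extensionality; intros; unfold vsub; ring).
pose proof (nm_sub N y (vsub y x)); lra.
Qed.

Lemma cylinder_closed N S T : seq_closed N S -> seq_closed (Datatypes.S N) (cylinder N S T).
Proof.
intros HS z Hz H; split; [auto|split].
- apply HS; [apply InRn_trunc|]. intros r Hr. destruct (H r Hr) as [y [[_ [Hy _]] Hd]].
  exists (trunc N y); split; auto. destruct (dist_S N z y); lra.
- split; apply Rnot_lt_le; intros Hlt.
  + destruct (H (- z N)) as [y [[_ [_ Hy]] Hd]]; [lra|]. destruct (dist_S N z y) as [_ H1].
    apply Rabs_le_bounds in H1; lra.
  + destruct (H (z N - T)) as [y [[_ [_ Hy]] Hd]]; [lra|]. destruct (dist_S N z y) as [_ H1].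
    apply Rabs_le_bounds in H1; lra.
Qed.

Lemma cylinder_bounded N S T : (exists M, forall x, S x -> nrm2 N x <= M) ->
  exists M, forall z, cylinder N S T z -> nrm2 (Datatypes.S N) z <= M.
Proof.
intros [M HM]; exists (M + T * T); intros z [_ [Hz Ht]]. rewrite nrm2_S.
specialize (HM _ Hz). rewrite (nrm2_ext N (trunc N z) z) in HM by (intros; now apply trunc_eq). nra.
Qed.

Lemma cylinder_cont N S T w : continuous_on_cyl N S w ->
  continuous_on (Datatypes.S N) (cylinder N S T) (fun z => w (trunc N z) (z N)).
Proof.
intros Hw z [_ [Hz1 Hz2]] eps He. destruct (Hw (trunc N z) (z N) Hz1 (proj1 Hz2) eps He) as [d [Hd Hd']].
exists d; split; auto. intros y [_ [Hy1 Hy2]] Hxy. destruct (dist_S N z y).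
apply Hd'; auto; lra.
Qed.

(** All second order terms involving time are [O(d * Rabs tau)] and are absorbed by the
    [eps * Rabs tau] allowed in a parabolic jet, so only the spatial block of [A] survives. The
    derivative of the penalty is added to the time slope. *)
Lemma touch_par_superjet N Om w lam T1 T2 z p A r :
  (forall x, Om x -> InRn N x) -> 0 <= lam -> T2 < T1 ->
  InRn (S N) z -> 0 < z N < T2 -> 0 < r -> symmetric (S N) A ->
  (forall k, nrm2 (S N) k <= r * r -> cylinder N (cl N Om) T2 (vadd z k) ->
    w (trunc N (vadd z k)) (vadd z k N) - lam * / (T1 - vadd z k N) <=
    w (trunc N z) (z N) - lam * / (T1 - z N) + dot (S N) p k + / 2 * quad (S N) A k) ->
  par_superjet N Om w (trunc N z) (z N) (p N + lam * (/ (T1 - z N) * / (T1 - z N))) (trunc N p) A.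
Proof.
intros HOm Hlam HT Hz Hs Hr HA Ht.
split; [apply InRn_trunc|split; [intros i k Hi Hk; apply HA; lia|]].
intros eps He. set (s := z N) in *. set (x := trunc N z) in *.
set (g0 := T1 - T2). assert (Hg0 : 0 < g0) by (unfold g0; lra).
set (be := fun i => A i N).
set (L := lam * (/ g0 * / g0 * / g0)).
assert (Hg0i : 0 < / g0) by (apply Rinv_0_lt_compat; auto).
assert (HL : 0 <= L) by (unfold L; apply Rmult_le_pos; [lra|repeat apply Rmult_le_pos; lra]).
set (Q := nm N be + Rabs (A N N) + L + 1).
pose proof (nm_ge0 N be) as Hbe. pose proof (Rabs_pos (A N N)) as HAN.
assert (HQ : 0 < Q) by (unfold Q; lra).
set (d := Rmin (Rmin (r / 2) (T2 - s)) (eps / Q)).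
assert (Hd : 0 < d) by (apply Rmin_pos; [apply Rmin_pos; lra|apply Rdiv_lt_0_compat; auto]).
assert (Hd1 : d <= r / 2) by (apply Rle_trans with (1 := Rmin_l _ _); apply Rmin_l).
assert (Hd2 : d <= T2 - s) by (apply Rle_trans with (1 := Rmin_l _ _); apply Rmin_r).
assert (Hd3 : d * Q <= eps).
{ apply Rle_trans with (eps / Q * Q); [|right; field; lra]. apply Rmult_le_compat_r; [lra|apply Rmin_r]. }
clearbody d. exists d; split; auto.
intros y s' Hy Hs' Hxy Hts. rewrite dist_nm in Hxy.
set (ka := vsub y x) in *. set (tau := s' - s) in *.
assert (Hzk : vadd z (glue N ka tau) = glue N y s').
{ rewrite <- (glue_trunc N z Hz). fold x s. apply functional_extensionality; intros i.
  unfold vadd, glue, ka, vsub, tau. destruct (Nat.eqb i N); ring. }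
specialize (Ht (glue N ka tau)). rewrite Hzk, trunc_glue, glue_N in Ht by auto.
pose proof (nrm2_le N ka d ltac:(lra)) as Hk2.
assert (Hkn : nrm2 N (glue N ka tau) = nrm2 N ka) by (apply nrm2_ext; intros; apply glue_lt; auto).
assert (Hqn : quad N A (glue N ka tau) = quad N A ka).
{ rewrite !quad_mv. unfold dot, mv. apply sumN_ext; intros i Hi. rewrite glue_lt by auto. f_equal.
  apply sumN_ext; intros k Hk. now rewrite glue_lt. }
assert (Hdn : forall v, dot N v (glue N ka tau) = dot N v ka).
{ intros v; apply dot_ext; auto. intros; now apply glue_lt. }
rewrite nrm2_S, dot_S, (quad_S N A _ HA), !Hdn, Hqn, Hkn, !glue_N in Ht.
apply Rabs_def2 in Hts.
assert (Htau2 : tau * tau <= d * d) by nra.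
specialize (Ht ltac:(nra)).
assert (Hcyl : cylinder N (cl N Om) T2 (glue N y s')).
{ split; [apply InRn_glue; auto|split].
  - rewrite trunc_glue by auto. apply cl_incl; auto.
  - rewrite glue_N. unfold tau in Hts. lra. }
specialize (Ht Hcyl). fold be in Ht.
(* The penalty differs from its tangent by at most [L * tau ^ 2], as both denominators are at least
   [g0]. *)
assert (Hpen : lam * / (T1 - s') - lam * / (T1 - s) <= lam * (/ (T1 - s) * / (T1 - s)) * tau + L * (tau * tau)).
{ assert (Hs1 : g0 <= T1 - s) by (unfold g0; lra).
  assert (Hs2 : g0 <= T1 - s') by (unfold g0, tau in *; lra).
  replace (lam * / (T1 - s') - lam * / (T1 - s)) with
    (lam * (/ (T1 - s) * / (T1 - s)) * tau + lam * (/ (T1 - s) * / (T1 - s) * / (T1 - s')) * (tau * tau)).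
  2:{ unfold tau; field; lra. }
  apply Rplus_le_compat_l. apply Rmult_le_compat_r; [nra|]. unfold L. apply Rmult_le_compat_l; auto.
  pose proof (Rinv_le_contravar _ _ Hg0 Hs1) as I1. pose proof (Rinv_le_contravar _ _ Hg0 Hs2) as I2.
  assert (0 < / (T1 - s)) by (apply Rinv_0_lt_compat; lra).
  assert (0 < / (T1 - s')) by (apply Rinv_0_lt_compat; lra).
  apply Rmult_le_compat; auto; try lra; [|apply Rmult_le_compat; lra]. apply Rmult_le_pos; lra. }
assert (Habs : Rabs tau <= d) by (apply Rabs_le; lra).
pose proof (Rabs_pos tau) as Hat0.
assert (Htt : tau * tau <= d * Rabs tau).
{ rewrite <- (Rabs_right (tau * tau)) by nra. rewrite Rabs_mult. apply Rmult_le_compat_r; auto. }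
assert (Hcross : tau * dot N be ka <= nm N be * (d * Rabs tau)).
{ apply Rle_trans with (1 := Rle_abs _). rewrite Rabs_mult.
  pose proof (dot_abs N be ka). pose proof (nm_ge0 N ka).
  apply Rle_trans with (Rabs tau * (nm N be * d)); [|lra]. apply Rmult_le_compat_l; auto.
  apply Rle_trans with (1 := H). apply Rmult_le_compat_l; lra. }
assert (HAtt : A N N * (tau * tau) <= Rabs (A N N) * (d * Rabs tau)).
{ pose proof (Rle_abs (A N N)). apply Rle_trans with (Rabs (A N N) * (tau * tau)).
  - apply Rmult_le_compat_r; auto; nra.
  - apply Rmult_le_compat_l; auto. }
assert (HLtt : L * (tau * tau) <= L * (d * Rabs tau)) by (apply Rmult_le_compat_l; auto).
assert (Htot : (nm N be + Rabs (A N N) + L) * (d * Rabs tau) <= eps * Rabs tau).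
{ apply Rle_trans with (d * Q * Rabs tau); [|apply Rmult_le_compat_r; auto].
  assert (0 <= d * Rabs tau) by (apply Rmult_le_pos; lra). unfold Q. lra. }
assert (HAnn : 0 <= Rabs (A N N) * (d * Rabs tau)).
{ apply Rmult_le_pos; auto. apply Rmult_le_pos; lra. }
assert (0 <= eps * nrm2 N ka) by (apply Rmult_le_pos; [lra|apply nrm2_ge0]).
assert (Hpt : dot N (trunc N p) ka = dot N p ka).
{ apply dot_ext; auto. intros; now apply trunc_eq. }
rewrite Hpt. lra.
Qed.

(** The operator is a parameter so that a supersolution [u] can be treated as the subsolution [- u]
    of the dual operator, which sends [X] to [- F (- X)]. *)
Definition par_subsol (N : nat) (Om : pt -> Prop) (F : mat -> R) (w : pt -> R -> R) : Prop :=
  forall x t a p X, Om x -> 0 < t -> par_superjet N Om w x t a p X -> a <= F X.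

(* Almost maximal pairs of the doubled problem stay away from the parabolic boundary. *)
Lemma separation n D M g1 g2 (I : pt -> Prop) m : 0 < m ->
  (forall x, D x -> nrm2 n x <= M) -> seq_closed n D -> (exists x, D x) ->
  continuous_on n D g1 -> continuous_on n D g2 ->
  (forall z, D z -> ~ I z -> g1 z + g2 z <= 0) ->
  exists ka, 0 < ka /\ forall z z', D z -> D z' ->
    m <= g1 z + g2 z' - ka * nrm2 n (vsub z z') -> I z /\ I z'.
Proof.
intros Hm HM HD Hne H1 H2 HI. apply NNPP; intros Hn.
assert (H : forall k : nat, exists zz : pt * pt, D (fst zz) /\ D (snd zz) /\
  m <= g1 (fst zz) + g2 (snd zz) - (INR k + 1) * nrm2 n (vsub (fst zz) (snd zz)) /\ ~ (I (fst zz) /\ I (snd zz))).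
{ intros k; apply NNPP; intros Hk; apply Hn. exists (INR k + 1); split; [pose proof (pos_INR k); lra|].
  intros z z' Hz Hz' Hle; apply NNPP; intros Hni; apply Hk; exists (z, z'); auto. }
destruct (functional_choice _ _ _ H) as [Z HZ]. clear H Hn.
destruct (evt n D M g1 Hne HM HD H1) as [y1 [_ Hy1]].
destruct (evt n D M g2 Hne HM HD H2) as [y2 [_ Hy2]].
set (B := g1 y1 + g2 y2).
destruct (cluster n D M (fun k => fst (Z k)) HM HD) as [z [Hz Hcl]]; [apply HZ|].
destruct (H1 z Hz (m / 4)) as [d1 [Hd1 Hd1']]; [lra|].
destruct (H2 z Hz (m / 4)) as [d2 [Hd2 Hd2']]; [lra|].
set (d := Rmin d1 d2 / 2). assert (Hd : 0 < d) by (unfold d; apply Rdiv_lt_0_compat; [apply Rmin_pos; lra|lra]).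
assert (Hdd : 2 * d <= d1 /\ 2 * d <= d2).
{ unfold d. pose proof (Rmin_l d1 d2); pose proof (Rmin_r d1 d2); lra. }
clearbody d.
(* A large penalty brings both points within [2 * d] of the cluster point, where [g1 + g2] is
   positive at each of them, hence each is in [I]. *)
destruct (INR_unbounded (B / (d * d))) as [K HK].
destruct (Hcl d Hd K) as [k [Hk Hzk]].
destruct (HZ k) as [Ha [Hb [Hc Hni]]]. set (a := fst (Z k)) in *. set (b := snd (Z k)) in *.
assert (Hab : nm n (vsub b a) < d).
{ rewrite nm_sub_sym. apply nm_lt; [lra|]. apply Rnot_le_lt; intros Hle.
  apply le_INR in Hk. pose proof (Hy1 a Ha); pose proof (Hy2 b Hb). fold B in H.
  assert (B < (INR k + 1) * (d * d)).
  { apply Rle_lt_trans with (B / (d * d) * (d * d)); [right; field; lra|]. apply Rmult_lt_compat_r; nra. }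
  assert ((INR k + 1) * (d * d) <= (INR k + 1) * nrm2 n (vsub a b)).
  { apply Rmult_le_compat_l; auto. pose proof (pos_INR k); lra. }
  unfold B in *; lra. }
assert (Hzb : dist n z b < 2 * d).
{ pose proof (dist_triangle n z a b). rewrite (dist_nm n a b) in H. lra. }
pose proof (Hd1' a Ha ltac:(lra)) as Ea. pose proof (Hd2' b Hb ltac:(lra)) as Eb.
pose proof (Hd1' b Hb ltac:(lra)) as Eb'. pose proof (Hd2' a Ha ltac:(lra)) as Ea'.
apply Rabs_def2 in Ea. apply Rabs_def2 in Eb. apply Rabs_def2 in Ea'. apply Rabs_def2 in Eb'.
assert (0 <= (INR k + 1) * nrm2 n (vsub a b)).
{ apply Rmult_le_pos; [pose proof (pos_INR k); lra|apply nrm2_ge0]. }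
apply Hni; split; apply NNPP; intros Hnot.
- pose proof (HI a Ha Hnot); lra.
- pose proof (HI b Hb Hnot); lra.
Qed.

(** * The comparison principle *)

Section comparison.
Variables (N : nat) (Om : pt -> Prop) (F : mat -> R).
Hypothesis HF : forall X Y c, (forall v, quad N X v <= quad N Y v + c * nrm2 N v) -> F X <= F Y + c.
Hypotheses (Hopen : open_in N Om) (Hbd : bounded_set N Om).

(** [w2] is minus a supersolution, so both functions are regularised in the same way, in space and
    time at once. The gap [eta] due to the penalty exceeds the errors of [semiconvex_sums]. *)
Lemma comparison (w1 w2 : pt -> R -> R) :
  continuous_on_cyl N (cl N Om) w1 -> continuous_on_cyl N (cl N Om) w2 ->
  par_subsol N Om F w1 -> par_subsol N Om (fun X => - F (msc (-1) X)) w2 ->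
  (forall x t, boundary N Om x -> 0 < t -> w1 x t + w2 x t <= 0) ->
  (forall x, cl N Om x -> w1 x 0 + w2 x 0 <= 0) ->
  forall x t, Om x -> 0 < t -> w1 x t + w2 x t <= 0.
Proof.
intros Hc1 Hc2 Hs1 Hs2 Hlat Hini x0 T0 Hx0 HT0. apply Rnot_lt_le; intros Hm0.
set (m := w1 x0 T0 + w2 x0 T0) in *.
destruct Hopen as [HOm _].
pose proof (cl_bounded N Om Hbd) as Hclb.
set (n := S N).
(* The penalty [lam / (T1 - t)] makes [w1] a strict subsolution and the sum negative at time [T2]. *)
set (T1 := T0 + 1). set (lam := m / 2).
set (z0 := glue N x0 T0).
assert (Hz0 : InRn n z0) by (apply InRn_glue; auto).
assert (Hz0t : trunc N z0 = x0) by (apply trunc_glue; auto).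
assert (Hz0N : z0 N = T0) by apply glue_N.
assert (Hx0c : cl N Om x0) by (apply cl_incl; auto).
assert (HS : exists S0, m <= S0 /\ forall x t, cl N Om x -> 0 <= t <= T1 -> w1 x t + w2 x t <= S0).
{ destruct (cylinder_bounded N (cl N Om) T1 Hclb) as [M HM].
  destruct (evt n (cylinder N (cl N Om) T1) M (fun z => w1 (trunc N z) (z N) + w2 (trunc N z) (z N)))
    as [zm [_ Hzm]]; auto.
  - exists z0; split; [auto|split]; rewrite ?Hz0t, ?Hz0N; auto; unfold T1; lra.
  - apply cylinder_closed, cl_closed.
  - apply cont_plus; apply cylinder_cont; auto.
  - exists (w1 (trunc N zm) (zm N) + w2 (trunc N zm) (zm N)).
    assert (Hall : forall x t, cl N Om x -> 0 <= t <= T1 -> w1 x t + w2 x t <= w1 (trunc N zm) (zm N) + w2 (trunc N zm) (zm N)).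
    { intros x t Hx Ht. pose proof (cl_InRn _ _ _ Hx). specialize (Hzm (glue N x t)).
      rewrite trunc_glue, glue_N in Hzm by auto. apply Hzm.
      split; [apply InRn_glue; auto|rewrite trunc_glue, glue_N; auto]. }
    split; auto. apply Hall; auto; unfold T1; lra. }
destruct HS as [S0 [HmS HS]].
(* At this distance from [T1] the penalty equals [S0 + 1], more than any value of [w1 + w2], so
   nothing positive remains at time [T2]. *)
set (g0 := lam / (S0 + 1)).
assert (Hg0 : 0 < g0) by (unfold g0, lam; apply Rdiv_lt_0_compat; lra).
assert (Hg0S : g0 * (S0 + 1) = lam) by (unfold g0; field; lra).
assert (Hg01 : g0 < 1) by (unfold lam in *; nra).
clearbody g0. set (T2 := T1 - g0).
assert (HT2 : T0 < T2 < T1) by (unfold T2, T1; lra).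
set (D := cylinder N (cl N Om) T2).
destruct (cylinder_bounded N (cl N Om) T2 Hclb) as [M HM]. fold D n in HM.
assert (HD : seq_closed n D) by apply cylinder_closed, cl_closed.
assert (Hz0D : D z0) by (split; [auto|split; rewrite ?Hz0t, ?Hz0N; auto; lra]).
set (g1 := fun z : pt => w1 (trunc N z) (z N) - lam * / (T1 - z N)).
set (g2 := fun z : pt => w2 (trunc N z) (z N)).
assert (Hg1 : continuous_on n D g1).
{ apply cont_minus; [apply cylinder_cont; auto|]. apply cont_scal.
  apply (cont_inv n D (fun z => T1 - z N) g0); auto.
  - intros z [_ [_ Hz]]; unfold T2 in Hz; lra.
  - apply cont_minus; [apply cont_const|apply cont_coord; unfold n; lia]. }
assert (Hg2 : continuous_on n D g2) by (apply cylinder_cont; auto).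
set (I := fun z : pt => Om (trunc N z) /\ 0 < z N < T2).
assert (Hlam : 0 < lam) by (unfold lam; lra).
assert (HI : forall z, D z -> ~ I z -> g1 z + g2 z <= 0).
{ intros z [Hz1 [Hz2 Hz3]] Hni. unfold g1, g2.
  assert (Hpos : 0 < lam * / (T1 - z N)).
  { apply Rmult_lt_0_compat; auto. apply Rinv_0_lt_compat; lra. }
  destruct (Req_dec (z N) 0) as [E|E].
  { specialize (Hini _ Hz2). rewrite E in *. lra. }
  destruct (classic (Om (trunc N z))) as [Ho|Ho].
  - assert (z N = T2) as ET.
    { apply NNPP; intros Hne; apply Hni; split; auto; lra. }
    specialize (HS (trunc N z) (z N) Hz2 ltac:(lra)). rewrite ET in *.
    replace (lam * / (T1 - T2)) with (S0 + 1); [lra|]. unfold T2. rewrite <- Hg0S. field; lra.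
  - pose proof (Hlat (trunc N z) (z N) (conj Hz2 Ho) ltac:(lra)). lra. }
destruct (separation n D M g1 g2 I (m / 4) ltac:(lra) HM HD (ex_intro _ z0 Hz0D) Hg1 Hg2 HI)
  as [ka0 [Hka0 Hsep]].
(* The factor 2 pays for estimating the squared distance of [ZU x] and [ZV x] through [x]. *)
set (ka := 2 * ka0). assert (Hka : 0 < ka) by (unfold ka; lra).
destruct (sup_convolution n D M g1 ka Hka (ex_intro _ z0 Hz0D) HM HD Hg1)
  as [U [ZU [HU1 [HU2 [HU3 [HU4 [HU5 [CU HU6]]]]]]]].
destruct (sup_convolution n D M g2 ka Hka (ex_intro _ z0 Hz0D) HM HD Hg2)
  as [V [ZV [HV1 [HV2 [HV3 [HV4 [HV5 [CV HV6]]]]]]]].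
set (eta := lam * (/ T1 * / T1)).
assert (HT1 : 0 < / T1) by (apply Rinv_0_lt_compat; unfold T1; lra).
assert (Heta : 0 < eta) by (apply Rmult_lt_0_compat; [|apply Rmult_lt_0_compat]; auto).
set (e0 := Rmin (eta / 4) (m / 4)).
assert (He0 : 0 < e0) by (apply Rmin_pos; lra).
assert (He01 : e0 <= eta / 4) by apply Rmin_l. assert (He02 : e0 <= m / 4) by apply Rmin_r. clearbody e0.
destruct (semiconvex_sums n U V (2 * ka) (CU + CV) ka e0) as
  [x1 [x2 [p1 [p2 [A1 [A2 [r1 [r2 [Hr1 [Hr2 [HA1 [HA2 [Ht1 [Ht2 [Hp [HA [Hx1 Hx2]]]]]]]]]]]]]]]]]; auto; try lra.
{ intros x; specialize (HU6 x); specialize (HV6 x); lra. }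
(* Since [T1 - T0 = 1], the penalty at [z0] costs exactly [lam = m / 2]. *)
assert (Hz0v : m / 2 <= U z0 + V z0).
{ pose proof (HU3 z0 z0 Hz0D) as Q1. pose proof (HV3 z0 z0 Hz0D) as Q2.
  rewrite (nrm2_ext n _ zero), nrm2_0 in Q1 by (intros; unfold vsub, zero; ring).
  rewrite (nrm2_ext n _ zero), nrm2_0 in Q2 by (intros; unfold vsub, zero; ring).
  unfold g1 in Q1. unfold g2 in Q2. rewrite Hz0t, Hz0N in *. unfold T1 in Q1 at 1.
  replace (T0 + 1 - T0) with 1 in Q1 by ring. rewrite Rinv_1 in Q1. unfold lam, m in *; lra. }
assert (Hint : forall x, m / 4 <= U x + V x -> I (ZU x) /\ I (ZV x)).
{ intros x Hx. apply Hsep; auto. rewrite HU2, HV2 in Hx.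
  assert (Hq : nrm2 n (vsub (ZU x) (ZV x)) <= 2 * nrm2 n (vsub x (ZU x)) + 2 * nrm2 n (vsub x (ZV x))).
  { replace (vsub (ZU x) (ZV x)) with (vsub (vsub x (ZV x)) (vsub x (ZU x))).
    2:{ apply functional_extensionality; intros; unfold vsub; ring. }
    pose proof (nrm2_ge0 n (vadd (vsub x (ZV x)) (vsub x (ZU x)))) as Hq.
    rewrite nrm2_add in Hq. rewrite nrm2_sub. lra. }
  apply (Rmult_le_compat_l ka0) in Hq; [|lra]. unfold ka in Hx. lra. }
destruct (Hint x1) as [[HI1 HI1'] _]; [specialize (Hx1 z0); lra|].
destruct (Hint x2) as [_ [HI2 HI2']]; [specialize (Hx2 z0); lra|].
(* Moving a point and its maximiser by the same [k] leaves the convolution penalty unchanged, so a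
   paraboloid touching [U] at [x1] gives one touching [g1] at [ZU x1] with the same slope and
   Hessian. *)
assert (Htr : forall x z k, vsub (vadd x k) (vadd z k) = vsub x z).
{ intros; apply functional_extensionality; intros; unfold vsub, vadd; ring. }
assert (J1 : p1 N + lam * (/ (T1 - ZU x1 N) * / (T1 - ZU x1 N)) <= F A1).
{ apply (Hs1 (trunc N (ZU x1)) (ZU x1 N) _ (trunc N p1) A1); auto; [lra|].
  apply (touch_par_superjet N Om w1 lam T1 T2 (ZU x1) p1 A1 r1); auto; try lra.
  - apply (HU1 x1).
  - intros k Hk HDk. specialize (Ht1 k Hk). pose proof (HU3 (vadd x1 k) _ HDk) as Q1.
    rewrite Htr in Q1. rewrite (HU2 x1) in Ht1. unfold g1 in *. fold n. lra. }
assert (J2 : p2 N + 0 * (/ (T1 - ZV x2 N) * / (T1 - ZV x2 N)) <= - F (msc (-1) A2)).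
{ apply (Hs2 (trunc N (ZV x2)) (ZV x2 N) _ (trunc N p2) A2); auto; [lra|].
  apply (touch_par_superjet N Om w2 0 T1 T2 (ZV x2) p2 A2 r2); auto; try lra.
  - apply (HV1 x2).
  - intros k Hk HDk. specialize (Ht2 k Hk). pose proof (HV3 (vadd x2 k) _ HDk) as Q1.
    rewrite Htr in Q1. rewrite (HV2 x2) in Ht2. unfold g2 in *. fold n. lra. }
assert (J3 : F A1 <= F (msc (-1) A2) + e0).
{ apply HF. intros v. rewrite quad_msc. specialize (HA (glue N v 0)).
  unfold n in HA. rewrite !quad_S, nrm2_S, !glue_N in HA by auto.
  assert (Hq : forall A, quad N A (glue N v 0) = quad N A v).
  { intros A. rewrite !quad_mv. unfold dot, mv. apply sumN_ext; intros i Hi. rewrite glue_lt by auto. f_equal.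
    apply sumN_ext; intros k Hk. now rewrite glue_lt. }
  rewrite !Hq, (nrm2_ext N (glue N v 0) v) in HA by (intros; now apply glue_lt). lra. }
assert (J4 : - e0 <= p1 N + p2 N).
{ specialize (Hp (vsc (-1) (basis N))). rewrite dot_scr, dot_basis in Hp by (unfold n; lia).
  unfold vadd in Hp. assert (nm n (vsc (-1) (basis N)) <= 1); [|specialize (Hp H); lra].
  apply nm_le; [lra|]. rewrite nrm2_sc, nrm2_basis by (unfold n; lia). lra. }
assert (J5 : eta <= lam * (/ (T1 - ZU x1 N) * / (T1 - ZU x1 N))).
{ unfold eta. apply Rmult_le_compat_l; [lra|].
  assert (/ T1 <= / (T1 - ZU x1 N)) by (apply Rinv_le_contravar; lra).
  apply Rmult_le_compat; lra. }
lra.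
Qed.
End comparison.

(** * Concavity of the eigenfunction *)

Lemma concave_supergradient N f x0 R : 0 < R -> InRn N x0 -> continuous_on N (ball N x0 R) f ->
  (forall a b th, ball N x0 R a -> ball N x0 R b -> 0 <= th <= 1 ->
    (1 - th) * f a + th * f b <= f (vadd a (vsc th (vsub b a)))) ->
  exists p, InRn N p /\ forall x, ball N x0 R x -> f x <= f x0 + dot N p (vsub x x0).
Proof.
intros HR Hx0 Hf Hconc. destruct (ball_bounded N x0 R) as [M HM].
pose proof (ball_closed N x0 R ltac:(lra)) as Hcl.
assert (Hx0b : ball N x0 R x0).
{ split; auto. rewrite (nrm2_ext N _ zero), nrm2_0 by (intros; unfold vsub, zero; ring). nra. }
assert (Hne : exists x, ball N x0 R x) by eauto.
destruct (evt N (ball N x0 R) M f Hne HM Hcl Hf) as [ym [_ Hym]].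
destruct (evt N (ball N x0 R) M (fun x => - f x) Hne HM Hcl ltac:(apply cont_opp; auto)) as [yl [_ Hyl]].
set (osc := f ym - f yl).
assert (Hosc : forall x y, ball N x0 R x -> ball N x0 R y -> f x - f y <= osc).
{ intros x y Hx Hy. pose proof (Hym x Hx); pose proof (Hyl y Hy). unfold osc; lra. }
assert (Hosc0 : 0 <= osc) by (pose proof (Hosc x0 x0 Hx0b Hx0b); lra). clearbody osc.
assert (H : forall k : nat, exists x, ball N x0 R x /\ forall y, ball N x0 R y ->
  f y - (INR k + 1) * nrm2 N (vsub y x0) <= f x - (INR k + 1) * nrm2 N (vsub x x0)).
{ intros k. apply (evt N (ball N x0 R) M); auto. apply cont_minus; auto. apply cont_scal, cont_nrm2_sub. }
destruct (functional_choice _ _ _ H) as [X HX]. clear H.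
(* By concavity the paraboloid touching [f] from above at [X k] can be replaced by its tangent plane;
   the slopes [P k] are bounded and any limit is a supergradient at [x0]. *)
set (P := fun k : nat => vsc (2 * (INR k + 1)) (vsub (X k) x0)).
assert (Hsub : forall k x, ball N x0 R x -> f x <= f (X k) + dot N (P k) (vsub x (X k))).
{ intros k x Hx. destruct (HX k) as [HXb HXm]. pose proof (pos_INR k) as Hk.
  apply Rnot_lt_le; intros Hlt. set (gap := f x - f (X k) - dot N (P k) (vsub x (X k))).
  set (q := (INR k + 1) * nrm2 N (vsub x (X k))).
  assert (Hq : 0 <= q) by (apply Rmult_le_pos; [lra|apply nrm2_ge0]).
  assert (Hgap : 0 < gap) by (unfold gap; lra).
  (* Moving the fraction [th] towards [x] would gain [th * gap] and cost only [th * th * q],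
     contradicting maximality of [X k]. *)
  set (th := Rmin 1 (gap / (2 * (q + 1)))).
  assert (Hth : 0 < th) by (apply Rmin_pos; [lra|apply Rdiv_lt_0_compat; lra]).
  assert (Hth1 : th <= 1) by apply Rmin_l.
  assert (Hth2 : th * (q + 1) <= gap / 2).
  { apply Rle_trans with (gap / (2 * (q + 1)) * (q + 1)); [|right; field; lra].
    apply Rmult_le_compat_r; [lra|apply Rmin_r]. }
  clearbody th.
  pose proof (Hconc (X k) x th HXb Hx ltac:(lra)) as H1.
  set (y := vadd (X k) (vsc th (vsub x (X k)))) in *.
  assert (Hyx : vsub y x0 = vadd (vsub (X k) x0) (vsc th (vsub x (X k)))).
  { apply functional_extensionality; intros; unfold y, vadd, vsub, vsc; ring. }
  assert (Hyb : ball N x0 R y).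
  { split.
    - intros i Hi. unfold y, vadd, vsc, vsub. rewrite (proj1 HXb i Hi), (proj1 Hx i Hi); ring.
    - apply nrm2_le. rewrite Hyx.
      replace (vadd (vsub (X k) x0) (vsc th (vsub x (X k)))) with
        (vadd (vsc (1 - th) (vsub (X k) x0)) (vsc th (vsub x x0))).
      2:{ apply functional_extensionality; intros; unfold vadd, vsub, vsc; ring. }
      apply Rle_trans with (1 := nm_add _ _ _). rewrite !nm_sc, !Rabs_right by lra.
      pose proof (nm_le N _ R (Rlt_le _ _ HR) (proj2 HXb)) as B1.
      pose proof (nm_le N _ R (Rlt_le _ _ HR) (proj2 Hx)) as B2.
      apply (Rmult_le_compat_l (1 - th)) in B1; [|lra].
      apply (Rmult_le_compat_l th) in B2; [|lra]. lra. }
  pose proof (HXm y Hyb) as H2. rewrite Hyx, nrm2_add, dot_scr, nrm2_sc in H2.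
  assert (H3 : th * (th * q) <= th * (gap / 2)) by (apply Rmult_le_compat_l; lra).
  assert (H4 : 0 < th * gap) by (apply Rmult_lt_0_compat; auto).
  assert (Egap : gap = f x - f (X k) - 2 * (INR k + 1) * dot N (vsub (X k) x0) (vsub x (X k))).
  { unfold gap, P; rewrite dot_scl; ring. }
  assert (H5 : th * gap = th * f x - th * f (X k) - 2 * (INR k + 1) * th * dot N (vsub (X k) x0) (vsub x (X k))).
  { rewrite Egap; ring. }
  unfold q in H3. lra. }
assert (HXc : forall k, (INR k + 1) * nrm2 N (vsub (X k) x0) <= osc).
{ intros k. destruct (HX k) as [HXb HXm]. specialize (HXm x0 Hx0b).
  rewrite (nrm2_ext N (vsub x0 x0) zero), nrm2_0 in HXm by (intros; unfold vsub, zero; ring).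
  pose proof (Hosc (X k) x0 HXb Hx0b). lra. }
assert (HXlim : forall d, 0 < d -> exists K, forall k, (K <= k)%nat -> nm N (vsub (X k) x0) < d).
{ intros d Hd. destruct (INR_unbounded (osc / (d * d))) as [K HK]. exists K; intros k Hk.
  apply nm_lt; [lra|]. apply le_INR in Hk. specialize (HXc k). pose proof (pos_INR k).
  apply Rnot_le_lt; intros Hle.
  assert (osc < (INR k + 1) * (d * d)).
  { apply Rle_lt_trans with (osc / (d * d) * (d * d)); [right; field; lra|]. apply Rmult_lt_compat_r; nra. }
  assert ((INR k + 1) * (d * d) <= (INR k + 1) * nrm2 N (vsub (X k) x0)) by (apply Rmult_le_compat_l; lra). lra. }
destruct (HXlim (R / 2)) as [K0 HK0]; [lra|].
assert (HPb : forall k, nrm2 N (P (k + K0)%nat) <= (2 * osc / R) * (2 * osc / R)).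
{ intros k. specialize (HK0 (k + K0)%nat ltac:(lia)). set (m := (k + K0)%nat) in *. destruct (HX m) as [HXb _].
  apply nrm2_le. pose proof (nm_ge0 N (P m)) as H0. destruct (Req_dec (nm N (P m)) 0) as [E|E].
  { rewrite E. apply Rmult_le_pos; [lra|left; apply Rinv_0_lt_compat; auto]. }
  (* A step of length [R / 2] against [P m] stays in the ball and lowers the tangent plane by
     [R / 2] times its slope, so the oscillation of [f] bounds the slope. *)
  set (v := vsc (- (R / 2 / nm N (P m))) (P m)).
  assert (Hc : 0 < R / 2 / nm N (P m)) by (apply Rdiv_lt_0_compat; lra).
  assert (Hv : nm N v = R / 2).
  { unfold v. rewrite nm_sc, Rabs_Ropp, Rabs_right by lra. field; lra. }
  assert (HPv : dot N (P m) v = - (R / 2 * nm N (P m))).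
  { unfold v. rewrite dot_scr. change (dot N (P m) (P m)) with (nrm2 N (P m)). rewrite <- nm_sq. field; lra. }
  assert (HPi : InRn N (P m)).
  { intros i Hi. unfold P, vsc, vsub. rewrite (proj1 HXb i Hi), (Hx0 i Hi); ring. }
  assert (Hb : ball N x0 R (vadd (X m) v)).
  { split.
    - intros i Hi. unfold vadd, v, vsc. rewrite (proj1 HXb i Hi), (HPi i Hi); ring.
    - apply nrm2_le. replace (vsub (vadd (X m) v) x0) with (vadd (vsub (X m) x0) v).
      + apply Rle_trans with (1 := nm_add _ _ _); lra.
      + apply functional_extensionality; intros; unfold vadd, vsub; ring. }
  pose proof (Hsub m _ Hb) as H1. rewrite vsub_add, HPv in H1. pose proof (Hosc _ _ HXb Hb) as H2.
  apply Rmult_le_reg_l with (R / 2); [lra|].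
  replace (R / 2 * (2 * osc / R)) with osc by (field; lra). lra. }
destruct (bw N (fun k => P (k + K0)%nat) _ HPb) as [p [sg [Hp [Hsg Hlim]]]].
exists p; split; auto. intros x Hx. apply Rnot_lt_le; intros Hlt.
set (gap := f x - (f x0 + dot N p (vsub x x0))). assert (Hgap : 0 < gap) by (unfold gap; lra).
destruct (Hf x0 Hx0b (gap / 4)) as [d [Hd Hd']]; [lra|].
pose proof (nm_ge0 N p) as Hp0.
set (d2 := Rmin (Rmin d 1) (gap / (4 * (nm N p + 1)))).
assert (Hd2 : 0 < d2) by (apply Rmin_pos; [apply Rmin_pos; lra|apply Rdiv_lt_0_compat; lra]).
assert (Hd2a : d2 <= d) by (apply Rle_trans with (1 := Rmin_l _ _); apply Rmin_l).
assert (Hd2c : (nm N p + 1) * d2 <= gap / 4).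
{ apply Rle_trans with ((nm N p + 1) * (gap / (4 * (nm N p + 1)))); [|right; field; lra].
  apply Rmult_le_compat_l; [lra|apply Rmin_r]. }
clearbody d2.
set (e1 := gap / (4 * (2 * R + 1))). assert (He1 : 0 < e1) by (apply Rdiv_lt_0_compat; lra).
assert (He1R : e1 * (2 * R + 1) = gap / 4) by (unfold e1; field; lra). clearbody e1.
destruct (HXlim d2 Hd2) as [K1 HK1].
destruct (Hlim (e1 * e1)) as [K2 HK2]; [nra|].
set (k := max K1 K2). specialize (HK2 k ltac:(lia)).
specialize (HK1 (sg k + K0)%nat). pose proof (Hsg k). specialize (HK1 ltac:(lia)).
set (m := (sg k + K0)%nat) in *. destruct (HX m) as [HXb _].
specialize (Hsub m x Hx).
specialize (Hd' (X m) HXb). rewrite dist_nm in Hd'. specialize (Hd' ltac:(lra)). apply Rabs_def2 in Hd'.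
apply nm_lt in HK2; [|lra].
pose proof (dot_le N (vsub (P m) p) (vsub x (X m))) as H1. rewrite dot_subl in H1.
pose proof (dot_ge N p (vsub (X m) x0)) as H2.
assert (Hxx : vsub x (X m) = vsub (vsub x x0) (vsub (X m) x0)).
{ apply functional_extensionality; intros; unfold vsub; ring. }
assert (Hpx : dot N p (vsub x (X m)) = dot N p (vsub x x0) - dot N p (vsub (X m) x0)).
{ rewrite Hxx at 1; apply dot_subr. }
assert (Hxn : nm N (vsub x (X m)) <= 2 * R).
{ rewrite Hxx. apply Rle_trans with (1 := nm_sub _ _ _).
  pose proof (nm_le N _ R ltac:(lra) (proj2 HXb)). pose proof (nm_le N _ R ltac:(lra) (proj2 Hx)). lra. }
pose proof (nm_ge0 N (vsub (P m) p)). pose proof (nm_ge0 N (vsub x (X m))). pose proof (nm_ge0 N (vsub (X m) x0)).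
assert (nm N (vsub (P m) p) * nm N (vsub x (X m)) <= e1 * (2 * R)) by (apply Rmult_le_compat; lra).
assert (nm N p * nm N (vsub (X m) x0) <= nm N p * d2) by (apply Rmult_le_compat_l; lra).
unfold gap in *. lra.
Qed.

Lemma closed_le n f v : continuous_on n (fun _ => True) f ->
  forall S : pt -> Prop, (forall x, S x -> f x <= v) ->
  forall x, (forall r, r > 0 -> exists y, S y /\ dist n x y < r) -> f x <= v.
Proof.
intros Hf S HS x H. apply Rnot_lt_le; intros Hlt.
destruct (Hf x I (f x - v)) as [d [Hd Hd']]; [lra|].
destruct (H d Hd) as [y [Hy Hxy]]. specialize (Hd' y I Hxy). specialize (HS y Hy).
apply Rabs_def2 in Hd'. lra.
Qed.

Lemma cont_shift n (S S' : pt -> Prop) f a : (forall k, S' k -> S (vadd a k)) ->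
  continuous_on n S f -> continuous_on n S' (fun k => f (vadd a k)).
Proof.
intros H Hf.
assert (E : forall k, vadd a (vsc 1 k) = vadd a k).
{ intros k; apply functional_extensionality; intros; unfold vadd, vsc; ring. }
apply cont_ext with (fun k => f (vadd a (vsc 1 k))).
- intros k _; now rewrite E.
- apply cont_affine with S; auto. intros k Hk; rewrite E; auto.
Qed.

Lemma InRn_vadd n x y : InRn n x -> InRn n y -> InRn n (vadd x y).
Proof. intros Hx Hy i Hi; unfold vadd; rewrite Hx, Hy by auto; ring. Qed.
Lemma InRn_vsub n x y : InRn n x -> InRn n y -> InRn n (vsub x y).
Proof. intros Hx Hy i Hi; unfold vsub; rewrite Hx, Hy by auto; ring. Qed.
Lemma InRn_vsc n c x : InRn n x -> InRn n (vsc c x).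
Proof. intros Hx i Hi; unfold vsc; rewrite Hx by auto; ring. Qed.

(** Read along a segment, [lambda_N < - c] puts [psi] above the parabola [q] of curvature [- c] with
    the same end values; [c] may have either sign. If [psi] fell below, [psi - phi] would have a
    negative interior minimum on a tube around the segment, where the Hessian of [phi] has the value
    [- c] along [e]. *)
Lemma segment_concave N Om psi c x0 R a b th : (1 <= N)%nat -> 0 < R ->
  (forall x, Om x -> InRn N x) -> InRn N x0 ->
  (forall x, InRn N x -> nm N (vsub x x0) <= 2 * R -> Om x) ->
  continuous_on N Om psi -> (forall x, Om x -> 0 < psi x) ->
  (forall x p X, InRn N x -> nm N (vsub x x0) <= 2 * R -> subjet N Om psi x p X -> lambda N N X < - c) ->
  ball N x0 R a -> ball N x0 R b -> 0 <= th <= 1 ->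
  (1 - th) * psi a + th * psi b + c / 2 * (th * (1 - th) * nrm2 N (vsub b a)) <=
    psi (vadd a (vsc th (vsub b a))).
Proof.
intros HN HR HOm Hx0 Hball Hpsi Hpos Hsup [Ha1 Ha2] [Hb1 Hb2] Hth.
apply Rnot_lt_le; intros Hlt.
set (e := vsub b a) in *. set (s := nm N e).
assert (He : InRn N e) by (apply InRn_vsub; auto).
pose proof (nm_sq N e) as Hs2. fold s in Hs2. pose proof (nm_ge0 N e) as Hs0. fold s in Hs0.
assert (Hae : vadd a e = b) by apply vadd_sub.
destruct (Req_dec s 0) as [Es|Es].
{ assert (E0 : e = zero).
  { apply functional_extensionality; intros i. destruct (Nat.lt_ge_cases i N) as [Hi|Hi].
    - apply (nrm2_eq0 N); auto. rewrite <- Hs2, Es; ring.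
    - apply He; auto. }
  rewrite <- Hae, E0, nrm2_0 in Hlt. rewrite vadd_zero_r in Hlt.
  replace (vadd a (vsc th zero)) with a in Hlt; [lra|].
  apply functional_extensionality; intros; unfold vadd, vsc, zero; ring. }
assert (Hs : 0 < s) by lra. clear Es Hs0.
assert (Han : nm N (vsub a x0) <= R) by (apply nm_le; lra).
assert (Hbn : nm N (vsub b x0) <= R) by (apply nm_le; lra).
rewrite <- Hs2 in Hlt. set (E := s * s) in *. assert (HE : 0 < E) by (apply Rmult_lt_0_compat; auto).
set (tau := fun k => dot N e k / E).
set (w := fun k => vsub k (vsc (tau k) e)).
set (q := fun t => psi a + t * (psi b - psi a) + c / 2 * (t * (1 - t) * E)).
assert (Hwn : forall k, nrm2 N (w k) = nrm2 N k - dot N e k * dot N e k / E).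
{ intros k. unfold w. rewrite nrm2_sub, dot_scr, nrm2_sc, (dot_sym N k e), <- Hs2. fold E. unfold tau. field; lra. }
assert (Hoa : Om a) by (apply Hball; auto; lra). assert (Hob : Om b) by (apply Hball; auto; lra).
pose proof (Hpos a Hoa) as Hpa. pose proof (Hpos b Hob) as Hpb.
set (gam := (q th - psi (vadd a (vsc th e))) / 2).
assert (Hgam : 0 < gam) by (unfold gam, q; lra).
destruct (Hpsi a Hoa gam) as [da [Hda Hda']]; [lra|].
destruct (Hpsi b Hob gam) as [db [Hdb Hdb']]; [lra|].
set (d := Rmin da db). assert (Hd : 0 < d) by (apply Rmin_pos; lra).
assert (Hdda : d <= da) by apply Rmin_l. assert (Hddb : d <= db) by apply Rmin_r. clearbody d.
set (Bq := psi a + psi b + Rabs c * E).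
pose proof (Rabs_pos c) as Hc0.
assert (HcE : 0 <= Rabs c * E) by (apply Rmult_le_pos; lra).
assert (HBq : 0 < Bq) by (unfold Bq; lra).
assert (HqB : forall t, 0 <= t <= 1 -> q t <= Bq).
{ intros t Ht. unfold q, Bq. assert (0 <= t * (1 - t) <= 1) by nra.
  assert (c / 2 * (t * (1 - t) * E) <= Rabs c * E).
  { pose proof (Rle_abs c). apply Rle_trans with (Rabs c * (t * (1 - t) * E)).
    - assert (0 <= t * (1 - t) * E) by (apply Rmult_le_pos; lra). nra.
    - apply Rmult_le_compat_l; auto. rewrite <- (Rmult_1_l E) at 2. apply Rmult_le_compat_r; lra. }
  nra. }
(* The first term makes [phi] too low on the lateral wall, the second at distance [d] from the
   axis. *)
set (m := Bq / (R * R) + Bq / (d * d)).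
assert (HRR : 0 < R * R) by nra. assert (Hdd : 0 < d * d) by nra.
assert (Hm1 : 0 < Bq / (R * R)) by (apply Rdiv_lt_0_compat; auto).
assert (Hm2 : 0 < Bq / (d * d)) by (apply Rdiv_lt_0_compat; auto).
assert (HmR : Bq <= m * (R * R)).
{ apply Rle_trans with (Bq / (R * R) * (R * R)); [right; field; lra|]. apply Rmult_le_compat_r; unfold m; lra. }
assert (Hmd : Bq <= m * (d * d)).
{ apply Rle_trans with (Bq / (d * d) * (d * d)); [right; field; lra|]. apply Rmult_le_compat_r; unfold m; lra. }
assert (Hm : 0 < m) by (unfold m; lra). clearbody m.
(* Touching from below with a paraboloid that is very concave across the segment makes its largest
   eigenvalue the one along the segment. *)
set (phi := fun k => q (tau k) - m * nrm2 N (w k)).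
set (Ks := fun k : pt => InRn N k /\ 0 <= tau k <= 1 /\ nrm2 N (w k) <= R * R).
assert (Hdec : forall k, k = vadd (vsc (tau k) e) (w k)).
{ intros k; apply functional_extensionality; intros; unfold w, vadd, vsub, vsc; ring. }
assert (HKn : forall k, Ks k -> nm N (vsub (vadd a k) x0) <= 2 * R).
{ intros k [_ [Ht Hw]].
  replace (vsub (vadd a k) x0) with
    (vadd (vadd (vsc (1 - tau k) (vsub a x0)) (vsc (tau k) (vsub b x0))) (w k)).
  2:{ apply functional_extensionality; intros; unfold w, e, vadd, vsub, vsc; ring. }
  apply nm_le in Hw; [|lra].
  pose proof (nm_add N (vadd (vsc (1 - tau k) (vsub a x0)) (vsc (tau k) (vsub b x0))) (w k)) as H1.
  pose proof (nm_add N (vsc (1 - tau k) (vsub a x0)) (vsc (tau k) (vsub b x0))) as H2.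
  rewrite !nm_sc, !Rabs_right in H2 by lra.
  pose proof (Rmult_le_compat_l (1 - tau k) _ _ ltac:(lra) Han).
  pose proof (Rmult_le_compat_l (tau k) _ _ ltac:(lra) Hbn). lra. }
assert (HKo : forall k, Ks k -> Om (vadd a k)).
{ intros k Hk; apply Hball; [|auto]. apply InRn_vadd; auto. apply Hk. }
assert (Hctau : forall S, continuous_on N S tau).
{ intros S. unfold tau, Rdiv. apply cont_ext with (fun k => / E * dot N e k); [intros; ring|].
  apply cont_scal, cont_dot. }
assert (Hcw : forall S, continuous_on N S (fun k => nrm2 N (w k))).
{ intros S. apply cont_ext with (fun k => nrm2 N (vsub k zero) - E * (tau k * tau k)).
  - intros k _. rewrite Hwn, vsub_zero. unfold tau. field; lra.
  - apply cont_minus; [apply cont_nrm2_sub|]. apply cont_scal, cont_mult; auto. }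
destruct (evt N Ks (R * R + E) (fun k => - (psi (vadd a k) - phi k))) as [k1 [Hk1 Hk1m]].
{ exists zero. split; [intros i _; reflexivity|]. rewrite Hwn. unfold tau.
  rewrite dot_0r, nrm2_0. unfold Rdiv. rewrite Rmult_0_l. lra. }
{ intros k [_ [Ht Hw]]. rewrite Hwn in Hw.
  assert (dot N e k * dot N e k / E = E * (tau k * tau k)) by (unfold tau; field; lra).
  assert (tau k * tau k <= 1) by nra. assert (E * (tau k * tau k) <= E * 1) by (apply Rmult_le_compat_l; lra). lra. }
{ intros k Hk H. split; auto. split; [split|].
  - assert (- tau k <= 0); [|lra].
    apply (closed_le N (fun k => - tau k) 0 (cont_opp _ _ _ (Hctau _)) Ks); auto.
    intros y [_ [Hy _]]; lra.
  - apply (closed_le N tau 1 (Hctau _) Ks); auto. intros y [_ [Hy _]]; lra.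
  - apply (closed_le N (fun k => nrm2 N (w k)) (R * R) (Hcw _) Ks); auto. intros y [_ [_ Hy]]; lra. }
{ apply cont_opp, cont_minus; [apply cont_shift with Om; auto|]. unfold phi, q. apply cont_minus.
  - apply cont_plus; [apply cont_plus; [apply cont_const|]|].
    + apply cont_mult; auto using cont_const.
    + apply cont_scal. apply cont_mult; [|apply cont_const]. apply cont_mult; auto.
      apply cont_minus; auto using cont_const.
  - apply cont_scal; auto. }
assert (Hval : psi (vadd a k1) - phi k1 <= - (2 * gam)).
{ assert (Htau : tau (vsc th e) = th).
  { unfold tau. rewrite dot_scr. change (dot N e e) with (nrm2 N e). rewrite <- Hs2. fold E. field; lra. }
  assert (Hw : nrm2 N (w (vsc th e)) = 0).
  { unfold w. rewrite Htau, (nrm2_ext N _ zero), nrm2_0; auto. intros; unfold vsub, zero; ring. }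
  assert (HK : Ks (vsc th e)).
  { split; [apply InRn_vsc; auto|]. rewrite Htau, Hw. lra. }
  assert (Hph : phi (vsc th e) = q th) by (unfold phi; rewrite Htau, Hw; ring).
  specialize (Hk1m _ HK). cbv beta in Hk1m. rewrite Hph in Hk1m. unfold gam. lra. }
destruct Hk1 as [Hk1i [Ht1 Hw1]]. set (t := tau k1) in *.
pose proof (Hpos _ (HKo k1 (conj Hk1i (conj Ht1 Hw1)))) as Hpk.
pose proof (nrm2_ge0 N (w k1)) as Hw0.
(* No minimum on an end section: within [d] of the axis [psi] is close to its end value, and farther
   out [m * (d * d)] wins. *)
assert (Hend : forall v, Om v -> 0 < psi v -> psi v <= Bq -> (forall y, Om y -> dist N v y < d -> Rabs (psi y - psi v) < gam) ->
  vadd v (w k1) = vadd a k1 -> phi k1 = psi v - m * nrm2 N (w k1) -> False).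
{ intros v Hv Hpv HvB Hcv Hvw Hph. destruct (Rlt_le_dec (nm N (w k1)) d) as [Hl|Hl].
  - specialize (Hcv (vadd a k1)). rewrite <- Hvw in Hcv at 2. rewrite dist_nm, vsub_add in Hcv.
    specialize (Hcv (HKo k1 (conj Hk1i (conj Ht1 Hw1))) Hl). apply Rabs_def2 in Hcv.
    assert (0 <= m * nrm2 N (w k1)) by (apply Rmult_le_pos; lra). lra.
  - assert (d * d <= nrm2 N (w k1)) by (rewrite <- nm_sq; nra).
    assert (m * (d * d) <= m * nrm2 N (w k1)) by (apply Rmult_le_compat_l; lra). lra. }
assert (Ht0 : 0 < t).
{ apply Rnot_le_lt; intros Hle. assert (Et : t = 0) by lra.
  apply (Hend a); auto; try (unfold Bq; lra).
  - intros y Hy Hay; apply Hda'; auto; lra.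
  - f_equal. rewrite (Hdec k1) at 2. fold t. rewrite Et. apply functional_extensionality; intros; unfold vadd, vsc; ring.
  - unfold phi. fold t. unfold q. rewrite Et. ring. }
assert (Ht1' : t < 1).
{ apply Rnot_le_lt; intros Hle. assert (Et : t = 1) by lra.
  apply (Hend b); auto; try (unfold Bq; lra).
  - intros y Hy Hay; apply Hdb'; auto; lra.
  - rewrite (Hdec k1) at 2. fold t. rewrite Et, <- Hae. apply functional_extensionality; intros; unfold vadd, vsc; ring.
  - unfold phi. fold t. unfold q. rewrite Et. ring. }
assert (HwR : nm N (w k1) < R).
{ apply nm_lt; [lra|]. apply Rnot_le_lt; intros Hle. unfold phi in Hval. fold t in Hval.
  pose proof (HqB t ltac:(lra)). assert (m * (R * R) <= m * nrm2 N (w k1)) by (apply Rmult_le_compat_l; lra). lra. }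
set (p := vadd (vsc ((psi b - psi a + c / 2 * ((1 - 2 * t) * E)) / E) e) (vsc (- 2 * m) (w k1))).
set (X := madd (msc ((2 * m - c) / E) (outer e)) (idm (- 2 * m))).
assert (HX : lambda N N X < - c).
{ apply (Hsup (vadd a k1) p X).
  { apply InRn_vadd; auto. }
  { apply HKn; split; auto. }
  split; [|split].
  - unfold p. apply InRn_vadd; apply InRn_vsc; auto. unfold w. apply InRn_vsub; auto. apply InRn_vsc; auto.
  - apply sym_madd; [apply sym_msc, sym_outer|apply sym_idm].
  - intros eps Heps. set (mt := Rmin t (1 - t)). assert (Hmt : 0 < mt) by (apply Rmin_pos; lra).
    assert (Hmt1 : mt <= t) by apply Rmin_l. assert (Hmt2 : mt <= 1 - t) by apply Rmin_r. clearbody mt.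
    exists (Rmin (mt * s) (R - nm N (w k1))). split; [apply Rmin_pos; [apply Rmult_lt_0_compat|]; lra|].
    intros y Hy Hyd. rewrite dist_nm in Hyd.
    pose proof (Rmin_l (mt * s) (R - nm N (w k1))) as M1. pose proof (Rmin_r (mt * s) (R - nm N (w k1))) as M2.
    set (k := vsub y (vadd a k1)) in *.
    assert (Hki : InRn N k) by (apply InRn_vsub; auto; apply InRn_vadd; auto).
    assert (Hyk : vadd a (vadd k1 k) = y).
    { apply functional_extensionality; intros; unfold k, vadd, vsub; ring. }
    assert (Htk : tau (vadd k1 k) = t + dot N e k / E).
    { unfold t, tau. rewrite dot_addr. field; lra. }
    assert (Hwk : nrm2 N (w (vadd k1 k)) = nrm2 N (w k1) + 2 * dot N (w k1) k + nrm2 N k - dot N e k * dot N e k / E).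
    { rewrite !Hwn, nrm2_add, dot_addr. unfold w. rewrite dot_subl, dot_scl. unfold tau. field; lra. }
    assert (Hdk : - (mt * E) <= dot N e k <= mt * E).
    { pose proof (dot_abs N e k) as H. fold s in H. apply Rabs_le_bounds in H.
      assert (s * nm N k <= s * (mt * s)) by (apply Rmult_le_compat_l; lra). unfold E. lra. }
    assert (Hdk2 : - mt <= dot N e k / E <= mt).
    { split; apply Rmult_le_reg_r with E; auto; unfold Rdiv; rewrite Rmult_assoc, Rinv_l by lra; lra. }
    assert (HK : Ks (vadd k1 k)).
    { split; [apply InRn_vadd; auto|]. rewrite Htk. split; [lra|].
      apply nrm2_le. replace (w (vadd k1 k)) with (vadd (w k1) (w k)).
      - assert (nm N (w k) <= nm N k).
        { apply nm_le; [apply nm_ge0|]. rewrite nm_sq, Hwn.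
          assert (0 <= dot N e k * dot N e k / E).
          { apply Rmult_le_pos; [nra|left; apply Rinv_0_lt_compat; auto]. } lra. }
        pose proof (nm_add N (w k1) (w k)). lra.
      - apply functional_extensionality; intros; unfold w. unfold tau. rewrite dot_addr. unfold vadd, vsub, vsc. field; lra. }
    specialize (Hk1m _ HK). rewrite Hyk in Hk1m. unfold phi in Hk1m. rewrite Htk, Hwk in Hk1m. fold t in Hk1m.
    unfold q in Hk1m. unfold p, X. rewrite dot_addl, !dot_scl, quad_madd, quad_msc, quad_outer, quad_idm.
    assert (0 <= eps * nrm2 N k) by (apply Rmult_le_pos; [lra|apply nrm2_ge0]).
    set (D := dot N e k) in *.
    replace ((psi b - psi a + c / 2 * ((1 - 2 * t) * E)) / E * D)
      with (D / E * (psi b - psi a) + c / 2 * ((1 - 2 * t) * D)) by (field; lra).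
    replace ((t + D / E) * (1 - (t + D / E)) * E) with (t * (1 - t) * E + (1 - 2 * t) * D - D * D / E) in Hk1m by (field; lra).
    replace (/ 2 * ((2 * m - c) / E * (D * D) + -2 * m * nrm2 N k)) with
      (m * (D * D / E) - c / 2 * (D * D / E) - m * nrm2 N k) by (field; lra).
    lra. }
assert (H1 : quad N X (vsc (/ s) e) <= lambda N N X).
{ apply lambda_max_ge; auto. rewrite nrm2_sc, <- Hs2. unfold E. field; lra. }
unfold X in H1. rewrite quad_madd, quad_msc, quad_outer, quad_idm, dot_scr, nrm2_sc in H1.
change (dot N e e) with (nrm2 N e) in H1. rewrite <- Hs2 in H1. fold E in H1.
assert (EE : (2 * m - c) / E * (/ s * E * (/ s * E)) + -2 * m * (/ s * / s * E) = - c) by (unfold E; field; lra).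
fold X in H1. lra.
Qed.

(** By continuity [mu * psi] exceeds [c] near [x0], so [segment_concave] makes
    [psi + c / 2 * nrm2 (x - x0)] concave there; its supergradient at [x0] is the required slope. *)
Lemma concave_upper_paraboloid N Om psi mu x0 eps : (1 <= N)%nat -> open_in N Om -> 0 < mu ->
  continuous_on N Om psi -> (forall x, Om x -> 0 < psi x) ->
  (forall x p X, Om x -> subjet N Om psi x p X -> - lambda N N X - mu * psi x >= 0) ->
  Om x0 -> 0 < eps ->
  exists p d, InRn N p /\ 0 < d /\ forall y, Om y -> dist N x0 y < d ->
    psi y <= psi x0 + dot N p (vsub y x0) - / 2 * ((mu * psi x0 - eps) * nrm2 N (vsub y x0)).
Proof.
intros HN [HOm Hopen] Hmu Hpsi Hpos Hsup Hx0 He.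
destruct (Hopen x0 Hx0) as [r1 [Hr1 Hr1']].
destruct (Hpsi x0 Hx0 (eps / mu)) as [r2 [Hr2 Hr2']]; [apply Rdiv_lt_0_compat; auto|].
set (R := Rmin r1 r2 / 3).
assert (HR : 0 < R) by (unfold R; assert (0 < Rmin r1 r2) by (apply Rmin_pos; lra); lra).
assert (HR1 : 2 * R < r1) by (pose proof (Rmin_l r1 r2); unfold R in *; lra).
assert (HR2 : 2 * R < r2) by (pose proof (Rmin_r r1 r2); unfold R in *; lra). clearbody R.
set (c := mu * psi x0 - eps).
assert (Hb : forall x, InRn N x -> nm N (vsub x x0) <= 2 * R -> Om x).
{ intros x Hx Hd. apply Hr1'; auto. rewrite dist_nm; lra. }
assert (Hc : forall x p X, InRn N x -> nm N (vsub x x0) <= 2 * R -> subjet N Om psi x p X -> lambda N N X < - c).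
{ intros x p X Hx Hd Hj. pose proof (Hb x Hx Hd) as Ho. specialize (Hsup x p X Ho Hj).
  specialize (Hr2' x Ho). rewrite dist_nm in Hr2'. specialize (Hr2' ltac:(lra)). apply Rabs_def2 in Hr2'.
  assert (mu * (psi x0 - eps / mu) < mu * psi x) by (apply Rmult_lt_compat_l; lra).
  replace (mu * (psi x0 - eps / mu)) with c in H by (unfold c; field; lra). lra. }
destruct (concave_supergradient N (fun x => psi x + c / 2 * nrm2 N (vsub x x0)) x0 R) as [p [Hp Hpp]]; auto.
- apply cont_plus; [|apply cont_scal, cont_nrm2_sub].
  apply cont_subset with (2 := Hpsi). intros x [Hx1 Hx2]; apply Hb; auto. apply nm_le in Hx2; lra.
- intros a b th Ha Hb' Hth.
  pose proof (segment_concave N Om psi c x0 R a b th HN HR HOm (HOm _ Hx0) Hb Hpsi Hpos) as H.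
  assert (H1 : vsub (vadd a (vsc th (vsub b a))) x0 = vadd (vsc (1 - th) (vsub a x0)) (vsc th (vsub b x0))).
  { apply functional_extensionality; intros; unfold vadd, vsub, vsc; ring. }
  rewrite H1, nrm2_add, dot_scl, dot_scr, !nrm2_sc.
  replace (vsub b a) with (vsub (vsub b x0) (vsub a x0)) in H at 1.
  2:{ apply functional_extensionality; intros; unfold vsub; ring. }
  rewrite nrm2_sub, (dot_sym N (vsub b x0)) in H.
  assert (H2 : (1 - th) * psi a + th * psi b + c / 2 * (th * (1 - th) *
    (nrm2 N (vsub b x0) - 2 * dot N (vsub a x0) (vsub b x0) + nrm2 N (vsub a x0))) <=
    psi (vadd a (vsc th (vsub b a)))) by (apply H; auto).
  lra.
- exists p, R. split; [auto|split; [auto|]]. intros y Hy Hd. rewrite dist_nm in Hd.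
  assert (Hyb : ball N x0 R y) by (split; auto; apply nrm2_le; lra).
  specialize (Hpp y Hyb).
  rewrite (nrm2_ext N (vsub x0 x0) zero), nrm2_0 in Hpp by (intros; unfold vsub, zero; ring).
  fold c. lra.
Qed.

(** * Perturbing the stationary solution by the eigenfunction *)

Lemma exp_growth_bound s : 0 <= s < 1 -> exp s - 1 <= s / (1 - s).
Proof.
intros Hs. pose proof (exp_ineq1_le (- s)) as H. rewrite exp_Ropp in H.
pose proof (exp_pos s) as He.
assert (H1 : exp s * (1 - s) <= 1).
{ apply (Rmult_le_compat_l (exp s)) in H; [|lra]. rewrite Rinv_r in H by lra. lra. }
apply Rmult_le_reg_r with (1 - s); [lra|]. unfold Rdiv. rewrite Rmult_assoc, Rinv_l by lra. lra.
Qed.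

Section subsolution.
Variables (N : nat) (Om OmR : pt -> Prop) (F : mat -> R) (psi z : pt -> R) (mu C : R).
Hypothesis HF : forall X Y c, (forall v, quad N X v <= quad N Y v + c * nrm2 N v) -> F X <= F Y + c.
Hypotheses (HN : (1 <= N)%nat) (HmuC : 0 < mu /\ 0 < C) (Hopen : open_in N OmR)
  (Hin : forall x, Om x -> OmR x) (HOm : forall x, Om x -> InRn N x)
  (Hpsi : continuous_on N OmR psi) (Hpos : forall x, OmR x -> 0 < psi x)
  (Hsup : forall x p X, OmR x -> subjet N OmR psi x p X -> - lambda N N X - mu * psi x >= 0)
  (Hz : forall x p X, Om x -> superjet N Om z x p X -> 0 <= F X).

(** Time and space decouple. For fixed [x] the function is smooth in time with derivative [B], so
    [a <= B]. For fixed time, [C * th] times the upper paraboloid of [psi] added to a jet of the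
    difference is a jet of [z], so [B <= F X] up to an error tending to zero. *)
Lemma perturbed_subsol : par_subsol N Om F (fun x t => z x - C * exp (- mu * t) * psi x).
Proof.
destruct HmuC as [Hmu HC].
intros x t a p X Hx Ht [Hp [HX Hj]].
set (th := exp (- mu * t)) in *. assert (Hth : 0 < th) by apply exp_pos.
assert (Hpx : 0 < psi x) by (apply Hpos; auto).
assert (Hself : vsub x x = zero) by (apply functional_extensionality; intros; unfold vsub, zero; ring).
assert (Hdist0 : forall d, 0 < d -> dist N x x < d).
{ intros d Hd; rewrite dist_nm, Hself. unfold nm; rewrite nrm2_0, sqrt_0; auto. }
set (B := C * th * psi x * mu).
assert (HCt : 0 < C * th) by (apply Rmult_lt_0_compat; auto).
assert (HB : 0 < B) by (repeat apply Rmult_lt_0_compat; auto).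
assert (Hcp : 0 < C * th * psi x) by (apply Rmult_lt_0_compat; auto).
assert (HaB : a <= B).
{ apply Rnot_lt_le; intros Hlt.
  destruct (Hj ((a - B) / 2)) as [d [Hd Hd']]; [lra|].
  (* Test at the earlier time [t - h], with [h] so small that the factor [1 - mu * h] costs at most
     half of the excess. *)
  set (h := Rmin (Rmin (d / 2) (t / 2)) ((a - B) / (2 * mu * (a + B)))).
  assert (Hmab : 0 < 2 * mu * (a + B)) by (repeat apply Rmult_lt_0_compat; lra).
  assert (Hh : 0 < h).
  { apply Rmin_pos; [apply Rmin_pos; lra|]. apply Rdiv_lt_0_compat; lra. }
  assert (Hh1 : h <= d / 2) by (apply Rle_trans with (1 := Rmin_l _ _); apply Rmin_l).
  assert (Hh2 : h <= t / 2) by (apply Rle_trans with (1 := Rmin_l _ _); apply Rmin_r).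
  assert (Hh3 : h * (2 * mu * (a + B)) <= a - B).
  { apply Rle_trans with ((a - B) / (2 * mu * (a + B)) * (2 * mu * (a + B))); [|right; field; lra].
    apply Rmult_le_compat_r; [lra|apply Rmin_r]. }
  clearbody h.
  specialize (Hd' x (t - h) Hx ltac:(lra) (Hdist0 d Hd)).
  replace (t - h - t) with (- h) in Hd' by ring. rewrite Rabs_Ropp, Rabs_right in Hd' by lra.
  specialize (Hd' ltac:(lra)). rewrite Hself, dot_0r, quad_0, nrm2_0 in Hd'.
  replace (- mu * (t - h)) with (- mu * t + mu * h) in Hd' by ring. rewrite exp_plus in Hd'. fold th in Hd'.
  assert (Hmh : 0 < mu * h) by (apply Rmult_lt_0_compat; auto).
  assert (Hmh2 : mu * h <= / 2).
  { apply Rmult_le_reg_r with (2 * (a + B)); lra. }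
  pose proof (exp_growth_bound (mu * h) ltac:(lra)) as He.
  apply (Rmult_le_compat_l (C * th * psi x)) in He; [|lra].
  assert (H1 : (a + B) / 2 * h <= C * th * psi x * (mu * h / (1 - mu * h))) by lra.
  apply (Rmult_le_compat_r (1 - mu * h)) in H1; [|lra].
  replace (C * th * psi x * (mu * h / (1 - mu * h)) * (1 - mu * h)) with (h * B) in H1 by (unfold B; field; lra).
  assert (H2 : (a + B) / 2 * (1 - mu * h) <= B) by (apply Rmult_le_reg_l with h; lra).
  lra. }
assert (Hall : forall eps, 0 < eps -> B <= F X + C * th * eps).
{ intros eps He.
  destruct (concave_upper_paraboloid N OmR psi mu x eps HN Hopen Hmu Hpsi Hpos Hsup (Hin x Hx) He)
    as [q [d1 [Hq [Hd1 Hq']]]].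
  set (c := mu * psi x - eps) in *.
  assert (H : 0 <= F (madd X (idm (- (C * th * c))))).
  { apply (Hz x (vadd p (vsc (C * th) q))); auto.
    split; [apply InRn_vadd; auto; apply InRn_vsc; auto|split].
    - apply sym_madd; auto using sym_idm.
    - intros e1 He1. destruct (Hj e1 He1) as [d2 [Hd2 Hd2']].
      exists (Rmin d1 d2); split; [apply Rmin_pos; lra|]. intros y Hy Hd.
      pose proof (Rmin_l d1 d2); pose proof (Rmin_r d1 d2).
      specialize (Hq' y (Hin y Hy) ltac:(lra)).
      specialize (Hd2' y t Hy Ht ltac:(lra)).
      replace (t - t) with 0 in Hd2' by ring. rewrite Rabs_R0 in Hd2'. specialize (Hd2' Hd2). fold th in Hd2'.
      apply (Rmult_le_compat_l (C * th)) in Hq'; [|lra].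
      rewrite dot_addl, dot_scl, quad_madd, quad_idm. lra. }
  assert (H1 : F (madd X (idm (- (C * th * c)))) <= F X + - (C * th * c)).
  { apply HF; intros v. rewrite quad_madd, quad_idm. lra. }
  unfold c, B in *. lra. }
apply Rle_trans with (1 := HaB). apply Rnot_lt_le; intros Hlt.
specialize (Hall ((B - F X) / (2 * (C * th)))).
assert (0 < (B - F X) / (2 * (C * th))) by (apply Rdiv_lt_0_compat; lra). specialize (Hall H).
replace (C * th * ((B - F X) / (2 * (C * th)))) with ((B - F X) / 2) in Hall by (field; lra). lra.
Qed.
End subsolution.

Lemma cyl_cont_opp N S u : continuous_on_cyl N S u -> continuous_on_cyl N S (fun x t => - u x t).
Proof.
intros H x t Hx Ht eps He; destruct (H x t Hx Ht eps He) as [d [Hd Hd']]; exists d; split; auto.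
intros y s Hy Hs H1 H2. replace (- u y s - - u x t) with (- (u y s - u x t)) by ring. rewrite Rabs_Ropp; auto.
Qed.

Lemma cyl_cont_perturbed N S z psi mu C : 0 < mu -> 0 < C -> continuous_on N S z -> continuous_on N S psi ->
  continuous_on_cyl N S (fun x t => z x - C * exp (- mu * t) * psi x).
Proof.
intros Hmu HC Hz Hpsi x t Hx Ht eps He.
set (Q := C * (Rabs (psi x) + 1)). pose proof (Rabs_pos (psi x)) as Hp.
assert (HQ : 0 < Q) by (apply Rmult_lt_0_compat; lra).
destruct (Hz x Hx (eps / 3)) as [d1 [Hd1 Hd1']]; [lra|].
destruct (Hpsi x Hx (eps / (3 * C))) as [d2 [Hd2 Hd2']]; [apply Rdiv_lt_0_compat; lra|].
assert (Hc : continuity (fun s => exp (- mu * s))) by (apply derivable_continuous; reg).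
destruct (Hc t (eps / (3 * Q))) as [d3 [Hd3 Hd3']]; [apply Rdiv_lt_0_compat; lra|].
exists (Rmin (Rmin d1 d2) d3); split; [repeat apply Rmin_pos; lra|].
intros y s Hy Hs Hxy Hts.
pose proof (Rmin_l (Rmin d1 d2) d3). pose proof (Rmin_r (Rmin d1 d2) d3).
pose proof (Rmin_l d1 d2). pose proof (Rmin_r d1 d2).
specialize (Hd1' y Hy ltac:(lra)). specialize (Hd2' y Hy ltac:(lra)).
assert (H3 : Rabs (exp (- mu * s) - exp (- mu * t)) < eps / (3 * Q)).
{ destruct (Req_dec s t) as [->|Hne]; [rewrite Rminus_diag, Rabs_R0; apply Rdiv_lt_0_compat; lra|].
  apply Hd3'. split; [split; [exact I|auto]|]. simpl. unfold R_dist. lra. }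
assert (Hs1 : 0 < exp (- mu * s) <= 1).
{ split; [apply exp_pos|]. rewrite <- exp_0. destruct (Req_dec s 0) as [->|Hne]; [right; f_equal; ring|].
  left; apply exp_increasing. nra. }
replace (z y - C * exp (- mu * s) * psi y - (z x - C * exp (- mu * t) * psi x)) with
  ((z y - z x) + (- C * (exp (- mu * s) * (psi y - psi x)) + - C * ((exp (- mu * s) - exp (- mu * t)) * psi x))) by ring.
apply Rle_lt_trans with (1 := Rabs_triang _ _).
pose proof (Rabs_triang (- C * (exp (- mu * s) * (psi y - psi x))) (- C * ((exp (- mu * s) - exp (- mu * t)) * psi x))) as T.
rewrite !Rabs_mult, Rabs_Ropp, (Rabs_right C), (Rabs_right (exp (- mu * s))) in T by lra.
set (D := Rabs (exp (- mu * s) - exp (- mu * t))) in *. pose proof (Rabs_pos (psi y - psi x)).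
assert (C * (exp (- mu * s) * Rabs (psi y - psi x)) < eps / 3).
{ apply Rle_lt_trans with (C * Rabs (psi y - psi x)); [apply Rmult_le_compat_l; nra|].
  replace (eps / 3) with (C * (eps / (3 * C))) by (field; lra). apply Rmult_lt_compat_l; auto. }
assert (C * (D * Rabs (psi x)) <= eps / 3).
{ assert (0 <= D) by apply Rabs_pos.
  apply Rle_trans with (Q * D); [unfold Q; nra|].
  replace (eps / 3) with (Q * (eps / (3 * Q))) by (field; lra). apply Rmult_le_compat_l; lra. }
lra.
Qed.

(** * The two exponential bounds *)

Lemma quad_neg n X v : quad n (msc (-1) X) v = - quad n X v.
Proof. rewrite quad_msc; ring. Qed.

Lemma dot_neg n p v : dot n (vsc (-1) p) v = - dot n p v.
Proof. rewrite dot_scl; ring. Qed.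

Theorem theorem3p2 (N j : nat) (Omega OmegaR : pt -> Prop)
  (u0 g psiR z : pt -> R) (u : pt -> R -> R) (muR : R) :
  (1 <= N)%nat -> (1 <= j)%nat -> (j <= N)%nat ->
  is_domain N Omega -> bounded_set N Omega ->
  continuous_on N (cl N Omega) u0 ->
  (forall x, boundary N Omega x -> u0 x = g x) ->
  is_domain N OmegaR -> bounded_set N OmegaR -> strictly_convex N OmegaR ->
  (forall x, cl N Omega x -> OmegaR x) ->
  muR > 0 ->
  continuous_on N (cl N OmegaR) psiR ->
  (forall x, OmegaR x -> psiR x > 0) ->
  (forall x, boundary N OmegaR x -> psiR x = 0) ->
  visc_solution N OmegaR (fun _ r X => - lambda N N X - muR * r) psiR ->
  (* u: viscosity solution of the parabolic problem, continuous up to the boundary *)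
  continuous_on_cyl N (cl N Omega) u ->
  visc_solution_par N j Omega u ->
  (forall x t, boundary N Omega x -> t > 0 -> u x t = g x) ->
  (forall x, cl N Omega x -> u x 0 = u0 x) ->
  (* z: viscosity solution of lambda_j(D^2 z) = 0, continuous up to the boundary *)
  continuous_on N (cl N Omega) z ->
  visc_solution N Omega (fun _ _ X => - lambda N j X) z ->
  (forall x, boundary N Omega x -> z x = g x) ->
  exists C1 C2 : R, C1 > 0 /\ C2 > 0 /\
    forall x t, Omega x -> t > 0 ->
      z x + C1 * exp (- muR * t) * (- psiR x) <= u x t /\
      u x t <= z x + C2 * exp (- muR * t) * psiR x.
Proof.
intros HN Hj HjN [Hopen [_ Hne]] Hbd Hu0 Hu0g [HopenR _] _ _ Hin Hmu Hpsi Hpos _ [_ Hpsisup]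
  Huc [Husub Husup] Hulat Huini Hzc [Hzsub Hzsup] Hzb.
pose proof (proj1 Hopen) as HOm. pose proof (proj1 HopenR) as HOmR.
assert (Hcl : forall x, Omega x -> cl N Omega x) by (intros; apply cl_incl; auto).
assert (HinO : forall x, Omega x -> OmegaR x) by auto.
assert (HpsiR : continuous_on N OmegaR psiR).
{ apply cont_subset with (2 := Hpsi). intros; apply cl_incl; auto. }
assert (Hpsicl : continuous_on N (cl N Omega) psiR) by (apply cont_subset with (2 := HpsiR); auto).
destruct (cl_bounded N Omega Hbd) as [M HM]. pose proof (cl_closed N Omega) as Hcc.
assert (Hnec : exists x, cl N Omega x) by (destruct Hne; eauto).
destruct (evt N _ M (fun x => - psiR x) Hnec HM Hcc (cont_opp _ _ _ Hpsicl)) as [xp [Hxp Hxpm]].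
destruct (evt N _ M (fun x => u0 x - z x) Hnec HM Hcc (cont_minus _ _ _ _ Hu0 Hzc)) as [x1 [_ Hx1]].
destruct (evt N _ M (fun x => z x - u0 x) Hnec HM Hcc (cont_minus _ _ _ _ Hzc Hu0)) as [x2 [_ Hx2]].
pose proof (Hpos xp (Hin xp Hxp)) as Hpxp.
(* [B] dominates [u0 - z] and [z - u0], and [psiR xp] is the minimum of [psiR] over the closure of
   [Omega]; hence [C * psiR] dominates the initial difference on both sides. *)
set (B := Rabs (u0 x1 - z x1) + Rabs (z x2 - u0 x2) + 1).
pose proof (Rabs_pos (u0 x1 - z x1)) as A1. pose proof (Rabs_pos (z x2 - u0 x2)) as A2.
set (C := B / psiR xp).
assert (HC : 0 < C) by (apply Rdiv_lt_0_compat; unfold B; lra).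
assert (HCB : forall x, cl N Omega x -> B <= C * psiR x).
{ intros x Hx. apply Rle_trans with (C * psiR xp); [right; unfold C; field; lra|].
  apply Rmult_le_compat_l; [lra|]. specialize (Hxpm x Hx). lra. }
assert (HCpos : forall x t, cl N Omega x -> 0 < C * exp (- muR * t) * psiR x).
{ intros x t Hx. apply Rmult_lt_0_compat; [|apply Hpos; auto]. apply Rmult_lt_0_compat; [exact HC|apply exp_pos]. }
exists C, C. split; [auto|split; [auto|]].
assert (HF : forall X Y c, (forall v, quad N X v <= quad N Y v + c * nrm2 N v) ->
  lambda N j X <= lambda N j Y + c) by (intros; apply lambda_le; auto).
(* The dual operator, in fact the eigenvalue of index [N + 1 - j]; that identity is avoided because
   the shift property passes to it directly. *)
set (F2 := fun X => - lambda N j (msc (-1) X)).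
assert (HF2 : forall X Y c, (forall v, quad N X v <= quad N Y v + c * nrm2 N v) -> F2 X <= F2 Y + c).
{ intros X Y c H. unfold F2. assert (lambda N j (msc (-1) Y) <= lambda N j (msc (-1) X) + c); [|lra].
  apply HF; intros v. rewrite !quad_neg. specialize (H v). lra. }
assert (Hsupp : forall x p X, OmegaR x -> subjet N OmegaR psiR x p X -> - lambda N N X - muR * psiR x >= 0).
{ intros x p X Hx H; apply (Hpsisup x p X); auto. }
assert (Hpos' : forall x, OmegaR x -> 0 < psiR x) by (intros x Hx; apply Hpos; auto).
assert (Hs1 : par_subsol N Omega (lambda N j) u).
{ intros x t a p X Hx Ht H. specialize (Husub x t a p X Hx Ht H). lra. }
assert (Hs2 : par_subsol N Omega F2 (fun x t => - u x t)).
{ intros x t a p X Hx Ht [Hp [HX H]].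
  assert (Hjet : par_subjet N Omega u x t (- a) (vsc (-1) p) (msc (-1) X)).
  { split; [apply InRn_vsc; auto|split; [apply sym_msc; auto|]].
    intros eps He; destruct (H eps He) as [d [Hd Hd']]; exists d; split; auto.
    intros y s Hy Hs Hxy Hts. specialize (Hd' y s Hy Hs Hxy Hts). rewrite dot_neg, quad_neg. lra. }
  specialize (Husup x t _ _ _ Hx Ht Hjet). unfold F2; lra. }
assert (Hs3 : par_subsol N Omega (lambda N j) (fun x t => z x - C * exp (- muR * t) * psiR x)).
{ apply perturbed_subsol with OmegaR; auto.
  intros x p X Hx H. specialize (Hzsub x p X Hx H). simpl in Hzsub. lra. }
(* Minus the upper barrier has the same perturbed form, with [- z] for [z] and the dual operator, so
   [perturbed_subsol] applies again. *)
assert (Hs4 : par_subsol N Omega F2 (fun x t => - z x - C * exp (- muR * t) * psiR x)).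
{ apply perturbed_subsol with (OmR := OmegaR) (z := fun x => - z x); auto.
  intros x p X Hx [Hp [HX H]].
  assert (Hjet : subjet N Omega z x (vsc (-1) p) (msc (-1) X)).
  { split; [apply InRn_vsc; auto|split; [apply sym_msc; auto|]].
    intros eps He; destruct (H eps He) as [d [Hd Hd']]; exists d; split; auto.
    intros y Hy Hxy. specialize (Hd' y Hy Hxy). rewrite dot_neg, quad_neg. lra. }
  specialize (Hzsup x _ _ Hx Hjet). unfold F2; lra. }
assert (He0 : forall x, C * exp (- muR * 0) * psiR x = C * psiR x).
{ intros x. rewrite Rmult_0_r, exp_0. ring. }
intros x t Hx Ht. split.
- pose proof (comparison N Omega (lambda N j) HF Hopen Hbd _ _
    (cyl_cont_perturbed N _ z psiR muR C Hmu HC Hzc Hpsicl) (cyl_cont_opp N _ u Huc) Hs3 Hs2) as H.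
  cbv beta in H. specialize (fun A B => H A B x t Hx Ht).
  assert (z x - C * exp (- muR * t) * psiR x + - u x t <= 0); [apply H|lra].
  + intros y s Hy Hs. rewrite (Hzb y Hy), (Hulat y s Hy Hs). pose proof (HCpos y s (proj1 Hy)). lra.
  + intros y Hy. rewrite (Huini y Hy), He0. pose proof (HCB y Hy). pose proof (Hx2 y Hy).
    pose proof (Rle_abs (z x2 - u0 x2)). unfold B in *. lra.
- pose proof (comparison N Omega (lambda N j) HF Hopen Hbd _ _ Huc
    (cyl_cont_perturbed N _ (fun x => - z x) psiR muR C Hmu HC (cont_opp _ _ _ Hzc) Hpsicl) Hs1 Hs4) as H.
  cbv beta in H. specialize (fun A B => H A B x t Hx Ht).
  assert (u x t + (- z x - C * exp (- muR * t) * psiR x) <= 0); [apply H|lra].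
  + intros y s Hy Hs. rewrite (Hzb y Hy), (Hulat y s Hy Hs). pose proof (HCpos y s (proj1 Hy)). lra.
  + intros y Hy. rewrite (Huini y Hy), He0. pose proof (HCB y Hy). pose proof (Hx1 y Hy).
    pose proof (Rle_abs (u0 x1 - z x1)). unfold B in *. lra.
Qed.
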